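(* Let $\gamma\colon[a,b]\to\mathbf{R}^3$ be a rectifiable curve with length $L$ and inradius $r$. Then $$L\geq \sqrt{(\pi+2)^2+36}\;r\;(>7.9104\,r).$$ Furthermore, if $\gamma$ is closed (i.e. $\gamma(a)=\gamma(b)$), then $$L\geq 6\sqrt{3}\,r\;(>10.3923\,r).$$
   Context: A curve is a continuous map $\gamma\colon[a,b]\to\mathbf{R}^3$; its length $L$ is the supremum of $\sum_{i}\|\gamma(t_i)-\gamma(t_{i-1})\|$ over all partitions of $[a,b]$, and $\gamma$ is rectifiable if $L<\infty$. The inradius $r$ of $\gamma$ is the supremum of the radii of all spheres which are contained in the convex hull of $\gamma([a,b])$ and are disjoint from $\gamma([a,b])$.
   Formalization: The decimal remarks are left out: ''> 7.9104 r'' is false, since sqrt((pi+2)^2+36) is about 7.9016, and ''> 10.3923 r'' is a direct numeric consequence of 6 sqrt(3); both inequalities are stated with their exact constants. *)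

(* Defs.v *)
From Stdlib Require Import Reals Lra.
From Coquelicot Require Import Coquelicot.
Open Scope R_scope.

Definition pt := (R * R * R)%type.

Definition dist3 (p q : pt) : R :=
  let '(x1, y1, z1) := p in let '(x2, y2, z2) := q in
  sqrt ((x1 - x2)^2 + (y1 - y2)^2 + (z1 - z2)^2).

Definition padd (p q : pt) : pt :=
  let '(x1, y1, z1) := p in let '(x2, y2, z2) := q in (x1 + x2, y1 + y2, z1 + z2).

Definition pscale (c : R) (p : pt) : pt :=
  let '(x, y, z) := p in (c * x, c * y, c * z).

Fixpoint rsum (n : nat) (f : nat -> R) : R :=
  match n with O => 0 | S m => rsum m f + f m end.
Fixpoint psum (n : nat) (f : nat -> pt) : pt :=
  match n with O => (0, 0, 0) | S m => padd (psum m f) (f m) end.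

(* gamma : [a,b] -> R^3 is continuous (represented as a total function R -> R^3,
   only its values on [a,b] matter) *)
Definition continuous_on_ab (g : R -> pt) (a b : R) : Prop :=
  forall t, a <= t <= b -> forall eps, 0 < eps -> exists delta, 0 < delta /\
    forall s, a <= s <= b -> Rabs (s - t) < delta -> dist3 (g s) (g t) < eps.

Definition is_curve (g : R -> pt) (a b : R) : Prop :=
  a <= b /\ continuous_on_ab g a b.

Definition is_partition (a b : R) (n : nat) (t : nat -> R) : Prop :=
  t O = a /\ t n = b /\ forall i, (i < n)%nat -> t i <= t (S i).

Definition inscribed_sum (g : R -> pt) (n : nat) (t : nat -> R) : R :=
  rsum n (fun i => dist3 (g (t (S i))) (g (t i))).

Definition curve_length (g : R -> pt) (a b : R) : Rbar :=
  Lub_Rbar (fun s => exists n t, is_partition a b n t /\ s = inscribed_sum g n t).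

Definition rectifiable (g : R -> pt) (a b : R) : Prop :=
  is_finite (curve_length g a b).

Definition image (g : R -> pt) (a b : R) (p : pt) : Prop :=
  exists t, a <= t <= b /\ g t = p.

Definition convex_hull (S : pt -> Prop) (p : pt) : Prop :=
  exists (n : nat) (w : nat -> R) (q : nat -> pt),
    (forall i, (i < n)%nat -> 0 <= w i /\ S (q i)) /\
    rsum n w = 1 /\
    p = psum n (fun i => pscale (w i) (q i)).

Definition sphere (c : pt) (rho : R) (p : pt) : Prop := dist3 p c = rho.

Definition admissible_radius (g : R -> pt) (a b : R) (rho : R) : Prop :=
  0 < rho /\ exists c : pt,
    (forall p, sphere c rho p -> convex_hull (image g a b) p) /\
    (forall p, sphere c rho p -> ~ image g a b p).

Definition inradius (g : R -> pt) (a b : R) : Rbar :=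
  Lub_Rbar (admissible_radius g a b).

(* Main.v *)
(* Place the sphere so that it is the unit sphere about the origin.  The curve stays outside the
   ball, and every tangent plane of the ball separates some point of the curve from the ball:
   the caps C(x) = {p : p.x >= |p|}, for x on the curve, cover the space of directions.  The area
   of C(x), normalised to total 2, is 1 - 1/|x|.

   Take finitely many points of the curve (after shrinking the ball a little) whose caps still
   cover, as few as possible, so that no cap contains another one.  Comparing each cap with the
   next one, the areas of the symmetric differences C(x)^C(y) of consecutive caps sum to at least
   4 for a closed curve and to 2 + 1/|A| + 1/|B| for an arc from A to B.  An arc of length d from x
   to y satisfies d >= k area(C(x)^C(y)) with k = 3 sqrt 3 / 2: if the segment xy meets the ball,
   then d >= sqrt(|x|^2 - 1) + sqrt(|y|^2 - 1), while C(x) and C(y) have area at most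
   2 - 1/|x| - 1/|y| together; otherwise the whole line xy misses the ball, as no cap contains the
   other, and one moves the cap along the line infinitesimally, first along a tangent line of the
   ball, which changes the area by the change of 1/|x|, then by a rotation, whose effect is
   bounded by packing rotated copies of the difference in a band.  This gives 4k = 6 sqrt 3.

   For arcs, this bound is too weak when an endpoint is far away, but far from the ball the ratio
   of area to length is smaller than 1/k, which yields the stronger estimate
   d >= k area(C(x)^C(y)) + |Psi(|x|) - Psi(|y|)| for a suitable increasing Psi; the sum over the
   arc, split where it is closest to the ball, exceeds 7.902 > sqrt((pi + 2)^2 + 36). *)
Require Import Defs.
From Stdlib Require Import Reals Lra Lia Psatz ZArith Classical List Sorted Wf_nat Machin.
From Coquelicot Require Import Coquelicot.
From HB Require structures.
From mathcomp Require all_boot all_order all_algebra.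
From mathcomp Require all_classical all_reals all_analysis.
From mathcomp Require Rstruct measurable_realfun lebesgue_measure lebesgue_integral ring lra.
Open Scope R_scope.

(** * Solid angle *)

(** The constant k is the reciprocal of the largest ratio of area to length. At distance q from the
    point of contact, a point of a tangent line has radius sqrt(1 + q^2), and moving it outwards
    changes 1 - 1/|x| at the rate q / (1 + q^2)^(3/2). This is at most 2 / (3 sqrt 3), with equality
    at q^2 = 1/2.

    The sum is at least 4 because a covering must let every direction in and out: the cap that
    contains the direction opposite to p misses p, so along a closed chain p is entered at least
    once and left at least once, and each of the two contributes the whole area 2.

    A segment xy that meets the ball may be shorter than the two tangent lengths together, but the
    curve avoids the ball: it crosses the plane through the centre orthogonal to x - y at some point
    q outside, and |x - q| and |y - q| are then at least the tangent lengths. So the curve enters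
    only through inscribed polygons, with the sampled points and some such crossing points as
    vertices.

    For an arc with far endpoints k times the area yields only about 2k < 5.2; this is why the
    weights are needed. *)

Module SolidAngle.
Import HB.structures.
Import all_boot all_order all_algebra all_classical all_reals all_analysis.
Import measurable_realfun lebesgue_measure lebesgue_integral.
Import mathcomp.algebra_tactics.ring mathcomp.algebra_tactics.lra.
Import Order.TTheory GRing.Theory Num.Theory.
Import numFieldNormedType.Exports.
Local Open Scope classical_set_scope.
Local Open Scope ring_scope.
Set Implicit Arguments. Unset Strict Implicit. Unset Printing Implicit Defensive.

Section ProductSigmaFinite.
Context d1 d2 (T1 : measurableType d1) (T2 : measurableType d2) (R : realType).
Variables (m1 : {sigma_finite_measure set T1 -> \bar R}).
Variables (m2 : {sigma_finite_measure set T2 -> \bar R}).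

Lemma product_measure_sigma_finite : sigma_finite setT (m1 \x m2)%E.
Proof.
have /sigma_finiteP[F [TF ndF Foo]] := sigma_finiteT m1.
have /sigma_finiteP[G [TG ndG Goo]] := sigma_finiteT m2.
exists (fun n => F n `*` G n).
  apply/seteqP; split=> // -[x y] _.
  have : [set: T1] x by []. have : [set: T2] y by [].
  rewrite TF TG => -[k _ Gky] [n _ Fnx]; exists (maxn n k) => //; split.
    by move: x Fnx; exact/subsetPset/ndF/leq_maxl.
  by move: y Gky; exact/subsetPset/ndG/leq_maxr.
move=> k; have [? ?] := Foo k; have [? ?] := Goo k.
split; first exact: measurableX.
by rewrite product_measure1E// lte_mul_pinfty// ge0_fin_numE.
Qed.

End ProductSigmaFinite.

(** The product measure is named so that a sigma-finite structure can be attached to it; the product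
    with a third line requires one. *)
Definition planar_measure {R : realType} : set (measurableTypeR R * measurableTypeR R) -> \bar R :=
  (@lebesgue_measure R \x @lebesgue_measure R)%E.
HB.instance Definition _ (R : realType) := Measure.on (@planar_measure R).
HB.instance Definition _ (R : realType) := Measure_isSigmaFinite.Build _ _ _
  (@planar_measure R) (product_measure_sigma_finite (@lebesgue_measure R) (@lebesgue_measure R)).

Section SolidAngle.
Context {R : realType}.
Local Notation lam := (@lebesgue_measure R).
Local Notation lam2 := (@planar_measure R).
Local Notation lam3 := ((@planar_measure R \x @lebesgue_measure R)%E).

Lemma measurable_affine (c s : R) :
  measurable_fun setT (fun y : measurableTypeR R => c * y + s : measurableTypeR R).
Proof.
apply: measurable_funD; last exact: measurable_cst.
by apply: measurable_funM => //; exact: measurable_cst.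
Qed.

(** The right-hand side is a measure in [A] that agrees with [lam] on half-open intervals, so
    uniqueness of Lebesgue measure applies. *)
Lemma lebesgue_affine (c s : R) (A : set (measurableTypeR R)) : 0 < c -> measurable A ->
  lam A = (c%:E * lam ((fun y => (c * y + s)%R) @^-1` A))%E.
Proof.
move=> c0 mA.
have c0' : 0 <= c by exact: ltW.
pose f := fun y : measurableTypeR R => c * y + s : measurableTypeR R.
have mf : measurable_fun setT f by exact: measurable_affine.
have H := @lebesgue_measure_unique R (mscale (NngNum c0') (pushforward lam f)).
rewrite (H mf) // => X [[a b] _ <-] /=.
rewrite /mscale /=.
rewrite -[X in _ = (_ * X)%E]/(lam (f @^-1` `]a, b])).
have -> : f @^-1` [set` `]a, b] ] = [set` `](a - s) / c, (b - s) / c] ].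
  apply/seteqP; split => y; rewrite /f /= !in_itv /= ltr_pdivrMr // ler_pdivlMr //.
    by move=> /andP[h1 h2]; apply/andP; split; lra.
  by move=> /andP[h1 h2]; apply/andP; split; lra.
rewrite !lebesgue_measure_itv /= !lte_fin.
rewrite ltr_pM2r ?invr_gt0 // ltrD2r.
case: ifP => _; last by rewrite mule0.
rewrite -!EFinB -EFinM; congr EFin.
by field; rewrite gt_eqF.
Qed.

Section Slices.
Context d1 d2 (T1 : measurableType d1) (T2 : measurableType d2).
Variable m1 : {sigma_finite_measure set T1 -> \bar R}.
Variable m2 : {sigma_finite_measure set T2 -> \bar R}.
Local Open Scope ereal_scope.

Lemma product_measure12 (A : set (T1 * T2)) : measurable A ->
  (m1 \x m2) A = \int[m2]_y m1 (ysection A y).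
Proof.
move=> mA; rewrite -(setIT A) -integral_indic // -/(product_measure1 m1 m2).
by rewrite setIT indic_fubini_tonelli1 // indic_fubini_tonelli // indic_fubini_tonelli_GE.
Qed.

Lemma product_measure_preim2 (c : R) (f : T1 -> T2 -> T2) (A : set (T1 * T2)) :
  measurable_fun setT (fun p : T1 * T2 => (p.1, f p.1 p.2)) ->
  (0 <= c)%R ->
  (forall x B, measurable B -> m2 B = c%:E * m2 (f x @^-1` B)) ->
  measurable A ->
  (m1 \x m2) A = c%:E * (m1 \x m2) ((fun p => (p.1, f p.1 p.2)) @^-1` A).
Proof.
move=> mf c0 H mA.
have mFA : measurable ((fun p : T1 * T2 => (p.1, f p.1 p.2)) @^-1` A).
  by rewrite -[X in measurable X]setTI; exact: mf.
rewrite /product_measure1 -ge0_integralZl //; last by exact: measurable_fun_xsection.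
apply: eq_integral => x _ /=.
rewrite (H x); last exact: measurable_xsection.
congr (_ * m2 _); apply/seteqP; split => y; rewrite /xsection /= !inE; by [].
Qed.

Lemma product_measure_preim1 (c : R) (f : T2 -> T1 -> T1) (A : set (T1 * T2)) :
  measurable_fun setT (fun p : T1 * T2 => (f p.2 p.1, p.2)) ->
  (0 <= c)%R ->
  (forall x B, measurable B -> m1 B = c%:E * m1 (f x @^-1` B)) ->
  measurable A ->
  (m1 \x m2) A = c%:E * (m1 \x m2) ((fun p => (f p.2 p.1, p.2)) @^-1` A).
Proof.
move=> mf c0 H mA.
have mFA : measurable ((fun p : T1 * T2 => (f p.2 p.1, p.2)) @^-1` A).
  by rewrite -[X in measurable X]setTI; exact: mf.
rewrite !product_measure12 // -ge0_integralZl //; last by exact: measurable_fun_ysection.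
apply: eq_integral => x _ /=.
rewrite (H x); last exact: measurable_ysection.
congr (_ * m1 _); apply/seteqP; split => y; rewrite /ysection /= !inE; by [].
Qed.

End Slices.


Lemma integral_quadratic (u v a b : R) : (u < v)%R ->
  (\int[lam]_(z in `[u, v]) (a * z ^+ 2 + b)%:E =
  ((a / 3 * v ^+ 3 + b * v) - (a / 3 * u ^+ 3 + b * u))%:E)%E.
Proof.
move=> uv; pose F (z : R) : R := (a / 3 * z ^+ 3 + b * z)%R.
have dF (z : R) : is_derive z (1 : R) F (a * z ^+ 2 + b)%R.
  rewrite /F; apply: is_derive_eq; rewrite /GRing.scale /=; by field.
have dG (z : R) : is_derive z (1 : R) (fun z : R => a * z ^+ 2 + b)%R (2 * a * z)%R.
  apply: is_derive_eq; rewrite /GRing.scale /=; by ring.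
have cF (z : R) : {for z, continuous F}.
  by apply: differentiable_continuous; apply/derivable1_diffP; exact: (@ex_derive _ _ _ _ _ _ _ (dF z)).
rewrite (@continuous_FTC2 _ _ F) ?EFinB //.
- apply: derivable_within_continuous => z _; exact: (@ex_derive _ _ _ _ _ _ _ (dG z)).
- split.
  + by move=> z _; exact: (@ex_derive _ _ _ _ _ _ _ (dF z)).
  + by apply: cvg_at_right_filter; exact: cF.
  + by apply: cvg_at_left_filter; exact: cF.
- by move=> z _; rewrite derive1E; exact: (@derive_val _ _ _ _ _ _ _ (dF z)).
Qed.


Section Scales.
Local Open Scope ereal_scope.

(** [c] is the Jacobian of [f]. Only maps that are affine in one coordinate have to be treated
    directly; Fubini and composition yield dilations and rotations. *)
Definition scales d (T : measurableType d) (m : set T -> \bar R) (f : T -> T) (c : R) :=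
  measurable_fun setT f /\ forall A, measurable A -> m A = c%:E * m (f @^-1` A).

Lemma scales_comp d (T : measurableType d) (m : set T -> \bar R) f g (c c' : R) :
  scales m f c -> scales m g c' -> scales m (f \o g) (c * c').
Proof.
move=> [mf Hf] [mg Hg]; split; first exact: measurableT_comp.
move=> A mA; rewrite Hf // EFinM -muleA; congr (_ * _).
rewrite Hg //; by rewrite -[X in measurable X]setTI; exact: mf.
Qed.

Lemma scales_prod2 d1 d2 (T1 : measurableType d1) (T2 : measurableType d2)
  (m1 : {sigma_finite_measure set T1 -> \bar R})
  (m2 : {sigma_finite_measure set T2 -> \bar R}) (c : R) (f : T1 -> T2 -> T2) :
  measurable_fun setT (fun p : T1 * T2 => f p.1 p.2) -> (0 <= c)%R ->
  (forall x, scales m2 (f x) c) ->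
  scales (m1 \x m2) (fun p => (p.1, f p.1 p.2)) c.
Proof.
move=> mf c0 H.
have mF : measurable_fun setT (fun p : T1 * T2 => (p.1, f p.1 p.2)).
  by apply: measurable_fun_pair.
by split=> // A mA; apply: product_measure_preim2 => // x; exact: (H x).2.
Qed.

Lemma scales_prod1 d1 d2 (T1 : measurableType d1) (T2 : measurableType d2)
  (m1 : {sigma_finite_measure set T1 -> \bar R})
  (m2 : {sigma_finite_measure set T2 -> \bar R}) (c : R) (f : T2 -> T1 -> T1) :
  measurable_fun setT (fun p : T1 * T2 => f p.2 p.1) -> (0 <= c)%R ->
  (forall y, scales m1 (f y) c) ->
  scales (m1 \x m2) (fun p => (f p.2 p.1, p.2)) c.
Proof.
move=> mf c0 H.
have mF : measurable_fun setT (fun p : T1 * T2 => (f p.2 p.1, p.2)).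
  by apply: measurable_fun_pair.
by split=> // A mA; apply: product_measure_preim1 => // x; exact: (H x).2.
Qed.

Lemma scales_affine (c s : R) : (0 < c)%R ->
  scales lam (fun y : measurableTypeR R => (c * y + s)%R : measurableTypeR R) c.
Proof.
by move=> c0; split; [exact: measurable_affine | move=> A; exact: lebesgue_affine].
Qed.

Let T2 : measurableType _ := (measurableTypeR R * measurableTypeR R)%type.
Let T3 : measurableType _ := (measurableTypeR R * measurableTypeR R * measurableTypeR R)%type.

Lemma scales_affine2 (c t : R) : (0 < c)%R ->
  scales lam2 (fun p : T2 => (p.1, (c * p.2 + t * p.1)%R)) c.
Proof.
move=> c0; apply: (@scales_prod2 _ _ _ _ lam lam c (fun x y => (c * y + t * x)%R)).
- by apply: measurable_funD; apply: measurable_funM => //; exact: measurable_cst.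
- exact: ltW.
- by move=> x; exact: scales_affine.
Qed.

Lemma scales_affine1 (c t : R) : (0 < c)%R ->
  scales lam2 (fun p : T2 => ((c * p.1 + t * p.2)%R, p.2)) c.
Proof.
move=> c0; apply: (@scales_prod1 _ _ _ _ lam lam c (fun y x => (c * x + t * y)%R)).
- by apply: measurable_funD; apply: measurable_funM => //; exact: measurable_cst.
- exact: ltW.
- by move=> x; exact: scales_affine.
Qed.

(* A plane rotation other than the half turn is a product of three shears; [upd p a b]
   replaces the two coordinates [u p] and [v p] of [p]. *)
Lemma scales_rotation d (T : measurableType d) (m : set T -> \bar R)
  (u v : T -> R) (upd : T -> R -> R -> T) :
  (forall p a b, u (upd p a b) = a) -> (forall p a b, v (upd p a b) = b) ->
  (forall p a b a' b', upd (upd p a b) a' b' = upd p a' b') ->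
  (forall t, scales m (fun p => upd p (u p + t * v p)%R (v p)) 1%R) ->
  (forall t, scales m (fun p => upd p (u p) (v p + t * u p)%R) 1%R) ->
  forall c s : R, (c ^+ 2 + s ^+ 2 = 1)%R ->
  scales m (fun p => upd p (c * u p - s * v p)%R (s * u p + c * v p)%R) 1%R.
Proof.
move=> Hu Hv Hupd shu shv.
have H c s : (c ^+ 2 + s ^+ 2 = 1)%R -> (c != -1)%R ->
    scales m (fun p => upd p (c * u p - s * v p)%R (s * u p + c * v p)%R) 1%R.
  move=> e c1.
  (* This is the tangent of half the rotation angle. *)
  pose t := (s / (1 + c))%R.
  have h1 := shu (- t)%R.
  have := scales_comp h1 (scales_comp (shv s) h1); rewrite !mulr1.
  congr scales; apply/funext => p /=; rewrite !(Hu, Hv, Hupd).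
  set x := u p; set y := v p.
  have c1' : (1 + c != 0)%R by apply: contra c1; rewrite addrC addr_eq0.
  have su : (s * t = 1 - c)%R.
    have e2 : (s ^+ 2 = (1 - c) * (1 + c))%R by lra.
    by rewrite /t mulrA -expr2 e2 mulfK.
  have uc : (t * (1 + c) = s)%R by rewrite /t mulfVK.
  have h3 : (s * t * x = (1 - c) * x)%R by rewrite su.
  have h4 : (s * t * y = (1 - c) * y)%R by rewrite su.
  have h5 : (t * (s * t) * y = t * (1 - c) * y)%R by rewrite su.
  have h6 : (t * (1 + c) * y = s * y)%R by rewrite uc.
  by congr upd; lra.
(* The remaining half turn is the square of a quarter turn. *)
move=> c s e; have [c1|c1] := eqVneq c (-1)%R; last exact: H.
have s0 : (s = 0)%R by apply/eqP; rewrite -sqrf_eq0; apply/eqP; move: e; rewrite c1; lra.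
have h : scales m (fun p => upd p (0 * u p - 1 * v p)%R (1 * u p + 0 * v p)%R) 1%R.
  by apply: H; [rewrite expr0n expr1n add0r | rewrite eq_sym oppr_eq0 oner_eq0].
have := scales_comp h h; rewrite mulr1; congr scales; apply/funext => p /=.
by rewrite !(Hu, Hv, Hupd) c1 s0; congr upd; ring.
Qed.

Lemma scales_rot12 (c s : R) : (c ^+ 2 + s ^+ 2 = 1)%R ->
  scales lam3 (fun p : T3 => ((c * p.1.1 - s * p.1.2)%R, (s * p.1.1 + c * p.1.2)%R, p.2)) 1%R.
Proof.
move=> e.
pose f : measurableTypeR R -> T2 -> T2 := fun _ q => ((c * q.1 - s * q.2)%R, (s * q.1 + c * q.2)%R).
have h : scales lam2 (f 0%R) 1%R.
  apply: (@scales_rotation _ T2 lam2 fst snd (fun _ a b => (a, b))) => // t.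
    by have := scales_affine1 t ltr01; under eq_fun do rewrite mul1r.
  by have := scales_affine2 t ltr01; under eq_fun do rewrite mul1r.
have mf : measurable_fun setT (fun p : T3 => f p.2 p.1).
  exact: (measurableT_comp h.1 measurable_fst).
exact: (@scales_prod1 _ _ T2 (measurableTypeR R) lam2 lam 1%R f mf ler01 (fun _ => h)).
Qed.

Lemma scales_rot23 (c s : R) : (c ^+ 2 + s ^+ 2 = 1)%R ->
  scales lam3 (fun p : T3 => (p.1.1, (c * p.1.2 - s * p.2)%R, (s * p.1.2 + c * p.2)%R)) 1%R.
Proof.
apply: (@scales_rotation _ T3 lam3 (fun p => p.1.2) snd (fun p a b => (p.1.1, a, b))) => // t.
- pose g (z : measurableTypeR R) : measurableTypeR R -> measurableTypeR R -> measurableTypeR R :=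
    fun _ y => (1 * y + t * z)%R.
  pose f (z : measurableTypeR R) (q : T2) : T2 := (q.1, g z q.1 q.2).
  have hg z : scales lam2 (f z) 1%R.
    apply: (@scales_prod2 _ _ _ _ lam lam 1%R (g z)) => //; last by move=> x; exact: scales_affine.
    exact: measurableT_comp (measurable_affine _ _) measurable_snd.
  have mf : measurable_fun setT (fun p : T3 => f p.2 p.1).
    apply: measurable_fun_pair => /=; first exact: measurableT_comp measurable_fst measurable_fst.
    apply: measurable_funD; apply: measurable_funM => //; try exact: measurable_cst.
    exact: measurableT_comp measurable_snd measurable_fst.
  have := @scales_prod1 _ _ T2 (measurableTypeR R) lam2 lam 1%R f mf ler01 hg.
  by congr scales; apply/funext => -[[x y] z] /=; rewrite /f /g /= mul1r.
- pose f (q : T2) (z : measurableTypeR R) : measurableTypeR R := (1 * z + t * q.2)%R.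
  have mf : measurable_fun setT (fun p : T3 => f p.1 p.2).
    apply: measurable_funD; apply: measurable_funM => //; try exact: measurable_cst.
    exact: measurableT_comp measurable_snd measurable_fst.
  have := @scales_prod2 _ _ T2 (measurableTypeR R) lam2 lam 1%R f mf ler01
     (fun q => scales_affine _ ltr01).
  by congr scales; apply/funext => -[[x y] z] /=; rewrite /f mul1r.
Qed.

(** * Volumes of solids of revolution and of cones over caps *)

Definition disc (s : R) : set T2 := [set q | (q.1 ^+ 2 + q.2 ^+ 2 <= s)%R].

Lemma measurable_disc s : measurable (disc s).
Proof.
rewrite -[X in measurable X]setTI.
have mf : measurable_fun setT (fun q : T2 => (q.1 ^+ 2 + q.2 ^+ 2)%R : measurableTypeR R).
  by apply: measurable_funD; apply: measurable_funX.
have := mf measurableT `]-oo, s]%classic (measurable_itv _).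
congr measurable; apply/seteqP; split => q /=; rewrite in_itv /= /disc /=; tauto.
Qed.

(** This is pi, but only its being finite and positive matters: it cancels in [solid_angle]. *)
Definition disc_const : \bar R := lam2 (disc 1).

Lemma disc_measure s : (0 <= s)%R -> lam2 (disc s) = s%:E * disc_const.
Proof.
rewrite le_eqVlt => /orP[/eqP <-|s0].
  rewrite mul0e; have -> : disc 0 = [set 0%R] `*` [set 0%R].
    apply/seteqP; split => -[x y]; rewrite /disc /=.
      by move=> h; split; apply/eqP; rewrite -sqrf_eq0; apply/eqP; nra.
    by move=> [-> ->]; rewrite expr0n /= addr0.
  by rewrite /planar_measure product_measure1E //= lebesgue_measure_set1 mul0e.
have r0 : (0 < Num.sqrt s)%R by rewrite sqrtr_gt0.
have := scales_comp (scales_affine1 0 r0) (scales_affine2 0 r0).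
move=> [_ /(_ _ (measurable_disc s)) ->].
rewrite -expr2 sqr_sqrtr ?ltW //; congr (_ * lam2 _).
have rr : (Num.sqrt s * Num.sqrt s = s)%R by rewrite -expr2 sqr_sqrtr ?ltW.
apply/seteqP; split => -[x y]; rewrite /disc /=.
  by move=> h; rewrite -(ler_pM2l s0) mulr1; move: h; rewrite -{5}rr; lra.
by move=> h; move: h; rewrite -(ler_pM2l s0) mulr1 -{1}rr; lra.
Qed.

Lemma disc_const_fin : disc_const \is a fin_num.
Proof.
have h : disc_const <= lam2 (`[(-1)%R, 1%R]%classic `*` `[(-1)%R, 1%R]%classic).
  apply: le_measure; rewrite ?inE; [exact: measurable_disc | exact: measurableX | ].
  move=> [x y]; rewrite /disc /= !in_itv /= => h; split; apply/andP; split; nra.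
rewrite ge0_fin_numE; last exact: measure_ge0.
rewrite (le_lt_trans h) //.
rewrite /planar_measure product_measure1E //= !lebesgue_measure_itv /=.
by case: ifP => _; rewrite -?EFinB -?EFinM ?mul0e ltry.
Qed.

Lemma disc_const_gt0 : 0 < disc_const.
Proof.
have h : lam2 (`[0%R, (2^-1)%R]%classic `*` `[0%R, (2^-1)%R]%classic) <= disc_const.
  apply: le_measure; rewrite ?inE; [exact: measurableX | exact: measurable_disc |].
  by move=> [x y]; rewrite /disc /= !in_itv /= => -[/andP[x0 x1] /andP[y0 y1]]; nra.
rewrite (lt_le_trans _ h) //.
rewrite /planar_measure product_measure1E //= !lebesgue_measure_itv /= lte_fin.
by rewrite invr_gt0 ltr0n -EFinB -EFinM lte_fin; nra.
Qed.


(** The part over heights in [D] of a quadric of revolution about the third axis: a cone for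
    [b = 0], the unit ball for [a = -1], [b = 1]. *)
Definition solid (D : set (measurableTypeR R)) (a b : R) : set T3 :=
  [set p | D p.2 /\ (p.1.1 ^+ 2 + p.1.2 ^+ 2 <= a * p.2 ^+ 2 + b)%R].

Local Arguments solid D%_classical_set_scope (a b)%_ring_scope.

Lemma measurable_solid D a b : measurable D -> measurable (solid D a b).
Proof.
move=> mD.
have mf : measurable_fun setT
   (fun p : T3 => (p.1.1 ^+ 2 + p.1.2 ^+ 2 - a * p.2 ^+ 2)%R : measurableTypeR R).
  apply: measurable_funB; first apply: measurable_funD; first apply: measurable_funX.
  - exact: measurableT_comp measurable_fst measurable_fst.
  - by apply: measurable_funX; exact: measurableT_comp measurable_snd measurable_fst.
  - by apply: measurable_funM; [exact: measurable_cst | apply: measurable_funX].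
have h1 := mf measurableT `]-oo, b]%classic (measurable_itv _).
have h2 : measurable (setT `*` D : set T3) by exact: measurableX.
have := measurableI _ _ h2 h1.
congr measurable; apply/seteqP; split => p; rewrite /solid /= in_itv /=.
  by move=> [[_ ?] [_ ?]]; split=> //; lra.
by move=> [? ?]; do ! split=> //; lra.
Qed.

Lemma solid_measure (D : set (measurableTypeR R)) (a b : R) : measurable D -> (forall z : R, D z -> (0 <= a * z ^+ 2 + b)%R) ->
  lam3 (solid D a b) = (\int[lam]_(z in D) (a * z ^+ 2 + b)%:E) * disc_const.
Proof.
move=> mD h0; rewrite product_measure12; last exact: measurable_solid.
have -> : disc_const = (fine disc_const)%:E by rewrite fineK // disc_const_fin.
have k0 : (0 <= fine disc_const)%R by rewrite fine_ge0 // ltW // disc_const_gt0.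
have mf : measurable_fun D (fun z : measurableTypeR R => (a * z ^+ 2 + b)%:E).
  apply/measurable_EFinP; apply: measurable_funS (measurableT) (@subsetT _ _) _.
  apply: measurable_funD => //; apply: measurable_funM => //; exact: measurable_funX.
have f0 (z : measurableTypeR R) : D z -> 0 <= (a * z ^+ 2 + b)%:E by move=> Dz; rewrite lee_fin h0.
rewrite muleC -(@ge0_integralZl _ _ _ lam D mD _ mf (fine disc_const)%:E f0); last by rewrite lee_fin.
rewrite [RHS]integral_mkcond; apply: eq_integral => z _ /=.
rewrite patchE; case: ifPn => [/set_mem Dz|/negP nDz].
  rewrite fineK ?disc_const_fin // muleC -disc_measure ?h0 //; congr (lam2 _).
  by apply/seteqP; split => q; rewrite /ysection /disc /solid /= inE //= => -[].
transitivity (lam2 set0); last by rewrite measure0.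
congr (lam2 _).
by apply/seteqP; split => q; rewrite /ysection /solid /= inE //= => -[/mem_set].
Qed.

Lemma solid_measure_itv (D : set (measurableTypeR R)) (u v a b : R) : (u < v)%R ->
  D = `]u, v]%classic \/ D = `[u, v]%classic ->
  (forall z : R, D z -> (0 <= a * z ^+ 2 + b)%R) ->
  lam3 (solid D a b) = ((a / 3 * v ^+ 3 + b * v) - (a / 3 * u ^+ 3 + b * u))%:E * disc_const.
Proof.
move=> uv hD h0; have mD : measurable D by case: hD => ->; exact: measurable_itv.
rewrite solid_measure //; congr (_ * _); rewrite -integral_quadratic //.
case: hD => -> //; rewrite integral_itv_obnd_cbnd //.
apply/measurable_EFinP; apply: measurable_funS (measurableT) (@subsetT _ _) _.
by apply: measurable_funD => //; apply: measurable_funM => //; exact: measurable_funX.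
Qed.

Definition sqn (p : T3) : R := (p.1.1 ^+ 2 + p.1.2 ^+ 2 + p.2 ^+ 2)%R.

(** Without the origin, the intersection with a cap splits exactly into two solids over positive
    heights. *)
Definition pball : set T3 := [set p | (0 < sqn p <= 1)%R].

Definition gcap (x : T3) : set T3 := [set p |
  let s := (x.1.1 * p.1.1 + x.1.2 * p.1.2 + x.2 * p.2)%R in (0 <= s)%R /\ (sqn p <= s ^+ 2)%R].

Lemma measurable_coords : [/\ measurable_fun setT (fun p : T3 => p.1.1),
  measurable_fun setT (fun p : T3 => p.1.2) & measurable_fun setT (fun p : T3 => p.2)].
Proof.
split; last exact: measurable_snd.
- exact: measurableT_comp measurable_fst measurable_fst.
- exact: measurableT_comp measurable_snd measurable_fst.
Qed.

Lemma measurable_sqn : measurable_fun setT (sqn : T3 -> measurableTypeR R).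
Proof.
have [m1 m2 m3] := measurable_coords.
by do 2 (try apply: measurable_funD); apply: measurable_funX.
Qed.

Lemma measurable_pball : measurable pball.
Proof.
have := measurable_sqn measurableT (measurable_itv `]0%R, 1%R]).
by congr measurable; apply/seteqP; split=> p; rewrite /pball /= in_itv /=; tauto.
Qed.

Lemma measurable_gcap x : measurable (gcap x).
Proof.
have [m1 m2 m3] := measurable_coords.
pose s (p : T3) : measurableTypeR R := (x.1.1 * p.1.1 + x.1.2 * p.1.2 + x.2 * p.2)%R.
have ms : measurable_fun setT s.
  by do 2 (try apply: measurable_funD); apply: measurable_funM => //; exact: measurable_cst.
have md : measurable_fun setT (fun p => s p ^+ 2 - sqn p : measurableTypeR R)%R.
  by apply: measurable_funB; [exact: measurable_funX | exact: measurable_sqn].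
have h1 := ms measurableT _ (measurable_itv `[0%R, +oo[).
have h2 := md measurableT _ (measurable_itv `[0%R, +oo[).
have := measurableI _ _ h1 h2.
congr measurable; apply/seteqP; split => p; rewrite /gcap /= !in_itv /= !andbT subr_ge0.
  by move=> [[_ ?] [_ ?]].
by move=> [? ?].
Qed.

(** The height 1/r of the rim of the cap separates a cone from a spherical segment; both are
    instances of [solid]. *)
Lemma gcap_measure (r : R) : (1 < r)%R ->
  lam3 (gcap (0%R, 0%R, r) `&` pball) = (2 / 3 * (1 - r^-1))%:E * disc_const.
Proof.
move=> r1; have r0 : (0 < r)%R by lra.
have i0 : (0 < r^-1)%R by rewrite invr_gt0.
have i1 : (r^-1 < 1)%R by rewrite invf_lt1.
have ri : (r * r^-1 = 1)%R by rewrite mulfV // gt_eqF.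
have -> : gcap (0%R, 0%R, r) `&` pball =
    solid `]0%R, (r^-1)%R]%classic (r ^+ 2 - 1) 0 `|` solid `](r^-1)%R, 1%R]%classic (-1) 1.
  apply/seteqP; split => -[[x y] z]; rewrite /gcap /pball /solid /sqn /= !in_itv /= !mul0r !add0r.
    move=> [[h1 h2] /andP[h3 h4]].
    have z0 : (0 < z)%R.
      rewrite lt_neqAle -(pmulr_rge0 _ r0) h1 andbT eq_sym.
      by apply/eqP => z0; move: h2 h3; rewrite z0; nra.
    have z1 : (z <= 1)%R by nra.
    have [zr|zr] := leP z r^-1%R; [left|right]; split; rewrite ?z0 ?zr ?z1 //; nra.
  move=> [[/andP[z0 z1] h]|[/andP[z0 z1] h]].
    have z2 : (0 < z ^+ 2)%R by rewrite exprn_gt0.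
    have rz0 : (0 <= r * z)%R by rewrite mulr_ge0 // ltW.
    have rz : ((r * z) ^+ 2 <= 1)%R by rewrite exprn_ile1 // -ri ler_pM2l.
    have x2 := sqr_ge0 x; have y2 := sqr_ge0 y.
    by split; [split => //; lra | apply/andP; split; lra].
  have z3 : (0 < z)%R by lra.
  have z2 : (0 < z ^+ 2)%R by rewrite exprn_gt0.
  have rz0 : (0 <= r * z)%R by rewrite mulr_ge0 // ltW.
  have rz : (1 <= (r * z) ^+ 2)%R by rewrite exprn_ege1 // -ri ler_pM2l // ltW.
  have x2 := sqr_ge0 x; have y2 := sqr_ge0 y.
  by split; [split => //; lra | apply/andP; split; lra].
have mU : lam3 (solid `]0%R, (r^-1)%R]%classic (r ^+ 2 - 1) 0 `|` solid `](r^-1)%R, 1%R]%classic (-1) 1)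
  = lam3 (solid `]0%R, (r^-1)%R]%classic (r ^+ 2 - 1) 0) + lam3 (solid `](r^-1)%R, 1%R]%classic (-1) 1).
  apply: measureU; [exact: measurable_solid | exact: measurable_solid |].
  apply/seteqP; split => // -[[x y] z]; rewrite /solid /= !in_itv /= => -[[/andP[? ?] _] [/andP[? ?] _]]; lra.
rewrite mU (solid_measure_itv i0 (or_introl erefl)); last first.
  by move=> z; rewrite /= in_itv /= addr0 => /andP[? ?]; rewrite mulr_ge0 ?sqr_ge0 // subr_ge0 exprn_ege1 // ltW.
rewrite (solid_measure_itv i1 (or_introl erefl)); last first.
  move=> z; rewrite /= in_itv /= => /andP[? ?].
  have z2 : (z ^+ 2 <= 1)%R by rewrite exprn_ile1 //; lra.
  by lra.
rewrite -(fineK disc_const_fin) -!EFinM -EFinD; congr EFin.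
by field; rewrite gt_eqF.
Qed.

Lemma pball_measure : lam3 pball = (4 / 3)%:E * disc_const.
Proof.
have e : solid `[(-1)%R, 1%R]%classic (-1) 1 = pball `|` ([set (0%R, 0%R)] `*` [set 0%R]).
  apply/seteqP; split => -[[x y] z]; rewrite /pball /solid /sqn /= !in_itv /=.
    move=> [/andP[h1 h2] h].
    have [h0|h0] := ltP 0%R (x ^+ 2 + y ^+ 2 + z ^+ 2)%R; [left; apply/andP; split; lra | right].
    have x0 : x = 0%R by apply/eqP; rewrite -sqrf_eq0; apply/eqP; nra.
    have y0 : y = 0%R by apply/eqP; rewrite -sqrf_eq0; apply/eqP; nra.
    have z0 : z = 0%R by apply/eqP; rewrite -sqrf_eq0; apply/eqP; nra.
    by rewrite x0 y0 z0.
  move=> [/andP[h1 h2]|[[-> ->] ->]].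
    by split; [apply/andP; split; nra | nra].
  by split; [apply/andP; split; lra | lra].
have m1 : measurable ([set (0%R, 0%R)] : set T2).
  have -> : [set (0%R, 0%R)] = [set 0%R] `*` [set 0%R] :> set T2.
    by apply/seteqP; split => -[x y] /=; [move=> [-> ->] | move=> [-> ->]].
  exact: measurableX.
have h0 : lam3 ([set (0%R, 0%R)] `*` [set 0%R]) = 0.
  by rewrite product_measure1E //= lebesgue_measure_set1 mule0.
have mU : lam3 (pball `|` ([set (0%R, 0%R)] `*` [set 0%R])) =
    lam3 pball + lam3 ([set (0%R, 0%R)] `*` [set 0%R]).
  apply: measureU; [exact: measurable_pball | exact: measurableX |].
  apply/seteqP; split => // -[[x y] z]; rewrite /pball /sqn /= => -[/andP[h _] [[a b] c]].
  by move: h; rewrite a b c; lra.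
rewrite h0 adde0 -e in mU; rewrite -mU.
have n11 : (-1 < 1 :> R)%R by lra.
rewrite (solid_measure_itv n11 (or_intror erefl)).
  by congr (_%:E * _); field.
move=> z; rewrite /= in_itv /= => /andP[z0 z1].
have : (0 <= (1 - z) * (1 + z))%R by rewrite mulr_ge0 //; lra.
lra.
Qed.

(* Normalised so that the whole sphere has solid angle 2. *)
Definition solid_angle (E : set T3) : R := (fine (lam3 (E `&` pball)) / (fine disc_const * (2 / 3)))%R.

Let fine_disc_const_gt0 : (0 < fine disc_const :> R)%R.
Proof. by rewrite fine_gt0 // disc_const_gt0 -ge0_fin_numE ?disc_const_fin // ltW // disc_const_gt0. Qed.

Lemma solid_angle_fin (E : set T3) : measurable E -> lam3 (E `&` pball) \is a fin_num.
Proof.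
move=> mE; have h : lam3 (E `&` pball) <= lam3 pball.
  apply: le_measure; rewrite ?inE; [|exact: measurable_pball | exact: subIsetr].
  by apply: measurableI => //; exact: measurable_pball.
rewrite ge0_fin_numE; last exact: measure_ge0.
rewrite (le_lt_trans h) // pball_measure -(fineK disc_const_fin) -EFinM ltry //.
Qed.

Lemma solid_angle_ge0 E : (0 <= solid_angle E)%R.
Proof.
rewrite /solid_angle divr_ge0 //; first by rewrite fine_ge0 // measure_ge0.
by rewrite mulr_ge0 // ltW.
Qed.

Lemma solid_angleU (E F : set T3) : measurable E -> measurable F -> E `&` F = set0 ->
  solid_angle (E `|` F) = (solid_angle E + solid_angle F)%R.
Proof.
move=> mE mF EF; rewrite /solid_angle -mulrDl; congr (_ / _)%R.
rewrite -fineD; try exact: solid_angle_fin.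
congr fine; rewrite setIUl; apply: measureU.
- by apply: measurableI => //; exact: measurable_pball.
- by apply: measurableI => //; exact: measurable_pball.
- by rewrite setIACA EF set0I.
Qed.

Lemma solid_angleT : solid_angle setT = 2%R.
Proof.
rewrite /solid_angle setTI pball_measure -{1}(fineK disc_const_fin) -EFinM /=.
by field; rewrite gt_eqF.
Qed.

Lemma solid_angle_gcap (r : R) : (1 < r)%R -> solid_angle (gcap (0%R, 0%R, r)) = (1 - r^-1)%R.
Proof.
move=> r1; rewrite /solid_angle gcap_measure // -{1}(fineK disc_const_fin) -EFinM /=.
by field; rewrite !gt_eqF //; lra.
Qed.

Lemma solid_angle_scales (f : T3 -> T3) (E : set T3) : scales lam3 f 1%R ->
  (forall p, sqn (f p) = sqn p) -> measurable E ->
  measurable (f @^-1` E) /\ solid_angle (f @^-1` E) = solid_angle E.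
Proof.
move=> [mf hf] fn mE; split; first by rewrite -[X in measurable X]setTI; exact: mf.
rewrite /solid_angle (hf (E `&` pball)); last by apply: measurableI => //; exact: measurable_pball.
rewrite mul1e; congr (fine (lam3 _) / _)%R.
by apply/seteqP; split => p; rewrite /pball /= fn.
Qed.

Lemma solid_angle_rot12 (c s : R) (E : set T3) : (c ^+ 2 + s ^+ 2 = 1)%R -> measurable E ->
  let f := fun p : T3 => ((c * p.1.1 - s * p.1.2)%R, (s * p.1.1 + c * p.1.2)%R, p.2) in
  measurable (f @^-1` E) /\ solid_angle (f @^-1` E) = solid_angle E.
Proof.
move=> e mE f; apply: solid_angle_scales => //; first exact: scales_rot12.
move=> [[x y] z]; rewrite /sqn /f /=.
by transitivity ((c ^+ 2 + s ^+ 2) * (x ^+ 2 + y ^+ 2) + z ^+ 2)%R; [ring | rewrite e mul1r].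
Qed.

Lemma solid_angle_rot23 (c s : R) (E : set T3) : (c ^+ 2 + s ^+ 2 = 1)%R -> measurable E ->
  let f := fun p : T3 => (p.1.1, (c * p.1.2 - s * p.2)%R, (s * p.1.2 + c * p.2)%R) in
  measurable (f @^-1` E) /\ solid_angle (f @^-1` E) = solid_angle E.
Proof.
move=> e mE f; apply: solid_angle_scales => //; first exact: scales_rot23.
move=> [[x y] z]; rewrite /sqn /f /=.
by transitivity (x ^+ 2 + (c ^+ 2 + s ^+ 2) * (y ^+ 2 + z ^+ 2))%R; [ring | rewrite e mul1r addrA].
Qed.

End Scales.

End SolidAngle.

End SolidAngle.

(** * Caps and their areas over the real numbers of the theorem *)

Module SphericalArea.
Import all_boot all_order all_algebra all_classical all_reals all_analysis.
Import Rstruct measurable_realfun lebesgue_measure lebesgue_integral.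
Import SolidAngle.
Local Open Scope R_scope.
Set Implicit Arguments. Unset Strict Implicit. Unset Printing Implicit Defensive.

Definition dot (p q : pt) : R := (fst (fst p) * fst (fst q) + snd (fst p) * snd (fst q) + snd p * snd q).
(** A cone of directions rather than a subset of the sphere, written without the square root in |p|
    <= x.p (see [cap_iff]). *)
Definition cap (x p : pt) : Prop := (0 <= dot x p /\ dot p p <= (dot x p)^2).

Definition meas (E : pt -> Prop) : Prop :=
  measurable (E : set (measurableTypeR R * measurableTypeR R * measurableTypeR R)).
Definition area (E : pt -> Prop) : R := @solid_angle R E.

(** Equality of the predicates themselves, so that one rewriting serves both [meas] and [area]. *)
Lemma area_ext (E F : pt -> Prop) : (forall p, E p <-> F p) -> E = F.
Proof. by move=> h; apply/funext => p; apply/propext. Qed.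

Lemma cap_gcap x : cap x = gcap (x : R * R * R).
Proof.
apply: area_ext => -[[a b] c]; rewrite /cap /gcap /dot /sqn /= -!RpowE /=.
split=> -[h1 h2]; (split; [apply/RleP; move: h1 | apply/RleP; move: h2]); rewrite ?Rmult_1_r; try exact: id;
 move=> /RleP; exact: id.
Qed.

Lemma meas_cap x : meas (cap x).
Proof. by rewrite cap_gcap; exact: measurable_gcap. Qed.

Lemma meas_union E F : meas E -> meas F -> meas (fun p => E p \/ F p).
Proof. exact: measurableU. Qed.

Lemma meas_diff E F : meas E -> meas F -> meas (fun p => E p /\ ~ F p).
Proof. exact: measurableD. Qed.

Lemma meas_all : meas (fun _ => True).
Proof. exact: measurableT. Qed.

Lemma area_ge0 E : (0 <= area E).
Proof. by apply/RleP; exact: solid_angle_ge0. Qed.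

Lemma area_union E F : meas E -> meas F -> (forall p, E p -> F p -> False) ->
  area (fun p => E p \/ F p) = (area E + area F).
Proof.
move=> mE mF EF; apply: solid_angleU => //.
by apply: area_ext => p; split => // -[/EF].
Qed.

Lemma area_all : area (fun _ => True) = 2.
Proof. by rewrite -[2]/(1 + 1); exact: solid_angleT. Qed.

Lemma area_cap_axis r : (1 < r) -> area (cap (0, 0, r)) = (1 - / r).
Proof. by move=> /RltP r1; rewrite cap_gcap; exact: solid_angle_gcap. Qed.

Definition rot12 (c s : R) (p : pt) : pt :=
  (c * fst (fst p) - s * snd (fst p), s * fst (fst p) + c * snd (fst p), snd p).
Definition rot23 (c s : R) (p : pt) : pt :=
  (fst (fst p), c * snd (fst p) - s * snd p, s * snd (fst p) + c * snd p).

Lemma area_rot12 c s E : (c ^ 2 + s ^ 2 = 1) -> meas E ->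
  meas (fun p => E (rot12 c s p)) /\ area (fun p => E (rot12 c s p)) = area E.
Proof. by rewrite !RpowE => e mE; exact: (solid_angle_rot12 e mE). Qed.

Lemma area_rot23 c s E : (c ^ 2 + s ^ 2 = 1) -> meas E ->
  meas (fun p => E (rot23 c s p)) /\ area (fun p => E (rot23 c s p)) = area E.
Proof. by rewrite !RpowE => e mE; exact: (solid_angle_rot23 e mE). Qed.

End SphericalArea.
Import SphericalArea ListNotations.

(** * Differences of caps *)

Definition cap_diff (x y : pt) : R := area (fun p => cap x p /\ ~ cap y p).

Lemma area_mono (E F : pt -> Prop) : meas E -> meas F -> (forall p, E p -> F p) ->
  area E <= area F.
Proof.
  intros mE mF H.
  rewrite (area_ext (E := F) (F := fun p => E p \/ (F p /\ ~ E p))).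
  - rewrite area_union; [| exact mE | apply meas_diff; assumption | (cbv beta in *; tauto)].
    pose proof (area_ge0 (fun p => F p /\ ~ E p)). lra.
  - intros p; specialize (H p); destruct (classic (E p)); (cbv beta in *; tauto).
Qed.

Lemma area_subadd (E F : pt -> Prop) : meas E -> meas F ->
  area (fun p => E p \/ F p) <= area E + area F.
Proof.
  intros mE mF.
  rewrite (area_ext (E := fun p => E p \/ F p) (F := fun p => E p \/ (F p /\ ~ E p))).
  - rewrite area_union; [| exact mE | apply meas_diff; assumption | (cbv beta in *; tauto)].
    assert (H := area_mono (fun p => F p /\ ~ E p) F (meas_diff mF mE) mF ltac:((cbv beta in *; tauto))). lra.
  - intros p; destruct (classic (E p)); (cbv beta in *; tauto).
Qed.

Lemma meas_cap_diff x y : meas (fun p => cap x p /\ ~ cap y p).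
Proof. apply meas_diff; apply meas_cap. Qed.

Lemma cap_diff_ge0 x y : 0 <= cap_diff x y.
Proof. apply area_ge0. Qed.

Lemma cap_diff_triangle x y z : cap_diff x z <= cap_diff x y + cap_diff y z.
Proof.
  unfold cap_diff; eapply Rle_trans; [| apply area_subadd; apply meas_cap_diff].
  apply area_mono; [apply meas_cap_diff | apply meas_union; apply meas_cap_diff |].
  intros p [H1 H2]; destruct (classic (cap y p)); (cbv beta in *; tauto).
Qed.

Lemma meas_inter E F : meas E -> meas F -> meas (fun p => E p /\ F p).
Proof.
  intros mE mF.
  rewrite (area_ext (E := fun p => E p /\ F p) (F := fun p => E p /\ ~ (E p /\ ~ F p))).
  - apply meas_diff; [exact mE | apply meas_diff; assumption].
  - intros p; destruct (classic (F p)); (cbv beta in *; tauto).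
Qed.

Lemma cap_diff_inter x y : area (cap x) = cap_diff x y + area (fun p => cap x p /\ cap y p).
Proof.
  unfold cap_diff; rewrite <- area_union.
  - f_equal; apply area_ext; intros p; destruct (classic (cap y p)); (cbv beta in *; tauto).
  - apply meas_cap_diff.
  - apply meas_inter; apply meas_cap.
  - (cbv beta in *; tauto).
Qed.

Lemma cap_diff_sym x y : cap_diff x y - cap_diff y x = area (cap x) - area (cap y).
Proof.
  rewrite (cap_diff_inter x y), (cap_diff_inter y x).
  rewrite (area_ext (E := fun p => cap y p /\ cap x p) (F := fun p => cap x p /\ cap y p)); [ring | (cbv beta in *; tauto)].
Qed.

Lemma cap_diff_le_cap x y : cap_diff x y <= area (cap x).
Proof. rewrite (cap_diff_inter x y); pose proof (area_ge0 (fun p => cap x p /\ cap y p)); lra. Qed.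

Lemma meas_empty : meas (fun _ => False).
Proof.
  rewrite (area_ext (E := fun _ : pt => False) (F := fun _ : pt => True /\ ~ True)); [| (cbv beta in *; tauto)].
  apply meas_diff; apply meas_all.
Qed.

Lemma area_empty : area (fun _ => False) = 0.
Proof.
  assert (H := area_union meas_empty meas_empty ltac:((cbv beta in *; tauto))).
  cbv beta in H; rewrite (area_ext (E := fun p : pt => False \/ False) (F := fun _ => False)) in H; [lra | (cbv beta in *; tauto)].
Qed.

Lemma cap_diff_nested x y : (forall p, cap x p -> cap y p) -> cap_diff x y = 0.
Proof.
  intros H; unfold cap_diff.
  rewrite (area_ext (E := fun p => cap x p /\ ~ cap y p) (F := fun _ => False)); [apply area_empty |].
  intros p; specialize (H p); (cbv beta in *; tauto).
Qed.

(** * Rotations and normal positions *)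

Definition is_rot (T : pt -> pt) : Prop :=
  (forall p q, dot (T p) (T q) = dot p q) /\
  (forall E, meas E -> meas (fun p => E (T p)) /\ area (fun p => E (T p)) = area E).

Lemma is_rot12 c s : c ^ 2 + s ^ 2 = 1 -> is_rot (rot12 c s).
Proof.
  intros e; split; [| intros E; apply area_rot12; exact e].
  intros [[a b] d] [[a' b'] d']; unfold dot, rot12; cbn [fst snd].
  transitivity ((c^2 + s^2) * (a * a' + b * b') + d * d'); [ring | rewrite e; ring].
Qed.

Lemma is_rot23 c s : c ^ 2 + s ^ 2 = 1 -> is_rot (rot23 c s).
Proof.
  intros e; split; [| intros E; apply area_rot23; exact e].
  intros [[a b] d] [[a' b'] d']; unfold dot, rot23; cbn [fst snd].
  transitivity (a * a' + (c^2 + s^2) * (b * b' + d * d')); [ring | rewrite e; ring].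
Qed.

Lemma is_rot_comp S T : is_rot S -> is_rot T -> is_rot (fun p => S (T p)).
Proof.
  intros [d1 a1] [d2 a2]; split.
  - intros p q; rewrite d1, d2; reflexivity.
  - intros E mE; destruct (a1 E mE) as [m1 e1]; destruct (a2 _ m1) as [m2 e2].
    split; [exact m2 | congruence].
Qed.

Lemma cap_rot T x p : is_rot T -> (cap (T x) (T p) <-> cap x p).
Proof. intros [d _]; unfold cap; rewrite !d; (cbv beta in *; tauto). Qed.

Lemma cap_diff_rot T x y : is_rot T -> cap_diff (T x) (T y) = cap_diff x y.
Proof.
  intros HT; unfold cap_diff; destruct HT as [d a]; assert (HT : is_rot T) by (split; assumption).
  rewrite <- (proj2 (a _ (meas_cap_diff (T x) (T y)))).
  f_equal; apply area_ext; intros p; rewrite !cap_rot by exact HT; (cbv beta in *; tauto).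
Qed.

Lemma area_cap_rot T x : is_rot T -> area (cap (T x)) = area (cap x).
Proof.
  intros HT; destruct HT as [d a]; assert (HT : is_rot T) by (split; assumption).
  rewrite <- (proj2 (a _ (meas_cap (T x)))).
  f_equal; apply area_ext; intros p; apply cap_rot; exact HT.
Qed.

Lemma rotate_to_axis u v : exists c s, c ^ 2 + s ^ 2 = 1 /\
  c * u - s * v = 0 /\ s * u + c * v = sqrt (u ^ 2 + v ^ 2).
Proof.
  destruct (Req_dec (u ^ 2 + v ^ 2) 0) as [h | h].
  - assert (u = 0) by nra. assert (v = 0) by nra. subst.
    exists 1, 0; rewrite h, sqrt_0; lra.
  - assert (0 < u ^ 2 + v ^ 2) by nra.
    assert (Hr := sqrt_lt_R0 _ H). assert (Hs := sqrt_sqrt _ (Rlt_le _ _ H)).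
    set (r := sqrt (u ^ 2 + v ^ 2)) in *.
    exists (v / r), (u / r); repeat split.
    + replace ((v / r) ^ 2 + (u / r) ^ 2) with ((u ^ 2 + v ^ 2) / (r * r)) by (field; lra).
      rewrite Hs; field; exact h.
    + field; lra.
    + replace (u / r * u + v / r * v) with ((u ^ 2 + v ^ 2) / r) by (field; lra).
      rewrite <- Hs; field; lra.
Qed.

Definition nrm (p : pt) : R := sqrt (dot p p).

Lemma dot_ge0 p : 0 <= dot p p.
Proof. unfold dot; nra. Qed.

Lemma nrm_sqr p : nrm p * nrm p = dot p p.
Proof. apply sqrt_sqrt, dot_ge0. Qed.

Lemma nrm_ge0 p : 0 <= nrm p.
Proof. apply sqrt_pos. Qed.

Lemma area_cap x : 1 < nrm x -> area (cap x) = 1 - / nrm x.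
Proof.
  intros Hx; unfold nrm in *; destruct x as [[x1 x2] x3].
  destruct (rotate_to_axis x1 x2) as [c [s [e [h1 h2]]]].
  destruct (rotate_to_axis (s * x1 + c * x2) x3) as [c' [s' [e' [h1' h2']]]].
  rewrite <- (area_cap_rot (fun p => rot23 c' s' (rot12 c s p))).
  2: { apply is_rot_comp; [apply is_rot23 | apply is_rot12]; assumption. }
  replace (rot23 c' s' (rot12 c s (x1, x2, x3))) with (0, 0, sqrt (dot (x1,x2,x3) (x1,x2,x3))).
  - apply area_cap_axis; exact Hx.
  - unfold rot12, rot23; cbn [fst snd]; rewrite h1, h1', h2'.
    f_equal; f_equal. rewrite h2, pow2_sqrt by nra.
    unfold dot; cbn [fst snd]; ring.
Qed.

(** Two rotations make y - x parallel to the second axis; a third, about that axis, moves the line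
    into the plane of the first two coordinates. Then [h] is the distance of the line from the
    origin. *)
Lemma planar_position x y : exists T h l1 l2, is_rot T /\ 0 <= h /\ l1 <= l2 /\
  T x = (h, l1, 0) /\ T y = (h, l2, 0).
Proof.
  destruct x as [[x1 x2] x3], y as [[y1 y2] y3].
  destruct (rotate_to_axis (y3 - x3) (y2 - x2)) as [c [s [e [h1 h2]]]].
  set (w := s * (y3 - x3) + c * (y2 - x2)) in *.
  destruct (rotate_to_axis (y1 - x1) w) as [c' [s' [e' [h1' h2']]]].
  set (x2' := c * x2 + s * x3) in *. set (x3' := - s * x2 + c * x3) in *.
  set (y2' := c * y2 + s * y3) in *.
  set (l1 := s' * x1 + c' * x2') in *. set (a := c' * x1 - s' * x2') in *.
  destruct (rotate_to_axis x3' a) as [c2 [s2 [e2 [h3 h4]]]].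
  (* The two quarter turns conjugate [rot23] into a rotation of the first and third coordinates. *)
  exists (fun p => rot12 0 (-1) (rot23 c2 (- s2) (rot12 0 1 (rot12 c' s' (rot23 c (- s) p))))).
  exists (s2 * x3' + c2 * a), l1, (s' * y1 + c' * y2').
  split; [| split; [| split; [| split]]].
  - assert (R1 : is_rot (rot23 c (- s))) by (apply is_rot23; nra).
    assert (R2 : is_rot (rot12 c' s')) by (apply is_rot12; nra).
    assert (R3 : is_rot (rot12 0 1)) by (apply is_rot12; ring).
    assert (R4 : is_rot (rot23 c2 (- s2))) by (apply is_rot23; nra).
    assert (R5 : is_rot (rot12 0 (-1))) by (apply is_rot12; ring).
    exact (is_rot_comp _ _ R5 (is_rot_comp _ _ R4 (is_rot_comp _ _ R3 (is_rot_comp _ _ R2 R1)))).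
  - rewrite h4; apply sqrt_pos.
  - assert (H := sqrt_pos ((y1 - x1) ^ 2 + w ^ 2)). rewrite <- h2' in H.
    unfold l1; unfold w in H; unfold x2', y2'; nra.
  - unfold rot12, rot23; cbn [fst snd].
    f_equal; [f_equal |]; unfold l1, a, x2', x3' in *; lra.
  - unfold rot12, rot23; cbn [fst snd].
    assert (E3 : - s * y2 + c * y3 = x3') by (unfold x3'; lra).
    assert (Ea : c' * y1 - s' * y2' = a) by (unfold a, x2', y2'; unfold w in h1'; lra).
    rewrite <- E3 in *. rewrite <- Ea in *.
    f_equal; [f_equal |]; unfold y2' in *; lra.
Qed.

(** * Rotating a cap *)

Definition pol (r t : R) : pt := (r * cos t, r * sin t, 0).

Lemma rot12_pol s r t : rot12 (cos s) (sin s) (pol r t) = pol r (t + s).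
Proof.
  unfold rot12, pol; cbn [fst snd]; rewrite cos_plus, sin_plus.
  f_equal; f_equal; ring.
Qed.

Lemma is_rot_angle s : is_rot (rot12 (cos s) (sin s)).
Proof. apply is_rot12; pose proof (sin2_cos2 s); unfold Rsqr in *; nra. Qed.

Lemma cap_diff_pol_shift r a r' b s : cap_diff (pol r (a + s)) (pol r' (b + s)) = cap_diff (pol r a) (pol r' b).
Proof. rewrite <- !(rot12_pol s); apply cap_diff_rot, is_rot_angle. Qed.

Lemma dot_pol r t : dot (pol r t) (pol r t) = r ^ 2.
Proof.
  unfold dot, pol; cbn [fst snd]; pose proof (sin2_cos2 t); unfold Rsqr in *.
  transitivity (r^2 * (sin t * sin t + cos t * cos t)); [ring | rewrite H; ring].
Qed.

Lemma nrm_pol r t : 0 <= r -> nrm (pol r t) = r.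
Proof. intros Hr; unfold nrm; rewrite dot_pol; apply sqrt_pow2; exact Hr. Qed.

Lemma polar_form u v : exists m t, 0 <= m /\ u = m * cos t /\ v = m * sin t.
Proof.
  destruct (rotate_to_axis v u) as [c [s [e [h1 h2]]]].
  assert (Hs : exists t, c = cos t /\ s = sin t).
  { destruct (Rle_lt_dec 0 s) as [h | h].
    - exists (acos c); split; [rewrite cos_acos; [reflexivity | nra] |].
      rewrite sin_acos by nra. symmetry. replace (1 - c²) with (s ^ 2) by (unfold Rsqr; nra).
      apply sqrt_pow2; exact h.
    - exists (- acos c); rewrite cos_neg, sin_neg; split; [rewrite cos_acos; [reflexivity | nra] |].
      rewrite sin_acos by nra. replace (1 - c²) with ((- s) ^ 2) by (unfold Rsqr; nra).
      rewrite sqrt_pow2 by lra; ring. }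
  destruct Hs as [t [Hc Hsn]].
  exists (sqrt (v^2 + u^2)), t; rewrite <- Hc, <- Hsn, <- h2; split; [rewrite h2; apply sqrt_pos |].
  assert (s * (c * v - s * u) = 0) by (rewrite h1; ring).
  assert (c * (c * v - s * u) = 0) by (rewrite h1; ring).
  assert ((c ^ 2 + s ^ 2) * u = u) by (rewrite e; ring).
  assert ((c ^ 2 + s ^ 2) * v = v) by (rewrite e; ring).
  split; lra.
Qed.

Lemma angle_mod x : exists n : Z, - PI <= x - 2 * PI * IZR n < PI.
Proof.
  pose proof PI_RGT_0 as HP.
  destruct (archimed ((x - PI) / (2 * PI))) as [h1 h2].
  exists (up ((x - PI) / (2 * PI)) - 0)%Z.
  set (n := up ((x - PI) / (2 * PI))) in *. rewrite Z.sub_0_r.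
  assert (E : x - PI = (x - PI) / (2 * PI) * (2 * PI)) by (field; lra).
  set (y := (x - PI) / (2 * PI)) in *. split; nra.
Qed.

Lemma cos_shift_Z x n : cos (x - 2 * PI * IZR n) = cos x.
Proof.
  assert (H : forall (k : nat) y, cos (y + 2 * PI * INR k) = cos y).
  { intros k y; rewrite <- (cos_period y k); f_equal; ring. }
  destruct (Z_le_gt_dec 0 n) as [h | h].
  - rewrite <- (H (Z.to_nat n) (x - _)); f_equal.
    rewrite INR_IZR_INZ, Z2Nat.id by lia; ring.
  - rewrite <- (H (Z.to_nat (- n)) x); f_equal.
    rewrite INR_IZR_INZ, Z2Nat.id, opp_IZR by lia; ring.
Qed.

(* Along the circle, [cos] falls below the level [T] only once per turn. *)
Lemma cos_downcrossing T psi d r (N j k : nat) :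
  0 < T -> (0 < N)%nat -> d = 2 * PI / INR N -> 0 <= r <= d ->
  (j < k < N)%nat ->
  cos (psi - INR j * d) >= T -> cos (psi - INR j * d - r) < T ->
  cos (psi - INR k * d) >= T -> cos (psi - INR k * d - r) < T -> False.
Proof.
  intros HT HN Hd Hr Hjk a1 a2 b1 b2.
  pose proof PI_RGT_0 as HP.
  assert (HT1 : T <= 1) by (pose proof (COS_bound (psi - INR j * d)); lra).
  set (w := acos T).
  assert (Hw : 0 <= w <= PI) by apply acos_bound.
  assert (Hcw : cos w = T) by (apply cos_acos; lra).
  (* The level set is the arc [-w, w]; going back by [r] leaves it only across its lower end -w. *)
  assert (key : forall x, cos x >= T -> cos (x - r) < T ->
     exists n : Z, - w <= x - 2 * PI * IZR n < - w + r).
  { intros x hx1 hx2; destruct (angle_mod x) as [n [n1 n2]]; exists n.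
    set (y := x - 2 * PI * IZR n) in *.
    assert (Hy1 : cos y >= T) by (unfold y; rewrite cos_shift_Z; exact hx1).
    assert (Hy2 : cos (y - r) < T).
    { unfold y; replace (x - 2 * PI * IZR n - r) with ((x - r) - 2 * PI * IZR n) by ring.
      rewrite cos_shift_Z; exact hx2. }
    assert (Hyw : - w <= y <= w).
    { split.
      - apply Rnot_lt_le; intros h. assert (cos (- y) < cos w) by (apply cos_decreasing_1; lra).
        rewrite cos_neg in *; lra.
      - apply Rnot_lt_le; intros h. assert (cos y < cos w) by (apply cos_decreasing_1; lra). lra. }
    split; [lra |].
    apply Rnot_le_lt; intros h.
    assert (cos w <= cos (y - r)); [| lra].
    destruct (Rle_lt_dec 0 (y - r)) as [g | g].
    - apply cos_decr_1; lra.
    - rewrite <- (cos_neg (y - r)); apply cos_decr_1; lra. }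
  destruct (key _ a1 a2) as [n1 h1]. destruct (key _ b1 b2) as [n2 h2].
  assert (HNr : 0 < INR N) by (apply lt_0_INR; lia).
  assert (Hdd : d * INR N = 2 * PI) by (rewrite Hd; field; lra).
  assert (hd : 0 < d) by (rewrite Hd; apply Rdiv_lt_0_compat; lra).
  (* Modulo full turns both points lie in one window of length r <= d, and they are [M] steps of
     length [d] apart. Hence M = 0, against 0 < k - j < N. *)
  set (M := (Z.of_nat k - Z.of_nat j + Z.of_nat N * (n2 - n1))%Z).
  assert (HM : IZR M * d = (INR k - INR j) * d + 2 * PI * (IZR n2 - IZR n1)).
  { unfold M; rewrite plus_IZR, mult_IZR, !minus_IZR, <- !INR_IZR_INZ, <- Hdd; ring. }
  assert (- 1 < IZR M < 1).
  { assert (- d < IZR M * d < d) by lra. nra. }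
  assert (M = 0)%Z.
  { destruct H as [H1 H2]; apply lt_IZR in H1; apply lt_IZR in H2; lia. }
  unfold M in H0.
  assert (n2 - n1 < 0)%Z by nia.
  assert (n2 - n1 > -1)%Z by nia. lia.
Qed.

Lemma cap_pol r t m psi z : 0 < r -> 0 <= m ->
  (cap (pol r t) (m * cos psi, m * sin psi, z) <->
   0 <= m * cos (psi - t) /\ m ^ 2 + z ^ 2 <= (r * (m * cos (psi - t))) ^ 2).
Proof.
  intros Hr Hm; unfold cap.
  assert (E1 : dot (pol r t) (m * cos psi, m * sin psi, z) = r * (m * cos (psi - t))).
  { unfold dot, pol; cbn [fst snd]; rewrite cos_minus; ring. }
  assert (E2 : dot (m * cos psi, m * sin psi, z) (m * cos psi, m * sin psi, z) = m ^ 2 + z ^ 2).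
  { unfold dot; cbn [fst snd]; pose proof (sin2_cos2 psi); unfold Rsqr in *.
    transitivity (m^2 * (sin psi * sin psi + cos psi * cos psi) + z ^ 2); [ring | rewrite H; ring]. }
  rewrite E1, E2; split; intros [h1 h2]; split; auto; nra.
Qed.

Definition sector_diff (r s t : R) (p : pt) : Prop := cap (pol r s) p /\ ~ cap (pol r t) p.

(** For p at longitude psi, membership in the cap at angle t means that cos(psi - t) reaches a level
    depending only on p and r. Lying in two of the differences would give two downcrossings of that
    level in one turn. *)
Lemma sector_disjoint (r d s : R) (N j k : nat) p : 1 < r -> (0 < N)%nat -> d = 2 * PI / INR N ->
  0 <= s <= d -> (j < k < N)%nat ->
  sector_diff r (INR j * d) (INR j * d + s) p -> sector_diff r (INR k * d) (INR k * d + s) p -> False.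
Proof.
  intros Hr HN Hd Hs Hjk.
  destruct p as [[u v] z]; destruct (polar_form u v) as [m [psi [Hm [-> ->]]]].
  unfold sector_diff; rewrite !cap_pol by lra.
  intros [[a1 a2] a3] [[b1 b2] b3].
  destruct (Req_dec m 0) as [m0 | m0].
  { subst m; apply a3; rewrite !Rmult_0_l in *; lra. }
  assert (Hm' : 0 < m) by lra.
  assert (H0 : 0 < m ^ 2 + z ^ 2) by nra.
  set (T := sqrt (m ^ 2 + z ^ 2) / (r * m)).
  assert (Hq := sqrt_lt_R0 _ H0). assert (Hqq := sqrt_sqrt _ (Rlt_le _ _ H0)).
  set (q := sqrt (m ^ 2 + z ^ 2)) in *.
  assert (Hrm : 0 < r * m) by nra.
  assert (ET : T * (r * m) = q) by (unfold T; field; lra).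
  assert (HT : 0 < T) by (apply Rdiv_lt_0_compat; lra).
  assert (key : forall x, (0 <= m * cos x /\ m ^ 2 + z ^ 2 <= (r * (m * cos x)) ^ 2) <-> cos x >= T).
  { intros x; rewrite <- Hqq, <- ET; split.
    - intros [h1 h2]; assert (0 <= cos x) by nra.
      apply Rle_ge. apply Rsqr_incr_0_var; [unfold Rsqr | assumption].
      assert (0 < (r * m) * (r * m)) by nra.
      apply Rmult_le_reg_r with ((r * m) * (r * m)); [assumption | nra].
    - intros h; split; [nra |].
      assert (T * T <= cos x * cos x) by nra.
      assert (0 < (r * m) * (r * m)) by nra.
      nra. }
  rewrite key in a3, b3.
  apply (cos_downcrossing T psi d s N j k); auto; try (apply key; split; assumption).
  - apply Rnot_ge_lt; intros h; apply a3; replace (psi - (INR j * d + s)) with (psi - INR j * d - s) by ring; exact h.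
  - apply Rnot_ge_lt; intros h; apply b3; replace (psi - (INR k * d + s)) with (psi - INR k * d - s) by ring; exact h.
Qed.

Lemma area_sectors (r d s : R) (N : nat) : 1 < r -> (0 < N)%nat -> d = 2 * PI / INR N ->
  0 <= s <= d -> forall n, (n <= N)%nat ->
  meas (fun p => exists k, (k < n)%nat /\ sector_diff r (INR k * d) (INR k * d + s) p) /\
  area (fun p => exists k, (k < n)%nat /\ sector_diff r (INR k * d) (INR k * d + s) p) =
    INR n * cap_diff (pol r 0) (pol r s).
Proof.
  intros Hr HN Hd Hs n; induction n as [| n IH]; intros Hn.
  - rewrite (area_ext (F := fun _ => False)).
    + split; [apply meas_empty | rewrite area_empty; simpl; ring].
    + intros p; split; [intros [k [h _]]; lia | tauto].
  - destruct IH as [IHm IHa]; [lia |].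
    rewrite (area_ext (F := fun p => (exists k, (k < n)%nat /\ sector_diff r (INR k * d) (INR k * d + s) p) \/
       sector_diff r (INR n * d) (INR n * d + s) p)).
    + split; [apply meas_union; [exact IHm | apply meas_cap_diff] |].
      rewrite area_union; [| exact IHm | apply meas_cap_diff |].
      * rewrite IHa, S_INR. change (area (sector_diff r (INR n * d) (INR n * d + s))) with (cap_diff (pol r (INR n * d)) (pol r (INR n * d + s))).
        rewrite <- (cap_diff_pol_shift r 0 r s (INR n * d)).
        rewrite Rplus_0_l, (Rplus_comm s); ring.
      * intros p [k [hk h1]] h2; apply (sector_disjoint r d s N k n p); auto; lia.
    + intros p; split.
      * intros [k [hk h]]; destruct (Nat.eq_dec k n) as [-> | hne]; [right; exact h | left; exists k; split; [lia | exact h]].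
      * intros [[k [hk h]] | h]; [exists k; split; [lia | exact h] | exists n; split; [lia | exact h]].
Qed.

(** The origin lies in every cap, and caps of radius close to 1 have arbitrarily small area 1 -
    1/r. *)
Lemma area_origin : forall E, meas E -> (forall p, E p -> dot p p = 0) -> area E = 0.
Proof.
  intros E mE H.
  assert (Hle : forall r, 1 < r -> area E <= 1 - / r).
  { intros r Hr; rewrite <- (area_cap_axis Hr).
    apply area_mono; [exact mE | apply meas_cap |].
    intros [[u v] w] Hp; specialize (H _ Hp); unfold dot in H; cbn [fst snd] in H.
    assert (u = 0) by nra. assert (v = 0) by nra. assert (w = 0) by nra. subst.
    unfold cap, dot; cbn [fst snd]; nra. }
  apply Rle_antisym; [| apply area_ge0].
  apply Rnot_lt_le; intros h.
  assert (h2 := Hle (1 + area E) ltac:(lra)).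
  assert (1 - / (1 + area E) = area E / (1 + area E)) by (field; lra).
  assert (area E / (1 + area E) < area E).
  { apply Rmult_lt_reg_r with (1 + area E); [lra |].
    replace (area E / (1 + area E) * (1 + area E)) with (area E) by (field; lra). nra. }
  lra.
Qed.

Lemma nrm_axis t : nrm (0, 0, t) = Rabs t.
Proof. unfold nrm, dot; cbn [fst snd]; rewrite <- sqrt_Rsqr_abs; f_equal; unfold Rsqr; ring. Qed.

(** The complement of the band consists of two polar caps of area 1 - 1/t each, which share only the
    origin. *)
Lemma area_band (E : pt -> Prop) t : 1 < t -> meas E ->
  (forall p, E p -> ~ cap (0, 0, t) p /\ ~ cap (0, 0, - t) p) -> area E <= 2 / t.
Proof.
  intros Ht mE HE.
  set (F := fun p => cap (0, 0, t) p /\ cap (0, 0, - t) p).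
  assert (mF : meas F) by (apply meas_inter; apply meas_cap).
  assert (F0 : area F = 0).
  { apply area_origin; [exact mF |].
    intros [[u v] w]; unfold F, cap, dot; cbn [fst snd]; intros [[h1 h2] [h3 h4]].
    assert (t * w = 0) by nra. assert (w = 0) by nra. subst w. nra. }
  assert (U := area_union (meas_cap_diff (0, 0, t) (0, 0, -t)) (meas_cap_diff (0, 0, - t) (0, 0, t)) ltac:((cbv beta in *; tauto))).
  assert (U2 := area_union mE (meas_union (meas_cap_diff (0, 0, t) (0, 0, -t)) (meas_cap_diff (0, 0, - t) (0, 0, t)))).
  cbv beta in U, U2; rewrite U in U2.
  specialize (U2 ltac:(intros p h; specialize (HE p h); (cbv beta in *; tauto))).
  assert (H := area_mono _ _ (meas_union mE (meas_union (meas_cap_diff (0, 0, t) (0, 0, -t)) (meas_cap_diff (0, 0, - t) (0, 0, t)))) meas_all ltac:((cbv beta in *; tauto))).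
  cbv beta in H; rewrite area_all in H; rewrite U2 in H.
  fold (cap_diff (0, 0, t) (0, 0, -t)) in H. fold (cap_diff (0, 0, -t) (0, 0, t)) in H.
  assert (A1 := cap_diff_inter (0, 0, t) (0, 0, - t)). fold F in A1.
  assert (A2 := cap_diff_inter (0, 0, -t) (0, 0, t)).
  rewrite (area_ext (E := fun p => cap (0, 0, -t) p /\ cap (0, 0, t) p) (F := F)) in A2 by (unfold F; tauto).
  rewrite area_cap in A1, A2; rewrite nrm_axis in *; rewrite ?Rabs_Ropp in *; rewrite Rabs_right in * by lra; try lra.
Qed.

Lemma le_of_forall_lt a b : (forall c, b < c -> a <= c) -> a <= b.
Proof. intros H; apply Rnot_lt_le; intros h; specialize (H ((a + b) / 2) ltac:(lra)); lra. Qed.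

(* The [N] rotated copies of the difference by multiples of [2 PI / N] are disjoint and lie in
   the band swept by the cap. *)
Lemma sector_packing (r s : R) (N : nat) : 1 < r -> (0 < N)%nat -> 0 <= s <= 2 * PI / INR N ->
  INR N * cap_diff (pol r 0) (pol r s) <= 2 * (sqrt (r ^ 2 - 1) / r).
Proof.
  intros Hr HN Hs.
  destruct (area_sectors r _ s N Hr HN eq_refl Hs N (Nat.le_refl N)) as [mE aE].
  rewrite <- aE.
  assert (Hq : 0 < r ^ 2 - 1) by nra.
  assert (Hs0 := sqrt_lt_R0 _ Hq). assert (Hss := sqrt_sqrt _ (Rlt_le _ _ Hq)).
  set (q := sqrt (r ^ 2 - 1)) in *.
  assert (Hqr : q < r) by nra.
  (* The band is taken slightly too wide: points of the differences may have the extreme latitude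
     q/r, whereas [area_band] excludes the closed polar caps. *)
  apply le_of_forall_lt; intros c Hc.
  assert (Hc0 : 0 < q / r) by (apply Rdiv_lt_0_compat; lra).
  destruct (Rle_lt_dec 2 c) as [h2 | h2].
  { eapply Rle_trans; [| exact h2].
    eapply Rle_trans; [apply (area_mono _ _ mE meas_all); tauto |].
    rewrite area_all; lra. }
  replace c with (2 / (2 / c)) by (field; lra).
  apply area_band.
  - apply Rmult_lt_reg_r with c; [lra |]. unfold Rdiv; rewrite Rmult_assoc, Rinv_l; lra.
  - exact mE.
  - intros [[u v] z] [k [_ [h1 h3]]].
    destruct (polar_form u v) as [m [psi [Hm [-> ->]]]].
    rewrite cap_pol in h1, h3 by lra.
    destruct h1 as [h1 h1'].
    assert (Hm2 : m ^ 2 + z ^ 2 <= r ^ 2 * m ^ 2).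
    { pose proof (COS_bound (psi - INR k * (2 * PI / INR N))) as [c1 c2].
      set (cc := cos _) in *. assert (cc ^ 2 <= 1) by nra.
      assert (0 <= r ^ 2 * m ^ 2) by nra. nra. }
    assert (Hpos : 0 < m ^ 2 + z ^ 2).
    { apply Rnot_le_lt; intros h. assert (m = 0) by nra. subst m.
      apply h3; rewrite !Rmult_0_l; split; nra. }
    assert (Ht : (2 / c) ^ 2 * (q ^ 2) < r ^ 2).
    { assert (2 * q < c * r).
      { apply Rmult_lt_reg_r with (/ r); [apply Rinv_0_lt_compat; lra |].
        replace (c * r * / r) with c by (field; lra). unfold Rdiv in Hc; lra. }
      assert (2 / c * q < r).
      { apply Rmult_lt_reg_r with c; [lra |]. replace (2 / c * q * c) with (2 * q) by (field; lra). lra. }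
      assert (0 < 2 / c * q) by (apply Rmult_lt_0_compat; [apply Rdiv_lt_0_compat |]; lra).
      nra. }
    assert (E2 : dot (m * cos psi, m * sin psi, z) (m * cos psi, m * sin psi, z) = m ^ 2 + z ^ 2).
    { unfold dot; cbn [fst snd]; pose proof (sin2_cos2 psi); unfold Rsqr in *.
      transitivity (m^2 * (sin psi * sin psi + cos psi * cos psi) + z ^ 2); [ring | rewrite H; ring]. }
    set (t := 2 / c) in *.
    assert (key : m ^ 2 + z ^ 2 <= t ^ 2 * z ^ 2 -> False).
    { intros h.
      assert (q ^ 2 = r ^ 2 - 1) by nra.
      assert (g1 : (m ^ 2 + z ^ 2) * r ^ 2 <= (t ^ 2 * q ^ 2) * (m ^ 2 + z ^ 2)).
      { assert (z ^ 2 <= (r^2 - 1) * m ^ 2) by lra.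
        assert (r ^ 2 * z ^ 2 <= q ^ 2 * (m ^ 2 + z ^ 2)) by nra.
        assert (0 <= t ^ 2) by nra.
        assert (t ^ 2 * (r ^ 2 * z ^ 2) <= t ^ 2 * (q ^ 2 * (m ^ 2 + z ^ 2))) by (apply Rmult_le_compat_l; assumption).
        assert (r ^ 2 * (m ^ 2 + z ^ 2) <= r ^ 2 * (t ^ 2 * z ^ 2)) by (apply Rmult_le_compat_l; nra).
        lra. }
      nra. }
    split; unfold cap; rewrite E2; unfold dot; cbn [fst snd]; intros [_ g]; apply key; nra.
Qed.

(** By packing, a rotation by 2 PI / N costs at most 2S/N. Finer and finer steps give S/PI per unit
    of angle, which is the exact rate; S is the sine of the angular radius of the cap. *)
Lemma rotation_area_pos (r w : R) : 1 < r -> 0 <= w ->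
  cap_diff (pol r 0) (pol r w) <= sqrt (r ^ 2 - 1) / r * w / PI.
Proof.
  intros Hr Hw. pose proof PI_RGT_0 as HP.
  set (S := sqrt (r ^ 2 - 1) / r).
  assert (HS : 0 <= S).
  { unfold S; apply Rmult_le_pos; [apply sqrt_pos | left; apply Rinv_0_lt_compat; lra]. }
  assert (chain : forall n d, cap_diff (pol r 0) (pol r (INR n * d)) <= INR n * cap_diff (pol r 0) (pol r d)).
  { intros n d; induction n as [| n IH].
    - simpl; rewrite !Rmult_0_l. rewrite (cap_diff_nested (pol r 0)) by auto; lra.
    - rewrite S_INR. eapply Rle_trans; [apply (cap_diff_triangle _ (pol r (INR n * d))) |].
      replace (pol r (INR n * d)) with (pol r (0 + INR n * d)) at 2 by (f_equal; ring).
      replace ((INR n + 1) * d) with (d + INR n * d) by ring.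
      rewrite cap_diff_pol_shift. lra. }
  apply le_epsilon; intros eps Heps.
  (* N is so large that the last, incomplete step costs at most [eps]. *)
  destruct (nfloor_ex (2 * S / eps)) as [N0 [HN0 HN1]].
  { apply Rmult_le_pos; [lra | left; apply Rinv_0_lt_compat; exact Heps]. }
  set (N := Datatypes.S N0).
  assert (HN : 0 < INR N) by (apply lt_0_INR; unfold N; lia).
  set (d := 2 * PI / INR N).
  assert (Hd : 0 < d) by (apply Rdiv_lt_0_compat; lra).
  destruct (nfloor_ex (w / d)) as [m [Hm0 Hm1]].
  { apply Rmult_le_pos; [lra | left; apply Rinv_0_lt_compat; exact Hd]. }
  assert (Ew : w = w / d * d) by (field; lra).
  set (s := w - INR m * d).
  assert (Hs : 0 <= s <= d) by (unfold s; split; rewrite Ew; nra).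
  assert (P1 := sector_packing r d N Hr ltac:(unfold N; lia) ltac:(unfold d in *; lra)).
  assert (P2 := sector_packing r s N Hr ltac:(unfold N; lia) ltac:(unfold d in *; lra)).
  fold S in P1, P2.
  assert (T1 : cap_diff (pol r 0) (pol r w) <= INR m * cap_diff (pol r 0) (pol r d) + cap_diff (pol r 0) (pol r s)).
  { eapply Rle_trans; [apply (cap_diff_triangle _ (pol r (INR m * d))) |].
    apply Rplus_le_compat; [apply chain |].
    apply Req_le. rewrite <- (cap_diff_pol_shift r 0 r s (INR m * d)). unfold s; f_equal; f_equal; ring. }
  assert (Q : forall x, INR N * x <= 2 * S -> x <= 2 * S / INR N).
  { intros x hx; apply Rmult_le_reg_r with (INR N); [exact HN |].
    replace (2 * S / INR N * INR N) with (2 * S) by (field; lra). lra. }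
  apply Q in P1. apply Q in P2.
  eapply Rle_trans; [exact T1 |].
  assert (e1 : 2 * S / INR N <= eps).
  { apply Rmult_le_reg_r with (INR N); [exact HN |].
    replace (2 * S / INR N * INR N) with (2 * S) by (field; lra).
    assert (2 * S / eps <= INR N) by (unfold N; rewrite S_INR; lra).
    apply Rmult_le_compat_l with (r := eps) in H; [| lra].
    replace (eps * (2 * S / eps)) with (2 * S) in H by (field; lra). lra. }
  assert (e2 : INR m * (2 * S / INR N) <= S * w / PI).
  { replace (S * w / PI) with (w / d * (2 * S / INR N)) by (unfold d; field; lra).
    apply Rmult_le_compat_r; [| exact Hm0].
    apply Rmult_le_pos; [lra | left; apply Rinv_0_lt_compat; exact HN]. }
  assert (INR m * cap_diff (pol r 0) (pol r d) <= INR m * (2 * S / INR N)) by (apply Rmult_le_compat_l; [apply pos_INR | exact P1]).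
  lra.
Qed.

Definition cap_dist (x y : pt) : R := cap_diff x y + cap_diff y x.

Lemma rotation_area (r s t : R) : 1 < r ->
  cap_dist (pol r s) (pol r t) <= 2 / PI * (sqrt (r ^ 2 - 1) / r) * Rabs (t - s).
Proof.
  intros Hr.
  assert (E : forall s t, cap_diff (pol r s) (pol r t) = cap_diff (pol r t) (pol r s)).
  { intros s' t'. assert (H := cap_diff_sym (pol r s') (pol r t')).
    rewrite !area_cap in H by (rewrite nrm_pol; lra). rewrite !nrm_pol in H by lra. lra. }
  assert (H : forall s t, s <= t -> cap_dist (pol r s) (pol r t) <= 2 / PI * (sqrt (r ^ 2 - 1) / r) * (t - s)).
  { intros s' t' h; unfold cap_dist; rewrite (E t' s').
    replace (cap_diff (pol r s') (pol r t')) with (cap_diff (pol r 0) (pol r (t' - s'))).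
    - assert (P := rotation_area_pos r (t' - s') Hr ltac:(lra)).
      replace (2 / PI * (sqrt (r ^ 2 - 1) / r) * (t' - s')) with (2 * (sqrt (r ^ 2 - 1) / r * (t' - s') / PI)); [lra |].
      unfold Rdiv; ring.
    - rewrite <- (cap_diff_pol_shift r 0 r (t' - s') s'); f_equal; f_equal; ring. }
  destruct (Rle_lt_dec s t) as [h | h].
  - rewrite Rabs_right by lra; apply H; exact h.
  - rewrite Rabs_left by lra; unfold cap_dist; rewrite Rplus_comm.
    replace (- (t - s)) with (s - t) by ring. apply (H t s); lra.
Qed.

(** * Moving a cap along a line *)

Lemma dot_sym p q : dot p q = dot q p.
Proof. unfold dot; ring. Qed.

Lemma dot_le_nrm p q : dot p q <= nrm p * nrm q.
Proof.
  apply Rsqr_incr_0_var; [| apply Rmult_le_pos; apply nrm_ge0].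
  replace (Rsqr (nrm p * nrm q)) with ((nrm p * nrm p) * (nrm q * nrm q)) by (unfold Rsqr; ring).
  rewrite !nrm_sqr; destruct p as [[a b] c], q as [[x y] z]; unfold dot, Rsqr; cbn [fst snd].
  assert (0 <= (a * y - b * x) ^ 2 + (b * z - c * y) ^ 2 + (c * x - a * z) ^ 2)
    by (repeat apply Rplus_le_le_0_compat; apply pow2_ge_0). lra.
Qed.

Lemma cap_iff x p : cap x p <-> nrm p <= dot x p.
Proof.
  unfold cap; rewrite <- nrm_sqr; pose proof (nrm_ge0 p); split.
  - intros [h1 h2]; apply Rsqr_incr_0_var; [unfold Rsqr; nra | exact h1].
  - intros h; split; [lra | nra].
Qed.

Definition lin (s : R) (p q : pt) : pt :=
  ((1 - s) * fst (fst p) + s * fst (fst q), (1 - s) * snd (fst p) + s * snd (fst q),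
   (1 - s) * snd p + s * snd q).

Lemma dot_lin s p q z : dot (lin s p q) z = (1 - s) * dot p z + s * dot q z.
Proof. unfold dot, lin; cbn [fst snd]; ring. Qed.

(* If [x] lies in the convex hull of [y] and the unit ball, every half-space touching the
   ball and reaching [x] reaches [y]. *)
Lemma cap_lin s t y p : 0 < s <= 1 -> nrm t <= 1 -> cap (lin s t y) p -> cap y p.
Proof.
  intros Hs Ht; rewrite !cap_iff, dot_lin; intros H.
  pose proof (dot_le_nrm t p); pose proof (nrm_ge0 p).
  assert (dot t p <= nrm p) by nra. nra.
Qed.

Lemma cap_dist_triangle x y z : cap_dist x z <= cap_dist x y + cap_dist y z.
Proof. unfold cap_dist; pose proof (cap_diff_triangle x y z); pose proof (cap_diff_triangle z y x); lra. Qed.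

Lemma cap_dist_sym x y : cap_dist x y = cap_dist y x.
Proof. unfold cap_dist; ring. Qed.

Lemma cap_dist_refl x : cap_dist x x = 0.
Proof. unfold cap_dist; rewrite cap_diff_nested; [ring | auto]. Qed.

Lemma cap_dist_nested x y : 1 < nrm x -> 1 < nrm y -> (forall p, cap x p -> cap y p) ->
  cap_dist x y = / nrm x - / nrm y.
Proof.
  intros hx hy H. pose proof (cap_diff_sym x y). rewrite !area_cap in H0 by assumption.
  unfold cap_dist. rewrite (cap_diff_nested x y) in * by exact H. lra.
Qed.

(** In the plane of the line and the centre, the point (h, l) has radius [rad], its tangents to the
    unit circle have length [tng], and the clockwise one of the two touches the circle at polar
    angle [ang]. *)
Definition rad (h l : R) := sqrt (h ^ 2 + l ^ 2).
Definition tng (h l : R) := sqrt (h ^ 2 + l ^ 2 - 1).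
Definition ang (h l : R) := atan (l / h) - atan (tng h l).

Lemma rad_sqr h l : rad h l * rad h l = h ^ 2 + l ^ 2.
Proof. apply sqrt_sqrt; nra. Qed.

Lemma rad_gt1 h l : 1 < h -> 1 < rad h l.
Proof. intros Hh; rewrite <- sqrt_1; apply sqrt_lt_1; nra. Qed.

Lemma tng_sqr h l : 1 < h -> tng h l * tng h l = h ^ 2 + l ^ 2 - 1.
Proof. intros Hh; apply sqrt_sqrt; nra. Qed.

Lemma tng_gt0 h l : 1 < h -> 0 < tng h l.
Proof. intros Hh; apply sqrt_lt_R0; nra. Qed.

Lemma pol_vertical h l : 1 < h -> (h, l, 0) = pol (rad h l) (atan (l / h)).
Proof.
  intros Hh; unfold pol; rewrite cos_atan, sin_atan.
  assert (E : sqrt (1 + (l / h)²) = rad h l / h).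
  { replace (1 + (l / h)²) with ((h ^ 2 + l ^ 2) / h ^ 2) by (unfold Rsqr; field; lra).
    rewrite sqrt_div_alt by nra; rewrite sqrt_pow2 by lra; reflexivity. }
  pose proof (rad_gt1 h l Hh). rewrite E.
  f_equal; f_equal; field; lra.
Qed.

(* Move the first point out along a tangent line of the ball to the radius of the second one,
   whereby its cap grows, then rotate. *)
Lemma step_estimate h l1 l2 : 1 < h -> 0 <= l1 <= l2 ->
  cap_dist (h, l1, 0) (h, l2, 0) <= / rad h l1 - / rad h l2 +
    2 / PI * (tng h l2 / rad h l2) * Rabs (ang h l2 - ang h l1).
Proof.
  intros Hh Hl.
  pose proof (rad_gt1 h l1 Hh) as r1; pose proof (rad_gt1 h l2 Hh) as r2.
  pose proof (tng_gt0 h l1 Hh) as q1; pose proof (tng_gt0 h l2 Hh) as q2.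
  pose proof (rad_sqr h l1) as s1; pose proof (rad_sqr h l2) as s2.
  pose proof (tng_sqr h l1 Hh) as t1; pose proof (tng_sqr h l2 Hh) as t2.
  set (b := ang h l1).
  set (z := pol (rad h l2) (b + atan (tng h l2))).
  (* The tangent line at polar angle [b], parametrised by the distance from the point of contact. *)
  assert (P : forall l, 1 < rad h l -> 0 < tng h l ->
     pol (rad h l) (b + atan (tng h l)) = lin (tng h l) (cos b, sin b, 0) (cos b - sin b, sin b + cos b, 0)).
  { intros l hr hq; unfold pol, lin; cbn [fst snd].
    rewrite cos_plus, sin_plus, cos_atan, sin_atan.
    assert (E : sqrt (1 + (tng h l)²) = rad h l).
    { unfold rad; f_equal; unfold Rsqr; rewrite tng_sqr by exact Hh; ring. }
    rewrite E; f_equal; [f_equal |]; field; lra. }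
  eapply Rle_trans; [apply (cap_dist_triangle _ z) |]; apply Rplus_le_compat.
  - rewrite (pol_vertical h l1 Hh).
    replace (atan (l1 / h)) with (b + atan (tng h l1)) by (unfold b, ang; ring).
    apply Req_le; unfold z. rewrite cap_dist_nested; rewrite ?nrm_pol by lra; try lra.
    intros p. rewrite !P by assumption.
    set (tau := (cos b, sin b, 0)).
    replace (lin (tng h l1) tau (cos b - sin b, sin b + cos b, 0))
      with (lin (tng h l1 / tng h l2) tau (lin (tng h l2) tau (cos b - sin b, sin b + cos b, 0))).
    + apply cap_lin.
      * split; [apply Rdiv_lt_0_compat; assumption |].
        apply Rmult_le_reg_r with (tng h l2); [assumption |].
        unfold Rdiv; rewrite Rmult_assoc, Rinv_l, Rmult_1_l, Rmult_1_r by lra. apply sqrt_le_1_alt; nra.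
      * replace tau with (pol 1 b) by (unfold pol, tau; f_equal; f_equal; ring).
        rewrite nrm_pol; lra.
    + unfold lin, tau; cbn [fst snd]; f_equal; [f_equal |]; field; lra.
  - rewrite (pol_vertical h l2 Hh).
    assert (Q := rotation_area (rad h l2) (b + atan (tng h l2)) (atan (l2 / h)) r2).
    replace (sqrt (rad h l2 ^ 2 - 1)) with (tng h l2) in Q by (unfold tng; f_equal; nra).
    replace (ang h l2 - b) with (atan (l2 / h) - (b + atan (tng h l2))) by (unfold ang; ring).
    exact Q.
Qed.

(* Over a partition into intervals of length [d] the errors [(S v - S u) * d] telescope. *)
Lemma chain_bound (dd : R -> R -> R) (W S : R -> R) a b : a <= b ->
  (forall x, dd x x = 0) -> (forall x y z, dd x z <= dd x y + dd y z) ->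
  (forall u v, a <= u -> u < v -> v <= b -> dd u v <= W v - W u + (S v - S u) * (v - u)) ->
  dd a b <= W b - W a.
Proof.
  intros Hab H0 Ht H.
  destruct (Req_dec a b) as [-> | Hne]; [rewrite H0; lra |].
  apply le_epsilon; intros eps Heps.
  destruct (nfloor_ex (Rabs (S b - S a) * (b - a) / eps)) as [N0 [HN0 HN1]].
  { apply Rmult_le_pos; [apply Rmult_le_pos; [apply Rabs_pos | lra] | left; apply Rinv_0_lt_compat; exact Heps]. }
  set (N := Datatypes.S N0).
  assert (HN : 0 < INR N) by (apply lt_0_INR; unfold N; lia).
  set (d := (b - a) / INR N).
  assert (Hd : 0 < d) by (apply Rdiv_lt_0_compat; lra).
  assert (Ed : INR N * d = b - a) by (unfold d; field; lra).
  assert (K : forall n, (n <= N)%nat -> dd a (a + INR n * d) <=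
     W (a + INR n * d) - W a + (S (a + INR n * d) - S a) * d).
  { induction n as [| n IH]; intros hn.
    - simpl; rewrite Rmult_0_l, Rplus_0_r, H0; lra.
    - eapply Rle_trans; [apply (Ht _ (a + INR n * d)) |].
      specialize (IH ltac:(lia)).
      assert (hn2 : INR (Datatypes.S n) <= INR N) by (apply le_INR; exact hn).
      pose proof (pos_INR n).
      assert (Es : a + INR (Datatypes.S n) * d = a + INR n * d + d) by (rewrite S_INR; ring).
      assert (P := H (a + INR n * d) (a + INR (Datatypes.S n) * d) ltac:(nra) ltac:(lra) ltac:(nra)).
      replace (a + INR (Datatypes.S n) * d - (a + INR n * d)) with d in P by (rewrite Es; ring). lra. }
  specialize (K N (Nat.le_refl N)). rewrite Ed in K. replace (a + (b - a)) with b in K by ring.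
  assert ((S b - S a) * d <= eps); [| lra].
  apply Rle_trans with (Rabs (S b - S a) * d).
  { apply Rmult_le_compat_r; [lra | apply Rle_abs]. }
  apply Rmult_le_reg_r with (INR N / eps); [apply Rdiv_lt_0_compat; assumption |].
  replace (Rabs (S b - S a) * d * (INR N / eps)) with (Rabs (S b - S a) * (b - a) / eps) by (unfold d; field; lra).
  replace (eps * (INR N / eps)) with (INR N) by (field; lra).
  unfold N; rewrite S_INR; lra.
Qed.

Lemma is_derive_rad h l : 1 < h -> is_derive (rad h) l (l / rad h l).
Proof.
  intros Hh; unfold rad; auto_derive; [nra |]. 
  pose proof (rad_gt1 h l Hh); unfold rad in *.
  replace (h * (h * 1) + l * (l * 1)) with (h ^ 2 + l ^ 2) by ring. field; lra.
Qed.

Lemma is_derive_ang h l : 1 < h ->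
  is_derive (ang h) l ((h * tng h l - l) / (rad h l ^ 2 * tng h l)).
Proof.
  intros Hh; unfold ang, tng; auto_derive; [nra |].
  pose proof (tng_gt0 h l Hh) as q0; pose proof (tng_sqr h l Hh) as qq; unfold tng in *.
  assert (0 < rad h l ^ 2) by (pose proof (rad_gt1 h l Hh); nra).
  assert (Er : rad h l ^ 2 = h ^ 2 + l ^ 2) by (pose proof (rad_sqr h l); nra).
  rewrite Er.
  replace (h * (h * 1) + l * (l * 1) + - (1)) with (h ^ 2 + l ^ 2 - 1) by ring.
  replace (h * (h * 1) + l * (l * 1) - 1) with (h ^ 2 + l ^ 2 - 1) by ring.
  set (q := sqrt (h ^ 2 + l ^ 2 - 1)) in *.
  replace (1 + q * (q * 1)) with (h ^ 2 + l ^ 2) by nra.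
  field; repeat split; nra.
Qed.

Lemma tng_mul_ge h l : 1 < h -> 0 <= l -> l <= h * tng h l.
Proof.
  intros Hh Hl. pose proof (tng_gt0 h l Hh); pose proof (tng_sqr h l Hh).
  apply Rsqr_incr_0_var; [unfold Rsqr | nra].
  replace (h * tng h l * (h * tng h l)) with (h ^ 2 * (tng h l * tng h l)) by ring.
  rewrite H0. assert (0 <= (h ^ 2 - 1) * (h ^ 2 + l ^ 2)) by (apply Rmult_le_pos; nra). lra.
Qed.

Lemma is_derive_ang_bounds h l : 1 < h -> 0 <= l ->
  0 <= (h * tng h l - l) / (rad h l ^ 2 * tng h l) <= 1.
Proof.
  intros Hh Hl. pose proof (tng_gt0 h l Hh); pose proof (tng_mul_ge h l Hh Hl).
  pose proof (rad_gt1 h l Hh); pose proof (rad_sqr h l).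
  assert (0 < rad h l ^ 2 * tng h l) by (apply Rmult_lt_0_compat; nra).
  split.
  - apply Rmult_le_pos; [lra | left; apply Rinv_0_lt_compat; assumption].
  - apply Rmult_le_reg_r with (rad h l ^ 2 * tng h l); [assumption |].
    unfold Rdiv; rewrite Rmult_assoc, Rinv_l, Rmult_1_l, Rmult_1_r by lra.
    assert (h * tng h l <= rad h l ^ 2 * tng h l); [| lra].
    apply Rmult_le_compat_r; [lra |]. nra.
Qed.

Lemma mono_of_derive (f df : R -> R) a b : a < b ->
  (forall x, a <= x <= b -> is_derive f x (df x)) ->
  (forall x, a <= x <= b -> 0 <= df x) -> f a <= f b.
Proof.
  intros Hab Hd Hp.
  destruct (MVT_gen f a b df) as [c [hc E]].
  - rewrite Rmin_left, Rmax_right by lra; intros x hx; apply Hd; lra.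
  - rewrite Rmin_left, Rmax_right by lra; intros x hx.
    apply derivable_continuous_pt. exists (df x). apply is_derive_Reals, Hd; lra.
  - rewrite Rmin_left, Rmax_right in hc by lra. specialize (Hp c hc). nra.
Qed.

(* The hypothesis bounds the rate at which the right-hand side of [step_estimate] changes. *)
Lemma segment_estimate h l1 l2 k mu nu : 1 < h -> 0 <= l1 <= l2 -> 0 < k ->
  (forall l, l1 <= l <= l2 ->
     k * (2 / PI * (h * tng h l) + (1 - nu - 2 / PI) * l) + mu * l * rad h l ^ 2 <= rad h l ^ 3) ->
  k * cap_dist (h, l1, 0) (h, l2, 0) <=
    (l2 - l1) - mu * (rad h l2 - rad h l1) - k * nu * (/ rad h l2 - / rad h l1).
Proof.
  intros Hh Hl Hk HC.
  pose proof PI_RGT_0 as HP.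
  set (c0 := 2 / PI) in *.
  assert (Hc0 : 0 <= c0) by (unfold c0; apply Rlt_le, Rdiv_lt_0_compat; lra).
  (* [k * W] is the potential whose increment is the claimed bound, and [S] is the coefficient of
     the rotation in [step_estimate]. *)
  set (W := fun l => (l - mu * rad h l) / k - nu / rad h l).
  set (S := fun l => c0 * (tng h l / rad h l)).
  assert (Smono : forall u v, 0 <= u <= v -> S u <= S v).
  { intros u v huv; unfold S; apply Rmult_le_compat_l; [exact Hc0 |].
    pose proof (rad_gt1 h u Hh); pose proof (rad_gt1 h v Hh).
    pose proof (tng_gt0 h u Hh); pose proof (tng_gt0 h v Hh).
    pose proof (rad_sqr h u); pose proof (rad_sqr h v); pose proof (tng_sqr h u Hh); pose proof (tng_sqr h v Hh).
    apply Rmult_le_reg_r with (rad h u * rad h v); [nra |].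
    replace (tng h u / rad h u * (rad h u * rad h v)) with (tng h u * rad h v) by (field; lra).
    replace (tng h v / rad h v * (rad h u * rad h v)) with (tng h v * rad h u) by (field; lra).
    apply Rsqr_incr_0_var; [| nra].
    replace (Rsqr (tng h u * rad h v)) with ((tng h u * tng h u) * (rad h v * rad h v)) by (unfold Rsqr; ring).
    replace (Rsqr (tng h v * rad h u)) with ((tng h v * tng h v) * (rad h u * rad h u)) by (unfold Rsqr; ring).
    rewrite H3, H4, H5, H6. assert (u ^ 2 <= v ^ 2) by nra. nra. }
  assert (main : cap_dist (h, l1, 0) (h, l2, 0) <= W l2 - W l1).
  { apply (chain_bound (fun a b => cap_dist (h, a, 0) (h, b, 0)) W S l1 l2); [lra | | |].
    - intros x; apply cap_dist_refl.
    - intros x y z; apply cap_dist_triangle.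
    - intros u v hu huv hv.
      eapply Rle_trans; [apply step_estimate; lra |].
      assert (Hang : forall x, u <= x <= v -> is_derive (ang h) x ((h * tng h x - x) / (rad h x ^ 2 * tng h x)))
        by (intros; apply is_derive_ang; exact Hh).
      assert (mono : ang h u <= ang h v).
      { apply (mono_of_derive (ang h) _ u v huv Hang); intros x hx; apply is_derive_ang_bounds; lra. }
      rewrite Rabs_right by lra.
      (* Monotonicity of [f] is the hypothesis of [chain_bound] after inserting [step_estimate]. As
         [ang] has slope between 0 and 1, the linear term pays for freezing the coefficient at its
         value [S v]. *)
      set (f := fun l => W l + / rad h l + (S v - S u) * l - S v * ang h l).
      assert (Hf : f u <= f v).
      { apply (mono_of_derive f (fun l => (1 - mu * (l / rad h l)) / k - (1 - nu) * (l / rad h l) / rad h l ^ 2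
            + (S v - S u) - S v * ((h * tng h l - l) / (rad h l ^ 2 * tng h l))) u v huv).
        - intros x hx. unfold f, W.
          pose proof (rad_gt1 h x Hh) as rx.
          assert (Dr := is_derive_rad h x Hh). assert (Da := is_derive_ang h x Hh).
          auto_derive.
          + split; [exists (x / rad h x); exact Dr |].
            split; [exists (x / rad h x); exact Dr |]. split; [lra |].
            split; [exists (x / rad h x); exact Dr |]. split; [lra |].
            split; [eexists; exact Da | exact I].
          + replace (Derive (fun x0 : R => rad h x0) x) with (x / rad h x) by (symmetry; apply is_derive_unique; exact Dr).
            replace (Derive (fun x0 : R => ang h x0) x) with ((h * tng h x - x) / (rad h x ^ 2 * tng h x)) by (symmetry; apply is_derive_unique; exact Da).
            pose proof (tng_gt0 h x Hh). field; lra.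
        - intros x hx.
          pose proof (rad_gt1 h x Hh) as rx. pose proof (tng_gt0 h x Hh) as qx.
          pose proof (is_derive_ang_bounds h x Hh ltac:(lra)) as [b0 b1].
          set (A := (h * tng h x - x) / (rad h x ^ 2 * tng h x)) in *.
          assert (SA : S x * A = c0 * (h * tng h x - x) / rad h x ^ 3).
          { unfold S, A; field; lra. }
          assert (S x <= S v) by (apply Smono; lra). assert (S u <= S x) by (apply Smono; lra).
          assert (S v * A <= S x * A + (S v - S u)) by nra.
          specialize (HC x ltac:(lra)).
          assert (E : (1 - mu * (x / rad h x)) / k - (1 - nu) * (x / rad h x) / rad h x ^ 2 - S x * A =
             (rad h x ^ 3 - (k * (c0 * (h * tng h x) + (1 - nu - c0) * x) + mu * x * rad h x ^ 2)) / (k * rad h x ^ 3)).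
          { rewrite SA; field; lra. }
          assert (0 <= (1 - mu * (x / rad h x)) / k - (1 - nu) * (x / rad h x) / rad h x ^ 2 - S x * A); [| lra].
          rewrite E. apply Rmult_le_pos; [lra | left; apply Rinv_0_lt_compat].
          apply Rmult_lt_0_compat; [exact Hk | apply pow_lt; lra]. }
      unfold f in Hf.
      change (2 / PI * (tng h v / rad h v)) with (S v). lra. }
  apply Rmult_le_compat_l with (r := k) in main; [| lra].
  replace (k * (W l2 - W l1)) with ((l2 - l1) - mu * (rad h l2 - rad h l1) - k * nu * (/ rad h l2 - / rad h l1)) in main; [exact main |].
  unfold W; field. pose proof (rad_gt1 h l1 Hh); pose proof (rad_gt1 h l2 Hh); lra.
Qed.

(* [k] times the area plus the increment of [Psi] is at most the length: on lines missing the
   ball, at radii at least [v], and on tangent segments (only needed if [v] allows radius 1). *)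
Definition admissible_weight (k : R) (Psi : R -> R) (v : R) : Prop :=
  0 <= k /\ (forall r r', r <= r' -> Psi r <= Psi r') /\
  (forall h l1 l2, 1 < h -> 0 <= l1 <= l2 -> v <= rad h l1 ->
     k * cap_dist (h, l1, 0) (h, l2, 0) + Psi (rad h l2) - Psi (rad h l1) <= l2 - l1) /\
  (v <= 1 -> forall r, 1 < r -> k * (1 - / r) + Psi r - Psi 1 <= sqrt (r ^ 2 - 1)).

(* [d] is the length of an arc from [x] to [y]; the radius [f] is the least one that has to
   be passed on the way. *)
Definition arc_bound (x y : pt) (d : R) : Prop :=
  exists f, 1 <= f /\ f <= nrm x /\ f <= nrm y /\ forall k Psi v, admissible_weight k Psi v -> v <= f ->
    k * cap_dist x y + Psi (nrm x) + Psi (nrm y) - 2 * Psi f <= d.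

Lemma cap_dist_rot T x y : is_rot T -> cap_dist (T x) (T y) = cap_dist x y.
Proof. intros HT; unfold cap_dist; rewrite !cap_diff_rot by exact HT; reflexivity. Qed.

Lemma nrm_rot T x : is_rot T -> nrm (T x) = nrm x.
Proof. intros [d _]; unfold nrm; rewrite d; reflexivity. Qed.

Lemma cap_dist_mirror h l1 l2 : cap_dist (h, l1, 0) (h, l2, 0) = cap_dist (h, - l1, 0) (h, - l2, 0).
Proof.
  rewrite <- (cap_dist_rot (rot23 (-1) 0)) by (apply is_rot23; ring).
  unfold rot23; cbn [fst snd]; f_equal; f_equal; try f_equal; ring.
Qed.

Lemma nrm_vertical h l : nrm (h, l, 0) = rad h l.
Proof. unfold nrm, rad, dot; cbn [fst snd]; f_equal; ring. Qed.

Lemma dist3_sqr p q : dist3 p q * dist3 p q = dot p p - 2 * dot p q + dot q q.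
Proof.
  destruct p as [[a b] c], q as [[x y] z]; unfold dist3, dot; cbn [fst snd].
  rewrite sqrt_sqrt; [ring | repeat apply Rplus_le_le_0_compat; apply pow2_ge_0].
Qed.

Lemma dist3_ge0 p q : 0 <= dist3 p q.
Proof. destruct p as [[a b] c], q as [[x y] z]; apply sqrt_pos. Qed.

Lemma dot_lin_lin s x y :
  dot (lin s x y) (lin s x y) = (1 - s) ^ 2 * dot x x + 2 * s * (1 - s) * dot x y + s ^ 2 * dot y y.
Proof. rewrite dot_lin, (dot_sym x), (dot_sym y), !dot_lin, (dot_sym y x); ring. Qed.

(** If the line met the ball beyond one end of the segment, that end would lie between the ball and
    the other end, and its cap would be contained in the other one by [cap_lin]. *)
Lemma line_avoids_ball x y :
  (forall s, 0 <= s <= 1 -> 1 < nrm (lin s x y)) ->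
  ~ (forall p, cap x p -> cap y p) -> ~ (forall p, cap y p -> cap x p) ->
  forall s, 1 < nrm (lin s x y).
Proof.
  intros H n1 n2 s. apply Rnot_le_lt; intros hs.
  destruct (Rlt_le_dec s 0) as [h | h].
  - apply n1; intros p Hp.
    apply (cap_lin (- s / (1 - s)) (lin s x y) y p); [| exact hs |].
    + split; [apply Rdiv_lt_0_compat; lra |].
      apply Rmult_le_reg_r with (1 - s); [lra |]. unfold Rdiv; rewrite Rmult_assoc, Rinv_l; lra.
    + replace (lin (- s / (1 - s)) (lin s x y) y) with x; [exact Hp |].
      destruct x as [[a b] c], y as [[a' b'] c']; unfold lin; cbn [fst snd].
      f_equal; [f_equal |]; field; lra.
  - destruct (Rle_lt_dec s 1) as [h1 | h1]; [specialize (H s ltac:(lra)); lra |].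
    apply n2; intros p Hp.
    apply (cap_lin (1 - / s) (lin s x y) x p); [| exact hs |].
    + assert (0 < / s) by (apply Rinv_0_lt_compat; lra).
      assert (/ s < 1) by (rewrite <- Rinv_1; apply Rinv_lt_contravar; lra). lra.
    + replace (lin (1 - / s) (lin s x y) x) with y; [exact Hp |].
      destruct x as [[a b] c], y as [[a' b'] c']; unfold lin; cbn [fst snd].
      f_equal; [f_equal |]; field; lra.
Qed.

Lemma arc_estimate x y d : 1 < nrm x -> 1 < nrm y -> dist3 x y <= d ->
  ~ (forall p, cap x p -> cap y p) -> ~ (forall p, cap y p -> cap x p) ->
  ((exists s, 0 <= s <= 1 /\ nrm (lin s x y) <= 1) ->
     sqrt (nrm x ^ 2 - 1) + sqrt (nrm y ^ 2 - 1) <= d) ->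
  arc_bound x y d.
Proof.
  intros hx hy hd n1 n2 Hc.
  destruct (classic (exists s, 0 <= s <= 1 /\ nrm (lin s x y) <= 1)) as [Hs | Hs].
  (* Here the caps are treated as if they were disjoint, and the tangent clause of the weight is
     applied at each end. *)
  - exists 1; repeat split; try lra. intros k Psi v [hk [_ [_ Hv]]] hv.
    specialize (Hv hv). specialize (Hc Hs).
    assert (B1 := cap_diff_le_cap x y). assert (B2 := cap_diff_le_cap y x).
    rewrite area_cap in B1, B2 by assumption.
    assert (H1 := Hv _ hx). assert (H2 := Hv _ hy).
    assert (k * cap_dist x y <= k * (1 - / nrm x) + k * (1 - / nrm y)) by (unfold cap_dist; nra). lra.
  - assert (Hline : forall s, 1 < nrm (lin s x y)).
    { apply line_avoids_ball; auto. intros s hs; apply Rnot_le_lt; intros h; apply Hs; exists s; auto. }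
    clear Hs Hc.
    destruct (planar_position x y) as [T [h [l1 [l2 [HT [hh [hl [Tx Ty]]]]]]]].
    assert (Dx : dot x x = h ^ 2 + l1 ^ 2) by (rewrite <- (proj1 HT x x), Tx; unfold dot; cbn [fst snd]; ring).
    assert (Dy : dot y y = h ^ 2 + l2 ^ 2) by (rewrite <- (proj1 HT y y), Ty; unfold dot; cbn [fst snd]; ring).
    assert (Dxy : dot x y = h ^ 2 + l1 * l2) by (rewrite <- (proj1 HT x y), Tx, Ty; unfold dot; cbn [fst snd]; ring).
    assert (hl' : l1 < l2).
    { destruct hl as [hl | hl]; [exact hl | exfalso]. subst l2.
      apply n1; intros p; rewrite <- (cap_rot T x p HT), <- (cap_rot T y p HT), Tx, Ty; auto. }
    assert (Hh : 1 < h).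
    (* The parameter of the foot of the perpendicular from the centre. *)
    { specialize (Hline (- l1 / (l2 - l1))).
      assert (E : dot (lin (- l1 / (l2 - l1)) x y) (lin (- l1 / (l2 - l1)) x y) = h ^ 2).
      { rewrite dot_lin_lin, Dx, Dy, Dxy; field; lra. }
      unfold nrm in Hline; rewrite E, sqrt_pow2 in Hline by exact hh; exact Hline. }
    assert (Hd : l2 - l1 <= d).
    { assert (S := dist3_sqr x y). rewrite Dx, Dy, Dxy in S.
      pose proof (dist3_ge0 x y). assert (l2 - l1 <= dist3 x y); [| lra].
      apply Rsqr_incr_0_var; [unfold Rsqr; nra | assumption]. }
    assert (Nx : nrm x = rad h l1) by (rewrite <- (nrm_rot T x HT), Tx; apply nrm_vertical).
    assert (Ny : nrm y = rad h l2) by (rewrite <- (nrm_rot T y HT), Ty; apply nrm_vertical).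
    assert (Dd : cap_dist x y = cap_dist (h, l1, 0) (h, l2, 0)) by (rewrite <- (cap_dist_rot T x y HT), Tx, Ty; reflexivity).
    assert (radm : forall l l', 0 <= l <= l' -> rad h l <= rad h l') by (intros; apply sqrt_le_1_alt; nra).
    assert (radn : forall l, rad h (- l) = rad h l) by (intros; unfold rad; f_equal; ring).
    rewrite Nx, Ny in *. unfold arc_bound; rewrite Nx, Ny, Dd.
    (* The least radius on the segment is attained at x, at y or at the foot (h, 0, 0); in the last
       case the two halves are estimated separately. *)
    destruct (Rle_lt_dec 0 l1) as [c1 | c1]; [| destruct (Rle_lt_dec l2 0) as [c2 | c2]].
    + exists (rad h l1); repeat split; try lra; [apply radm; lra |].
      intros k Psi v [hk [_ [Hv _]]] hv. specialize (Hv h l1 l2 Hh ltac:(lra) hv). lra.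
    + exists (rad h l2); repeat split; try lra.
      { rewrite <- (radn l1), <- (radn l2); apply radm; lra. }
      intros k Psi v [hk [_ [Hv _]]] hv.
      specialize (Hv h (- l2) (- l1) Hh ltac:(lra)). rewrite !radn in Hv.
      rewrite cap_dist_mirror, cap_dist_sym. specialize (Hv hv). lra.
    + assert (r0 : rad h 0 <= rad h l1) by (rewrite <- (radn l1); apply radm; lra).
      assert (r1 : rad h 0 <= rad h l2) by (apply radm; lra).
      exists (rad h 0); repeat split; auto.
      { left; apply rad_gt1; exact Hh. }
      intros k Psi v [hk [_ [Hv _]]] hv.
      assert (H1 := Hv h 0 (- l1) Hh ltac:(lra) hv). assert (H2 := Hv h 0 l2 Hh ltac:(lra) hv).
      rewrite radn in H1. pose proof (cap_dist_triangle (h, l1, 0) (h, 0, 0) (h, l2, 0)).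
      assert (E : cap_dist (h, l1, 0) (h, 0, 0) = cap_dist (h, 0, 0) (h, - l1, 0)).
      { rewrite cap_dist_mirror, Ropp_0; apply cap_dist_sym. }
      rewrite E in H. apply Rmult_le_compat_l with (r := k) in H; [lra | exact hk].
Qed.

(** Let m be the point of the segment in the ball. Then x.q = m.q <= |q|, so |x - q|^2 >= |x|^2 -
    2|q| + |q|^2 >= |x|^2 - 1. *)
Lemma bisector_point_dist x y q s : 0 <= s <= 1 -> nrm (lin s x y) <= 1 -> 1 <= nrm q ->
  1 <= nrm x -> dot x q = dot y q -> sqrt (nrm x ^ 2 - 1) <= dist3 x q.
Proof.
  intros Hs Hn Hq Hx E.
  assert (C := dot_le_nrm (lin s x y) q). rewrite dot_lin, <- E in C.
  assert (h : dot x q <= nrm q) by (pose proof (nrm_ge0 (lin s x y)); nra).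
  apply Rsqr_incr_0_var; [| apply dist3_ge0]. rewrite Rsqr_sqrt by nra. unfold Rsqr; rewrite dist3_sqr, <- !nrm_sqr.
  nra.
Qed.

(** * Chains of arcs and coverings by caps *)

Inductive chain : pt -> list pt -> R -> Prop :=
| chain_one x y d : arc_bound x y d -> chain x [y] d
| chain_cons x y l d d' : arc_bound x y d -> chain y l d' -> chain x (y :: l) (d + d').

Fixpoint cap_dist_sum (x : pt) (l : list pt) : R :=
  match l with [] => 0 | y :: l' => cap_dist x y + cap_dist_sum y l' end.

Lemma last_cons {A} (l : list A) a b : last (a :: l) b = last l a.
Proof.
  revert a b; induction l as [| c l IH]; intros a b; [reflexivity |].
  change (last (a :: c :: l) b) with (last (c :: l) b); rewrite !IH; reflexivity.
Qed.

(** At a joint y both arcs contribute Psi(|y|), and these two terms pay for the larger of the two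
    minima, as Psi is increasing. Only the least radius of the whole chain remains. *)
Lemma chain_estimate x l d : chain x l d ->
  exists f, 1 <= f /\ f <= nrm x /\ f <= nrm (last l x) /\ forall k Psi v, admissible_weight k Psi v -> v <= f ->
    k * cap_dist_sum x l + Psi (nrm x) + Psi (nrm (last l x)) - 2 * Psi f <= d.
Proof.
  intros H; induction H as [x y d [f [h1 [h2 [h3 h4]]]] | x y l d d' [f [h1 [h2 [h3 h4]]]] Hc [f' [g1 [g2 [g3 g4]]]]].
  - exists f; simpl; repeat split; auto. intros k Psi v Hv hv. specialize (h4 k Psi v Hv hv). lra.
  - exists (Rmin f f'). rewrite last_cons.
    pose proof (Rmin_l f f'); pose proof (Rmin_r f f').
    repeat split; try lra; [apply Rmin_glb; assumption |].
    intros k Psi v Hv hv. specialize (h4 k Psi v Hv ltac:(lra)). specialize (g4 k Psi v Hv ltac:(lra)).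
    simpl. assert (mono := proj1 (proj2 Hv)).
    assert (Psi f <= Psi (nrm y)) by (apply mono; assumption).
    assert (Psi f' <= Psi (nrm y)) by (apply mono; assumption).
    unfold Rmin; destruct (Rle_dec f f'); lra.
Qed.

Definition covers (l : list pt) : Prop := forall p, 0 < dot p p -> exists x, In x l /\ cap x p.

Fixpoint entering (x : pt) (l : list pt) (p : pt) : Prop :=
  match l with [] => False | y :: l' => (cap y p /\ ~ cap x p) \/ entering y l' p end.

Fixpoint leaving (x : pt) (l : list pt) (p : pt) : Prop :=
  match l with [] => False | y :: l' => (cap x p /\ ~ cap y p) \/ leaving y l' p end.

Lemma entering_leaving_area x l : meas (entering x l) /\ meas (leaving x l) /\
  area (entering x l) + area (leaving x l) <= cap_dist_sum x l.
Proof.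
  revert x; induction l as [| y l IH]; intros x.
  - split; [apply meas_empty | split; [apply meas_empty |]].
    simpl. change (entering x []) with (fun _ : pt => False). change (leaving x []) with (fun _ : pt => False).
    rewrite area_empty; lra.
  - destruct (IH y) as [m1 [m2 h]].
    split; [apply (meas_union (meas_cap_diff y x) m1) | split; [apply (meas_union (meas_cap_diff x y) m2) |]].
    assert (h1 := area_subadd _ _ (meas_cap_diff y x) m1). assert (h2 := area_subadd _ _ (meas_cap_diff x y) m2).
    simpl; unfold cap_dist, cap_diff. cbv beta in *.
    change (entering x (y :: l)) with (fun p => (cap y p /\ ~ cap x p) \/ entering y l p).
    change (leaving x (y :: l)) with (fun p => (cap x p /\ ~ cap y p) \/ leaving y l p).
    lra.
Qed.

Lemma entering_first x l p : (exists y, In y (x :: l) /\ cap y p) -> cap x p \/ entering x l p.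
Proof.
  revert x; induction l as [| z l IH]; intros x [y [[-> | Hy] Hp]]; try (left; exact Hp); [destruct Hy |].
  simpl. destruct (IH z (ex_intro _ y (conj Hy Hp))); tauto.
Qed.

Lemma leaving_last x l p : (exists y, In y (x :: l) /\ cap y p) -> cap (last l x) p \/ leaving x l p.
Proof.
  revert x; induction l as [| z l IH]; intros x [y [Hy Hp]].
  - destruct Hy as [-> | []]; auto.
  - rewrite last_cons; simpl. destruct Hy as [-> | Hy].
    + destruct (classic (cap z p)) as [c | c]; [| tauto].
      destruct (IH z (ex_intro _ z (conj (or_introl eq_refl) c))); tauto.
    + destruct (IH z (ex_intro _ y (conj Hy Hp))); tauto.
Qed.

Lemma last_in (l : list pt) x : In (last l x) (x :: l).
Proof. revert x; induction l as [| y l IH]; intros x; [left; reflexivity | rewrite last_cons; right; apply IH]. Qed.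

(** After a cap that misses p, the chain has to take p in again before its end. *)
Lemma entering_closed x l p : (exists y, In y (x :: l) /\ ~ cap y p) -> cap (last l x) p -> entering x l p.
Proof.
  revert x; induction l as [| z l IH]; intros x [y [Hy Hp]] Hl.
  - destruct Hy as [-> | []]; simpl in Hl; tauto.
  - destruct Hy as [-> | Hy].
    + destruct (entering_first y (z :: l) p); [| tauto | assumption].
      exists (last (z :: l) y); split; [apply last_in | exact Hl].
    + right; apply IH; [exists y; auto | rewrite last_cons in Hl; exact Hl].
Qed.

Lemma leaving_closed x l p : (exists y, In y (x :: l) /\ ~ cap y p) -> cap x p -> leaving x l p.
Proof.
  revert x; induction l as [| z l IH]; intros x [y [Hy Hp]] Hl.
  - destruct Hy as [-> | []]; tauto.
  - simpl. destruct (classic (cap z p)) as [c | c]; [right | tauto].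
    destruct Hy as [-> | Hy]; [tauto |]. apply IH; [exists y; auto | exact c].
Qed.

(** [cap (0, 0, 0)] is the origin alone, and null, so it may be added to [E]. *)
Lemma area_covering (E : pt -> Prop) : meas E -> (forall p, 0 < dot p p -> E p) -> 2 <= area E.
Proof.
  intros mE H. rewrite <- area_all.
  assert (O : area (cap (0, 0, 0)) = 0).
  { apply area_origin; [apply meas_cap |]. intros p [_ h]. pose proof (dot_ge0 p).
    replace (dot (0, 0, 0) p) with 0 in h by (unfold dot; cbn [fst snd]; ring). lra. }
  assert (h := area_subadd _ _ mE (meas_cap (0, 0, 0))). rewrite O in h.
  eapply Rle_trans; [| rewrite Rplus_0_r in h; exact h].
  apply area_mono; [apply meas_all | apply meas_union; [exact mE | apply meas_cap] |].
  intros p _. destruct (Rle_lt_or_eq_dec _ _ (dot_ge0 p)) as [h0 | h0]; [left; auto | right].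
  unfold cap. replace (dot (0, 0, 0) p) with 0 by (unfold dot; cbn [fst snd]; ring). lra.
Qed.

(** Every direction lies in the first cap or is entered later, and lies in the last cap or is left
    before; each statement covers the area 2. *)
Lemma covering_open x l : covers (x :: l) -> 4 <= area (cap x) + area (cap (last l x)) + cap_dist_sum x l.
Proof.
  intros H. destruct (entering_leaving_area x l) as [m1 [m2 h]].
  assert (h1 := area_subadd _ _ (meas_cap x) m1). assert (h2 := area_subadd _ _ (meas_cap (last l x)) m2).
  assert (c1 : 2 <= area (fun p => cap x p \/ entering x l p)).
  { apply area_covering; [apply meas_union; [apply meas_cap | exact m1] |].
    intros p hp; apply entering_first; apply H; exact hp. }
  assert (c2 : 2 <= area (fun p => cap (last l x) p \/ leaving x l p)).
  { apply area_covering; [apply meas_union; [apply meas_cap | exact m2] |].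
    intros p hp; apply leaving_last; apply H; exact hp. }
  lra.
Qed.

(** The cap that contains -p does not contain p. *)
Lemma covers_misses l p : covers l -> 0 < dot p p -> exists x, In x l /\ ~ cap x p.
Proof.
  intros H hp.
  set (p' := (- fst (fst p), - snd (fst p), - snd p)).
  assert (E1 : dot p' p' = dot p p) by (unfold p', dot; cbn [fst snd]; ring).
  destruct (H p') as [x [Hx [c1 c2]]]; [rewrite E1; exact hp |].
  exists x; split; [exact Hx |]. intros [c3 c4].
  assert (E2 : dot x p' = - dot x p) by (unfold p', dot; cbn [fst snd]; ring).
  rewrite E2 in c1. assert (dot x p = 0) by lra. rewrite H0 in c4. lra.
Qed.

Lemma covering_closed x l : covers (x :: l) -> 4 <= cap_dist_sum x (l ++ [x]).
Proof.
  intros H. destruct (entering_leaving_area x (l ++ [x])) as [m1 [m2 h]].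
  assert (Hlast : last (l ++ [x]) x = x) by apply last_last.
  assert (Hin : forall y, In y (x :: l) -> In y (x :: l ++ [x])).
  { intros y [hy | hy]; [left; exact hy | right; apply in_or_app; left; exact hy]. }
  assert (c1 : 2 <= area (entering x (l ++ [x]))).
  { apply area_covering; [exact m1 |]. intros p hp.
    destruct (covers_misses _ p H hp) as [y [Hy ny]]. destruct (H p hp) as [z [Hz cz]].
    destruct (entering_first x (l ++ [x]) p (ex_intro _ z (conj (Hin _ Hz) cz))) as [c | c]; [| exact c].
    apply entering_closed; [exists y; auto | rewrite Hlast; exact c]. }
  assert (c2 : 2 <= area (leaving x (l ++ [x]))).
  { apply area_covering; [exact m2 |]. intros p hp.
    destruct (covers_misses _ p H hp) as [y [Hy ny]]. destruct (H p hp) as [z [Hz cz]].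
    destruct (leaving_last x (l ++ [x]) p (ex_intro _ z (conj (Hin _ Hz) cz))) as [c | c]; [| exact c].
    rewrite Hlast in c. apply leaving_closed; [exists y; auto | exact c]. }
  lra.
Qed.

(** * Weights *)

Lemma PI_bounds : 3.1415 < PI < 3.1416.
Proof.
  destruct (PI_2_3_7_ineq 2) as [h1 h2].
  cbn [Nat.mul Nat.add sum_f_R0] in h1, h2; unfold tg_alt, PI_2_3_7_tg, Ratan_seq in h1, h2.
  cbn [Nat.mul Nat.add INR] in h1, h2. simpl pow in h1, h2. lra.
Qed.

Lemma c0_bounds : 0.63661 < 2 / PI < 0.63664.
Proof.
  pose proof PI_bounds as [h1 h2]. split.
  - apply Rmult_lt_reg_r with PI; [lra |]. unfold Rdiv; rewrite Rmult_assoc, Rinv_l; lra.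
  - apply Rmult_lt_reg_r with PI; [lra |]. unfold Rdiv; rewrite Rmult_assoc, Rinv_l; lra.
Qed.

Lemma cauchy_schwarz2 a b x y : (a * x + b * y) ^ 2 <= (a ^ 2 + b ^ 2) * (x ^ 2 + y ^ 2).
Proof. assert (0 <= (a * y - b * x) ^ 2) by apply pow2_ge_0. lra. Qed.

(* [k] times the area grows slower than the length along every line, at radii at least [v]. *)
Definition slow (k v : R) : Prop := forall h l, 1 < h -> 0 <= l -> v <= rad h l ->
  k * (2 / PI * (h * tng h l) + (1 - 2 / PI) * l) <= rad h l ^ 3.

(* [mu * m + beta / m] is least at [m = sqrt (beta / mu)]; it is kept constant below. *)
Definition profile (k mu r : R) : R :=
  let beta := k * (1 - 2 / PI) in
  let m := Rmax r (sqrt (beta / mu)) in mu * m + beta / m.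

Lemma profile_incr mu beta a b : 0 < mu -> 0 < beta -> sqrt (beta / mu) <= a -> a <= b ->
  mu * a + beta / a <= mu * b + beta / b.
Proof.
  intros Hm Hb Ha Hab.
  assert (0 < beta / mu) by (apply Rdiv_lt_0_compat; lra).
  assert (S0 := sqrt_lt_R0 _ H). assert (SS := sqrt_sqrt _ (Rlt_le _ _ H)).
  assert (E : mu * (beta / mu) = beta) by (field; lra).
  assert (beta <= mu * (a * b)).
  { rewrite <- E. apply Rmult_le_compat_l; [lra |]. rewrite <- SS. nra. }
  apply Rmult_le_reg_r with (a * b); [nra |].
  replace ((mu * a + beta / a) * (a * b)) with (mu * a * (a * b) + beta * b) by (field; nra).
  replace ((mu * b + beta / b) * (a * b)) with (mu * b * (a * b) + beta * a) by (field; nra).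
  nra.
Qed.

Lemma beta_pos k : 0 < k -> 0 < k * (1 - 2 / PI).
Proof. intros; pose proof c0_bounds; nra. Qed.

Lemma sqrt_ratio_pos k mu : 0 < k -> 0 < mu -> 0 < sqrt (k * (1 - 2 / PI) / mu).
Proof. intros hk hm; apply sqrt_lt_R0, Rdiv_lt_0_compat; [apply beta_pos |]; assumption. Qed.

Lemma profile_mono k mu r r' : 0 < k -> 0 < mu -> r <= r' -> profile k mu r <= profile k mu r'.
Proof.
  intros hk hm hr; unfold profile; apply profile_incr; [assumption | apply beta_pos; assumption | apply Rmax_r |].
  apply Rle_max_compat_r; exact hr.
Qed.

Lemma profile_weight k mu v : 0 < k -> 0 < mu -> slow k v ->
  (forall r, v <= r -> 1 < r -> (2 / PI * k) ^ 2 * (r ^ 2 - 1) + mu ^ 2 * r ^ 4 <= r ^ 4) ->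
  (v <= 1 -> forall r, 1 < r -> k * (1 - / r) + profile k mu r - profile k mu 1 <= sqrt (r ^ 2 - 1)) ->
  admissible_weight k (profile k mu) v.
Proof.
  intros hk hm Hslow Hcs Htan.
  split; [lra | split; [intros; apply profile_mono; assumption | split; [| exact Htan]]].
  set (r1 := sqrt (k * (1 - 2 / PI) / mu)).
  assert (Hr1 : 0 < r1) by (apply sqrt_ratio_pos; assumption).
  assert (radm : forall h l l', 0 <= l <= l' -> rad h l <= rad h l') by (intros; apply sqrt_le_1_alt; nra).
  assert (low : forall h l1 l2, 1 < h -> 0 <= l1 <= l2 -> v <= rad h l1 -> rad h l2 <= r1 ->
     k * cap_dist (h, l1, 0) (h, l2, 0) + profile k mu (rad h l2) - profile k mu (rad h l1) <= l2 - l1).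
  { intros h l1 l2 Hh Hl Hv Hr.
    assert (rad h l1 <= rad h l2) by (apply radm; lra).
    unfold profile; fold r1; rewrite !Rmax_right by lra.
    (* Below [r1] the profile is constant, and the condition on the rate is exactly [slow]. *)
    assert (E := segment_estimate h l1 l2 k 0 0 Hh Hl hk). 
    assert (k * cap_dist (h, l1, 0) (h, l2, 0) <= l2 - l1); [| lra].
    eapply Rle_trans; [apply E |]; [| lra].
    intros l hl. assert (rad h l1 <= rad h l) by (apply radm; lra).
    specialize (Hslow h l Hh ltac:(lra) ltac:(lra)). lra. }
  assert (high : forall h l1 l2, 1 < h -> 0 <= l1 <= l2 -> v <= rad h l1 -> r1 <= rad h l1 ->
     k * cap_dist (h, l1, 0) (h, l2, 0) + profile k mu (rad h l2) - profile k mu (rad h l1) <= l2 - l1).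
  { intros h l1 l2 Hh Hl Hv Hr.
    assert (rad h l1 <= rad h l2) by (apply radm; lra).
    unfold profile; fold r1; rewrite !Rmax_left by lra.
    (* This [nu] cancels the term in l and produces the summand beta/r of the profile. What remains
       is a scalar product with (h, l), to which Cauchy-Schwarz applies. *)
    assert (E := segment_estimate h l1 l2 k mu (1 - 2 / PI) Hh Hl hk).
    unfold Rdiv at 2 3. lapply E; [clear E; intros E; lra |].
    intros l hl. assert (rad h l1 <= rad h l) by (apply radm; lra).
    pose proof (rad_gt1 h l Hh) as rg.
    specialize (Hcs (rad h l) ltac:(lra) rg).
    pose proof (rad_sqr h l) as rs. pose proof (tng_sqr h l Hh) as ts. pose proof (tng_gt0 h l Hh) as tg.
    set (r := rad h l) in *. set (q := tng h l) in *.
    apply Rsqr_incr_0_var; [| apply pow_le; lra].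
    assert (C := cauchy_schwarz2 (2 / PI * k * q) (mu * r ^ 2) h l).
    replace (h ^ 2 + l ^ 2) with (r * r) in C by lra.
    unfold Rsqr.
    replace (k * (2 / PI * (h * q) + (1 - (1 - 2 / PI) - 2 / PI) * l) + mu * l * r ^ 2)
      with (2 / PI * k * q * h + mu * r ^ 2 * l) by ring.
    replace (q ^ 2) with (r ^ 2 - 1) in * by nra.
    assert (((2 / PI * k * q) ^ 2 + (mu * r ^ 2) ^ 2) <= r ^ 4).
    { replace ((2 / PI * k * q) ^ 2) with ((2 / PI * k) ^ 2 * (q * q)) by ring.
      rewrite ts. replace (h ^ 2 + l ^ 2 - 1) with (r ^ 2 - 1) by lra. 
      replace ((mu * r ^ 2) ^ 2) with (mu ^ 2 * r ^ 4) by ring. exact Hcs. }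
    assert (0 <= r * r) by nra. 
    replace (r ^ 3 * r ^ 3) with (r ^ 4 * (r * r)) by ring. nra. }
  intros h l1 l2 Hh Hl Hv.
  destruct (Rle_lt_dec r1 (rad h l1)) as [c | c]; [apply high; assumption |].
  destruct (Rle_lt_dec (rad h l2) r1) as [c' | c']; [apply low; assumption |].
  pose proof (rad_sqr h l1) as s1. pose proof (rad_sqr h l2) as s2. pose proof (rad_gt1 h l1 Hh).
  assert (0 <= r1 ^ 2 - h ^ 2) by nra.
  (* The line reaches radius [r1] here, where the two regimes of the profile meet. *)
  set (m := sqrt (r1 ^ 2 - h ^ 2)).
  assert (Sm : m * m = r1 ^ 2 - h ^ 2) by (apply sqrt_sqrt; assumption).
  assert (Hm0 : 0 <= m) by apply sqrt_pos.
  assert (Rm : rad h m = r1).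
  { unfold rad. replace (h ^ 2 + m ^ 2) with (r1 ^ 2) by lra. apply sqrt_pow2; lra. }
  assert (l1 <= m) by (apply Rsqr_incr_0_var; [unfold Rsqr; nra | exact Hm0]).
  assert (m <= l2) by (apply Rsqr_incr_0_var; [unfold Rsqr; nra | lra]).
  assert (L := low h l1 m Hh ltac:(lra) Hv ltac:(lra)).
  assert (U := high h m l2 Hh ltac:(lra) ltac:(lra) ltac:(lra)).
  pose proof (cap_dist_triangle (h, l1, 0) (h, m, 0) (h, l2, 0)) as T.
  apply Rmult_le_compat_l with (r := k) in T; lra.
Qed.

(** With m the maximum in [profile], k/r >= k/m, and the arithmetic-geometric mean inequality for (k
    + beta)/m and mu m gives a bound independent of r. *)
Lemma profile_end k mu r : 0 < k -> 0 < mu ->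
  2 * sqrt ((k + k * (1 - 2 / PI)) * mu) <= k / r + profile k mu r \/ r <= 0.
Proof.
  intros hk hm. destruct (Rle_lt_dec r 0) as [c | c]; [right; exact c | left].
  unfold profile. set (beta := k * (1 - 2 / PI)).
  assert (Hb : 0 < beta) by (apply beta_pos; exact hk).
  set (m := Rmax r (sqrt (beta / mu))).
  assert (r <= m) by apply Rmax_l.
  assert (k / m <= k / r).
  { apply Rmult_le_compat_l; [lra |]. apply Rinv_le_contravar; assumption. }
  assert (2 * sqrt ((k + beta) * mu) <= (k + beta) / m + mu * m).
  { set (A := (k + beta) / m). set (B := mu * m).
    assert (0 < A) by (apply Rdiv_lt_0_compat; lra). assert (0 < B) by (unfold B; nra).
    replace ((k + beta) * mu) with (A * B) by (unfold A, B; field; lra).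
    apply Rsqr_incr_0_var; [| lra].
    rewrite Rsqr_mult, Rsqr_sqrt by nra. unfold Rsqr. assert (0 <= (A - B) ^ 2) by apply pow2_ge_0. lra. }
  unfold Rdiv in *; lra.
Qed.

Definition tangent_ratio := 3 * sqrt 3 / 2.

Lemma tangent_ratio_sqr : tangent_ratio * tangent_ratio = 27 / 4.
Proof. unfold tangent_ratio; assert (H := sqrt_sqrt 3 ltac:(lra)). nra. Qed.

Lemma tangent_ratio_bounds : 2.59807 < tangent_ratio < 2.59808.
Proof.
  assert (H := tangent_ratio_sqr). assert (0 <= tangent_ratio) by (unfold tangent_ratio; pose proof (sqrt_pos 3); lra). nra.
Qed.

(* For [q^2 <= 0.57] the bound is attained on tangent lines ([h = 1], [l = q]), and reduces to
   [q / r^3 <= 2 / (3 sqrt 3)]; beyond, the Cauchy-Schwarz inequality is strong enough. *)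
Lemma slow_tangent_ratio v : slow tangent_ratio v.
Proof.
  intros h l Hh Hl _. pose proof c0_bounds as Hc. pose proof tangent_ratio_sqr as Hk. pose proof tangent_ratio_bounds as Hkb.
  pose proof (rad_gt1 h l Hh) as rg. pose proof (rad_sqr h l) as rs.
  pose proof (tng_sqr h l Hh) as ts. pose proof (tng_gt0 h l Hh) as tg.
  set (r := rad h l) in *. set (q := tng h l) in *. set (c0 := 2 / PI) in *.
  assert (rq : r * r = 1 + q * q) by lra.
  (* The comparison with the tangent line needs 1 - c0 - c0 q^2 >= 0, that is q^2 <= PI/2 - 1 =
     0.5707... *)
  destruct (Rle_lt_dec (q * q) 0.57) as [c | c].
  - assert (Hlq : l <= q) by nra.
    assert (hh : h * h - 1 = (q - l) * (q + l)) by lra.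
    assert (hle : h - 1 <= (q - l) * q).
    { assert (2 * (h - 1) <= h * h - 1) by nra. nra. }
    assert (A : c0 * (h * q) + (1 - c0) * l <= q).
    { assert (c0 * (h - 1) * q <= c0 * ((q - l) * q) * q) by (apply Rmult_le_compat_r; [lra | apply Rmult_le_compat_l; lra]).
      assert (0 <= (q - l) * (1 - c0 - c0 * (q * q))) by (apply Rmult_le_pos; nra). lra. }
    apply Rle_trans with (tangent_ratio * q); [apply Rmult_le_compat_l; lra |].
    apply Rsqr_incr_0_var; [| apply pow_le; lra]. unfold Rsqr.
    replace (tangent_ratio * q * (tangent_ratio * q)) with ((tangent_ratio * tangent_ratio) * (q * q)) by ring. rewrite Hk.
    replace (r ^ 3 * r ^ 3) with ((r * r) ^ 3) by ring. rewrite rq.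
    set (y := q * q). assert (0 <= y) by (unfold y; nra).
    (* This product equals (1 + y)^3 - 27y/4; its double root 1/2 is where the ratio is attained. *)
    assert (0 <= (y - 1 / 2) ^ 2 * (y + 4)) by (apply Rmult_le_pos; [apply pow2_ge_0 | lra]). lra.
  - apply Rsqr_incr_0_var; [| apply pow_le; lra]. unfold Rsqr.
    assert (C := cauchy_schwarz2 (c0 * q) (1 - c0) h l).
    replace (h ^ 2 + l ^ 2) with (r * r) in C by lra.
    replace (tangent_ratio * (c0 * (h * q) + (1 - c0) * l) * (tangent_ratio * (c0 * (h * q) + (1 - c0) * l)))
      with ((tangent_ratio * tangent_ratio) * (c0 * q * h + (1 - c0) * l) ^ 2) by ring. rewrite Hk.
    replace (r ^ 3 * r ^ 3) with ((r * r) * (r * r) * (r * r)) by ring.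
    set (y := q * q) in *.
    assert (B : 27 / 4 * ((c0 * q) ^ 2 + (1 - c0) ^ 2) <= (1 + y) * (1 + y)).
    { replace ((c0 * q) ^ 2) with (c0 ^ 2 * y) by (unfold y; ring).
      assert (c0 ^ 2 <= 0.40532) by nra. assert ((1 - c0) ^ 2 <= 0.13206) by nra. nra. }
    rewrite <- rq in B. assert (0 <= r * r) by nra. nra.
Qed.

Lemma slow_cauchy k v : 0 < k ->
  (forall r, v <= r -> 1 < r -> k ^ 2 * ((2 / PI) ^ 2 * (r ^ 2 - 1) + (1 - 2 / PI) ^ 2) <= r ^ 4) ->
  slow k v.
Proof.
  intros hk H h l Hh Hl Hv.
  pose proof (rad_gt1 h l Hh) as rg. pose proof (rad_sqr h l) as rs.
  pose proof (tng_sqr h l Hh) as ts. specialize (H _ Hv rg).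
  set (r := rad h l) in *. set (q := tng h l) in *. set (c0 := 2 / PI) in *.
  apply Rsqr_incr_0_var; [| apply pow_le; lra]. unfold Rsqr.
  assert (C := cauchy_schwarz2 (c0 * q) (1 - c0) h l).
  replace (h ^ 2 + l ^ 2) with (r * r) in C by lra.
  replace (k * (c0 * (h * q) + (1 - c0) * l) * (k * (c0 * (h * q) + (1 - c0) * l)))
    with (k ^ 2 * (c0 * q * h + (1 - c0) * l) ^ 2) by ring.
  replace (r ^ 3 * r ^ 3) with (r ^ 4 * (r * r)) by ring.
  replace ((c0 * q) ^ 2) with (c0 ^ 2 * (r ^ 2 - 1)) in C.
  2: { replace (r ^ 2 - 1) with (q * q) by lra; ring. }
  assert (0 <= k ^ 2) by nra. assert (0 <= r * r) by nra.
  apply Rmult_le_compat_l with (r := k ^ 2) in C; [| assumption].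
  apply Rmult_le_compat_r with (r := r * r) in H; [| assumption]. lra.
Qed.

Lemma profile_le k mu b r : 0 < k -> 0 < mu -> r <= b -> k * (1 - 2 / PI) / mu <= b ^ 2 -> 0 < b ->
  profile k mu r <= mu * b + k * (1 - 2 / PI) / b.
Proof.
  intros hk hm hr hb b0. unfold profile.
  assert (Hb := beta_pos k hk). set (beta := k * (1 - 2 / PI)) in *.
  assert (sqrt (beta / mu) <= b).
  { rewrite <- (sqrt_pow2 b) by lra. apply sqrt_le_1_alt; exact hb. }
  apply profile_incr; [assumption | assumption | apply Rmax_r |].
  apply Rmax_lub; assumption.
Qed.

Lemma sqrt_lower a b : 0 <= a -> a ^ 2 <= b -> a <= sqrt b.
Proof. intros ha h; rewrite <- (sqrt_pow2 a) by exact ha; apply sqrt_le_1_alt; exact h. Qed.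

(** The root is 7.9017...; half of it, rounded up, is what each end of the arc has to contribute in
    [open_numeric]. *)
Lemma open_constant : sqrt ((PI + 2) ^ 2 + 36) <= 2 * 3.951.
Proof.
  pose proof PI_bounds. rewrite <- (sqrt_pow2 (2 * 3.951)) by lra. apply sqrt_le_1_alt; nra.
Qed.

(* The three ranges of [f] need different multipliers: a large [k] is only allowed far from
   the ball, where in turn little is lost at the ends. *)
Lemma open_numeric f : 1 <= f -> exists k Psi v, admissible_weight k Psi v /\ v <= f /\
  forall r, f <= r -> 3.951 <= k + k / r + Psi r - Psi f.
Proof.
  intros hf. pose proof c0_bounds as Hc. set (c0 := 2 / PI) in *.
  assert (c2 : 0.40527 <= c0 ^ 2 <= 0.405311) by nra.
  assert (d2 : (1 - c0) ^ 2 <= 0.13206) by nra.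
  (* Common end of the three cases: [profile_end] bounds the terms in r from below uniformly, and
     [profile_le] bounds the profile at f by its formula at the upper end [b] of the range of f. *)
  assert (fin : forall k mu b, 0 < k -> 0 < mu -> f <= b -> k * (1 - c0) / mu <= b ^ 2 ->
     3.951 + mu * b + k * (1 - c0) / b <= k + 2 * sqrt ((k + k * (1 - c0)) * mu) ->
     forall r, f <= r -> 3.951 <= k + k / r + profile k mu r - profile k mu f).
  { intros k mu b hk hm hb h1 h2 r hr.
    assert (P := profile_le k mu b f hk hm hb h1 ltac:(lra)). fold c0 in P.
    destruct (profile_end k mu r hk hm) as [Q | Q]; [| lra]. fold c0 in Q. lra. }
  pose proof tangent_ratio_sqr as Ks. pose proof tangent_ratio_bounds as Kb.
  destruct (Rle_lt_dec f 1.42) as [h1 | h1]; [| destruct (Rle_lt_dec f 2) as [h2 | h2]].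
  (* The Cauchy-Schwarz condition of [profile_weight] is tightest at r^2 = 2, where it reads mu^2 <=
     1 - (k/PI)^2; 0.562 is just below this limit. *)
  - exists tangent_ratio, (profile tangent_ratio 0.562), 1. split; [| split; [lra |]].
    + apply profile_weight; [lra | lra | apply slow_tangent_ratio | |].
      * intros r _ hr; fold c0. replace ((c0 * tangent_ratio) ^ 2) with (c0 ^ 2 * (tangent_ratio * tangent_ratio)) by ring. rewrite Ks.
        replace (r ^ 4) with (r ^ 2 * r ^ 2) by ring. set (x := r ^ 2).
        assert (1 < x) by (unfold x; nra).
        assert (c0 ^ 2 * (27 / 4) * (x - 1) <= 2.73585 * (x - 1)) by (apply Rmult_le_compat_r; lra).
        assert (0 <= (x - 2) ^ 2) by apply pow2_ge_0. nra.
      * intros _ r hr.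
        (* Beyond its minimum at [r1] the profile exceeds its least value by exactly mu (r - r1)^2 /
           r, and r1 >= 1. *)
        assert (P : profile tangent_ratio 0.562 r - profile tangent_ratio 0.562 1 <= 0.562 * (r - 1) ^ 2 / r).
        { unfold profile; fold c0. set (beta := tangent_ratio * (1 - c0)).
          assert (Hb : 0.94 <= beta <= 0.945) by (unfold beta; nra).
          assert (0 < beta / 0.562) by (apply Rdiv_lt_0_compat; lra).
          set (r1 := sqrt (beta / 0.562)).
          assert (0 < r1) by (apply sqrt_lt_R0; assumption).
          assert (S := sqrt_sqrt (beta / 0.562) ltac:(lra)). fold r1 in S.
          assert (Eb : beta = 0.562 * (r1 * r1)) by (rewrite S; field; lra).
          assert (1 <= r1) by nra.
          rewrite (Rmax_right 1 r1) by assumption.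
          destruct (Rle_lt_dec r r1) as [c | c].
          - rewrite Rmax_right by exact c. rewrite Rminus_diag_eq by reflexivity.
            apply Rmult_le_pos; [assert (0 <= (r - 1) ^ 2) by apply pow2_ge_0; lra | left; apply Rinv_0_lt_compat; lra].
          - rewrite Rmax_left by lra.
            apply Rmult_le_reg_r with r; [lra |].
            replace (0.562 * (r - 1) ^ 2 / r * r) with (0.562 * (r - 1) ^ 2) by (field; lra).
            replace ((0.562 * r + beta / r - (0.562 * r1 + beta / r1)) * r) with (0.562 * (r - r1) ^ 2).
            + assert ((r - r1) ^ 2 <= (r - 1) ^ 2) by nra. lra.
            + rewrite Eb; field; lra. }
        apply Rle_trans with ((r - 1) / r * (tangent_ratio + 0.562 * (r - 1))).
        { replace (tangent_ratio * (1 - / r)) with ((r - 1) / r * tangent_ratio) by (field; lra).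
          replace (0.562 * (r - 1) ^ 2 / r) with ((r - 1) / r * (0.562 * (r - 1))) in P by (field; lra). lra. }
        apply sqrt_lower.
        { apply Rmult_le_pos; [apply Rmult_le_pos; [lra | left; apply Rinv_0_lt_compat; lra] | lra]. }
        set (u := r - 1). assert (hu : 0 < u) by (unfold u; lra).
        replace (r ^ 2 - 1) with (u * (u + 2)) by (unfold u; ring).
        replace ((u / r * (tangent_ratio + 0.562 * u)) ^ 2) with (u * (u * (tangent_ratio + 0.562 * u) ^ 2) / r ^ 2) by (field; lra).
        apply Rmult_le_reg_r with (r ^ 2); [nra |].
        replace (u * (u * (tangent_ratio + 0.562 * u) ^ 2) / r ^ 2 * r ^ 2) with (u * (u * (tangent_ratio + 0.562 * u) ^ 2)) by (field; lra).
        replace (u * (u + 2) * r ^ 2) with (u * ((u + 2) * (u + 1) ^ 2)) by (unfold u; ring).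
        apply Rmult_le_compat_l; [lra |].
        replace ((tangent_ratio + 0.562 * u) ^ 2) with (tangent_ratio * tangent_ratio + 1.124 * tangent_ratio * u + 0.315844 * u ^ 2) by lra.
        rewrite Ks.
        assert (1.124 * tangent_ratio * u <= 2.921 * u) by nra.
        assert (u * (27 / 4 + 1.124 * tangent_ratio * u + 0.315844 * u ^ 2) <= u * (27 / 4 + 2.921 * u + 0.315844 * u ^ 2)) by (apply Rmult_le_compat_l; lra).
        assert (0 <= u * (u - 0.8) ^ 2) by (apply Rmult_le_pos; [lra | apply pow2_ge_0]).
        nra.
    + apply (fin tangent_ratio 0.562 1.42); try lra.
      * apply Rmult_le_reg_r with 0.562; [lra |].
        replace (tangent_ratio * (1 - c0) / 0.562 * 0.562) with (tangent_ratio * (1 - c0)) by (field; lra). nra.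
      * assert (E1 : 0.94399 <= tangent_ratio * (1 - c0) <= 0.94412) by nra.
        assert (1.4107 <= sqrt ((tangent_ratio + tangent_ratio * (1 - c0)) * 0.562)) by (apply sqrt_lower; lra).
        unfold Rdiv; rewrite (Rmult_comm _ (/ 1.42)).
        assert (/ 1.42 * (tangent_ratio * (1 - c0)) <= / 1.42 * 0.94412) by (apply Rmult_le_compat_l; lra). lra.
  (* [slow_cauchy] from radius 1.42 on permits k slightly above 2.73, and 0.494 is just below sqrt(1
     - (k/PI)^2). *)
  - exists 2.73, (profile 2.73 0.494), 1.42. split; [| split; [lra |]].
    + apply profile_weight; [lra | lra | apply slow_cauchy; [lra |] | |].
      * intros r hv hr; fold c0. replace (r ^ 4) with (r ^ 2 * r ^ 2) by ring. set (x := r ^ 2).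
        assert (2.0164 <= x) by (unfold x; nra).
        assert (c0 ^ 2 * (x - 1) <= 0.405311 * (x - 1)) by (apply Rmult_le_compat_r; lra). nra.
      * intros r hv hr; fold c0. replace ((c0 * 2.73) ^ 2) with (c0 ^ 2 * 7.4529) by lra.
        replace (r ^ 4) with (r ^ 2 * r ^ 2) by ring. set (x := r ^ 2).
        assert (1 < x) by (unfold x; nra).
        assert (c0 ^ 2 * (x - 1) <= 0.405311 * (x - 1)) by (apply Rmult_le_compat_r; lra).
        assert (0 <= (x - 2) ^ 2) by apply pow2_ge_0. nra.
      * lra.
    + apply (fin 2.73 0.494 2); try lra.
      assert (1.35595 <= sqrt ((2.73 + 2.73 * (1 - c0)) * 0.494)) by (apply sqrt_lower; lra). lra.
  (* Far from the ball k may grow in proportion to f; the factors are limited by (2 * 1.45 / PI)^2 +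
     0.38^2 < 1. *)
  - exists (1.45 * f), (profile (1.45 * f) 0.38), f. split; [| split; [lra |]].
    + apply profile_weight; [lra | lra | apply slow_cauchy; [lra |] | |].
      * intros r hv hr; fold c0.
        assert (F : (1.45 * f) ^ 2 <= 2.1025 * r ^ 2) by nra.
        set (x := r ^ 2) in *. replace (r ^ 4) with (x * x) by (unfold x; ring).
        assert (4 <= x) by (unfold x; nra).
        assert (c0 ^ 2 * (x - 1) <= 0.405311 * (x - 1)) by (apply Rmult_le_compat_r; lra).
        assert (0 <= (1.45 * f) ^ 2) by apply pow2_ge_0.
        assert (c0 ^ 2 * (x - 1) + (1 - c0) ^ 2 <= 0.405311 * x) by lra.
        apply Rle_trans with ((1.45 * f) ^ 2 * (0.405311 * x)); [apply Rmult_le_compat_l; assumption |].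
        apply Rle_trans with (2.1025 * x * (0.405311 * x)); [apply Rmult_le_compat_r; lra | nra].
      * intros r hv hr; fold c0. 
        assert (F : (1.45 * f) ^ 2 <= 2.1025 * r ^ 2) by nra.
        set (x := r ^ 2) in *. replace (r ^ 4) with (x * x) by (unfold x; ring).
        assert (4 <= x) by (unfold x; nra).
        replace ((c0 * (1.45 * f)) ^ 2) with (c0 ^ 2 * (1.45 * f) ^ 2) by ring.
        assert (0 <= (1.45 * f) ^ 2) by apply pow2_ge_0.
        assert (c0 ^ 2 * (1.45 * f) ^ 2 <= 0.405311 * (2.1025 * x)) by (apply Rmult_le_compat; lra).
        assert (c0 ^ 2 * (1.45 * f) ^ 2 * (x - 1) <= 0.405311 * (2.1025 * x) * (x - 1)) by (apply Rmult_le_compat_r; lra).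
        nra.
      * lra.
    + apply (fin (1.45 * f) 0.38 f); try lra.
      * apply Rmult_le_reg_r with 0.38; [lra |].
        replace (1.45 * f * (1 - c0) / 0.38 * 0.38) with (1.45 * f * (1 - c0)) by (field; lra). nra.
      * replace (1.45 * f * (1 - c0) / f) with (1.45 * (1 - c0)) by (field; lra).
        assert (1.22 <= sqrt ((1.45 * f + 1.45 * f * (1 - c0)) * 0.38)) by (apply sqrt_lower; nra). lra.
Qed.

Lemma closed_weight : admissible_weight tangent_ratio (fun _ => 0) 1.
Proof.
  pose proof tangent_ratio_bounds as Kb. pose proof tangent_ratio_sqr as Ks.
  split; [lra | split; [intros; lra | split]].
  - intros h l1 l2 Hh Hl _.
    assert (E := segment_estimate h l1 l2 tangent_ratio 0 0 Hh Hl ltac:(lra)).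
    assert (tangent_ratio * cap_dist (h, l1, 0) (h, l2, 0) <= l2 - l1); [| lra].
    eapply Rle_trans; [apply E |]; [| lra].
    intros l hl. assert (H := slow_tangent_ratio 0 h l Hh ltac:(lra) (sqrt_pos _)). lra.
  - intros _ r hr. replace (tangent_ratio * (1 - / r) + 0 - 0) with (tangent_ratio * ((r - 1) / r)) by (field; lra).
    apply sqrt_lower.
    { apply Rmult_le_pos; [lra |]. apply Rmult_le_pos; [lra | left; apply Rinv_0_lt_compat; lra]. }
    set (u := r - 1). assert (hu : 0 < u) by (unfold u; lra).
    replace (r ^ 2 - 1) with (u * (u + 2)) by (unfold u; ring).
    replace ((tangent_ratio * (u / r)) ^ 2) with (u * (tangent_ratio * tangent_ratio * u) / r ^ 2) by (field; lra).
    rewrite Ks. apply Rmult_le_reg_r with (r ^ 2); [nra |].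
    replace (u * (27 / 4 * u) / r ^ 2 * r ^ 2) with (u * (27 / 4 * u)) by (field; lra).
    replace (u * (u + 2) * r ^ 2) with (u * ((u + 2) * (u + 1) ^ 2)) by (unfold u; ring).
    apply Rmult_le_compat_l; [lra |]. nra.
Qed.

(** * Curves *)

Lemma dist3_triangle p q r : dist3 p r <= dist3 p q + dist3 q r.
Proof.
  assert (E : forall u v, dist3 u v = nrm (fst (fst u) - fst (fst v), snd (fst u) - snd (fst v), snd u - snd v)).
  { intros [[a b] c] [[x y] z]; unfold dist3, nrm, dot; cbn [fst snd]; f_equal; ring. }
  rewrite !E.
  set (u := (fst (fst p) - fst (fst q), snd (fst p) - snd (fst q), snd p - snd q)).
  set (v := (fst (fst q) - fst (fst r), snd (fst q) - snd (fst r), snd q - snd r)).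
  set (w := (fst (fst p) - fst (fst r), snd (fst p) - snd (fst r), snd p - snd r)).
  pose proof (nrm_ge0 u); pose proof (nrm_ge0 v).
  apply Rsqr_incr_0_var; [| lra]. unfold Rsqr.
  rewrite nrm_sqr. pose proof (dot_le_nrm u v) as C.
  assert (dot w w = dot u u + 2 * dot u v + dot v v) by (unfold w, u, v, dot; cbn [fst snd]; ring).
  rewrite H1, <- !nrm_sqr. nra.
Qed.

Lemma dist3_sym p q : dist3 p q = dist3 q p.
Proof. destruct p as [[a b] c], q as [[x y] z]; unfold dist3; f_equal; ring. Qed.

Fixpoint incr (s : R) (l : list R) : Prop :=
  match l with [] => True | t :: l' => s <= t /\ incr t l' end.

Fixpoint plen (X : R -> pt) (s : R) (l : list R) : R :=
  match l with [] => 0 | t :: l' => dist3 (X t) (X s) + plen X t l' end.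

Lemma incr_app s l m : incr s (l ++ m) <-> incr s l /\ incr (last l s) m.
Proof.
  revert s; induction l as [| t l IH]; intros s; [simpl; tauto |].
  rewrite last_cons; simpl; rewrite IH; tauto.
Qed.

Lemma plen_app X s l m : plen X s (l ++ m) = plen X s l + plen X (last l s) m.
Proof.
  revert s; induction l as [| t l IH]; intros s; [simpl; ring |].
  rewrite last_cons; simpl; rewrite IH; ring.
Qed.

Lemma last_app {A} (l m : list A) s : last (l ++ m) s = last m (last l s).
Proof.
  revert s; induction l as [| t l IH]; intros s; [reflexivity |].
  simpl app; rewrite !last_cons; apply IH.
Qed.

Lemma incr_last s l : incr s l -> s <= last l s.
Proof.
  revert s; induction l as [| t l IH]; intros s H; [simpl; lra |].
  rewrite last_cons; destruct H as [h1 h2]; specialize (IH t h2); lra.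
Qed.

Lemma plen_ge0 X s l : 0 <= plen X s l.
Proof.
  revert s; induction l as [| t l IH]; intros s; simpl; [lra |].
  pose proof (dist3_ge0 (X t) (X s)); specialize (IH t); lra.
Qed.

Lemma rsum_shift n f : rsum (S n) f = f O + rsum n (fun i => f (S i)).
Proof.
  induction n as [| n IH]; [simpl; ring |].
  change (rsum (S (S n)) f) with (rsum (S n) f + f (S n)). rewrite IH; simpl; ring.
Qed.

Lemma plen_rsum X s l :
  plen X s l = rsum (length l) (fun i => dist3 (X (nth (S i) (s :: l) 0)) (X (nth i (s :: l) 0))).
Proof.
  revert s; induction l as [| t l IH]; intros s; [reflexivity |].
  change (length (t :: l)) with (S (length l)); rewrite rsum_shift.
  change (plen X s (t :: l)) with (dist3 (X t) (X s) + plen X t l). rewrite IH; reflexivity.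
Qed.

Lemma plen_le_length g a b L l : incr a l -> last l a = b ->
  curve_length g a b = Finite L -> plen g a l <= L.
Proof.
  intros Hi Hl HL.
  assert (H := Lub_Rbar_correct (fun s => exists n t, is_partition a b n t /\ s = inscribed_sum g n t)).
  fold (curve_length g a b) in H; rewrite HL in H.
  apply (proj1 H). exists (length l), (fun i => nth i (a :: l) 0); split; [| apply plen_rsum].
  split; [reflexivity | split].
  - rewrite <- Hl. clear. revert a; induction l as [| t l IH]; intros a; [reflexivity |].
    rewrite last_cons. apply (IH t).
  - clear - Hi. revert a Hi; induction l as [| t l IH]; intros a Hi i hi; [simpl in hi; lia |].
    destruct Hi as [h1 h2]. destruct i as [| i]; [exact h1 |].
    apply (IH t h2 i). simpl in hi; lia.
Qed.

Section Curve.
Variables (X : R -> pt) (a b : R).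
Hypothesis X_outside : forall t, 1 < nrm (X t).
Hypothesis X_cont : forall v, continuity (fun t => dot v (X t)).

Let noncomp (s t : R) : Prop :=
  ~ (forall p, cap (X s) p -> cap (X t) p) /\ ~ (forall p, cap (X t) p -> cap (X s) p).

Let hits (x y : pt) : Prop := exists s, 0 <= s <= 1 /\ nrm (lin s x y) <= 1.

(** For a point m of the ball on the segment, m.x <= |x| < |x|^2, so the step from x to y goes
    against x; likewise at y. Hence (x - y).q changes sign between the ends of the arc. *)
Lemma hits_obtuse x y : 1 < nrm x -> 1 < nrm y -> hits x y -> 0 <= dot x x - dot y x /\ dot x y - dot y y <= 0.
Proof.
  intros hx hy [s [hs hn]].
  assert (C1 := dot_le_nrm (lin s x y) x). assert (C2 := dot_le_nrm (lin s x y) y).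
  rewrite !dot_lin in C1, C2. rewrite (dot_sym y x) in *.
  pose proof (nrm_sqr x) as sx. pose proof (nrm_sqr y) as sy. pose proof (nrm_ge0 (lin s x y)).
  assert (dot x x > nrm x) by nra. assert (dot y y > nrm y) by nra.
  assert (D1 : (1 - s) * dot x x + s * dot x y < dot x x) by nra.
  assert (D2 : (1 - s) * dot x y + s * dot y y < dot y y) by nra.
  split.
  - assert (0 < s) by (destruct hs as [[h | h] _]; [exact h | subst s; lra]). nra.
  - assert (0 < 1 - s) by (destruct hs as [_ [h | h]]; [lra | subst s; lra]). nra.
Qed.

Lemma ivt_root x y u v : u <= v -> 0 <= dot x (X u) - dot y (X u) -> dot x (X v) - dot y (X v) <= 0 ->
  exists q, u <= q <= v /\ dot x (X q) = dot y (X q).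
Proof.
  intros huv h1 h2.
  destruct (IVT_gen (fun t => dot x (X t) - dot y (X t)) u v 0) as [q [hq E]].
  - apply continuity_minus; apply X_cont.
  - rewrite Rmin_right, Rmax_left by lra; lra.
  - rewrite Rmin_left, Rmax_right in hq by lra. exists q; split; [exact hq | lra].
Qed.

Lemma arc_through s t q d : noncomp s t -> hits (X s) (X t) -> dot (X s) (X q) = dot (X t) (X q) ->
  dist3 (X s) (X q) + dist3 (X q) (X t) <= d -> arc_bound (X s) (X t) d.
Proof.
  intros [n1 n2] Hh E Hd. pose proof (X_outside s); pose proof (X_outside t); pose proof (X_outside q).
  apply arc_estimate; auto; [pose proof (dist3_triangle (X s) (X q) (X t)); lra |].
  intros [w [hw1 hw2]].
  assert (A := bisector_point_dist (X s) (X t) (X q) w hw1 hw2 ltac:(lra) ltac:(lra) E).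
  assert (B : sqrt (nrm (X t) ^ 2 - 1) <= dist3 (X t) (X q)).
  { apply (bisector_point_dist (X t) (X s) (X q) (1 - w)); try lra.
    replace (lin (1 - w) (X t) (X s)) with (lin w (X s) (X t)); [exact hw2 |].
    unfold lin; f_equal; [f_equal |]; ring. }
  rewrite (dist3_sym (X t)) in B. lra.
Qed.

Lemma arc_direct s t d : noncomp s t -> ~ hits (X s) (X t) -> dist3 (X s) (X t) <= d ->
  arc_bound (X s) (X t) d.
Proof.
  intros [n1 n2] Hh Hd; apply arc_estimate; auto; intros H; exfalso; apply Hh; exact H.
Qed.

(** If the segment meets the ball, the inscribed polygon receives the crossing point of [ivt_root]
    as an additional vertex. *)
Lemma arc_exists s t : s <= t -> noncomp s t ->
  exists l, incr s l /\ last l s = t /\ arc_bound (X s) (X t) (plen X s l).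
Proof.
  intros hst Hn. destruct (classic (hits (X s) (X t))) as [Hh | Hh].
  - destruct (hits_obtuse _ _ (X_outside s) (X_outside t) Hh) as [h1 h2].
    destruct (ivt_root (X s) (X t) s t hst h1 h2) as [q [hq E]].
    exists [q; t]; split; [simpl; lra | split; [reflexivity |]].
    apply (arc_through s t q); auto. simpl. rewrite (dist3_sym (X q) (X s)), (dist3_sym (X t) (X q)); lra.
  - exists [t]; split; [simpl; lra | split; [reflexivity |]].
    apply arc_direct; auto. simpl; rewrite (dist3_sym (X t)); lra.
Qed.

Lemma chain_exists s l : l <> [] -> incr s l ->
  (forall l1 u v l2, s :: l = l1 ++ u :: v :: l2 -> noncomp u v) ->
  exists m, incr s m /\ last m s = last l s /\ chain (X s) (map X l) (plen X s m).
Proof.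
  revert s; induction l as [| t l IH]; intros s Hne Hi Hn; [congruence |].
  destruct Hi as [hst Hi].
  destruct (arc_exists s t hst (Hn [] s t l eq_refl)) as [m1 [i1 [e1 b1]]].
  destruct l as [| u l].
  - exists m1; split; [exact i1 | split; [exact e1 |]]. apply chain_one; exact b1.
  - destruct (IH t ltac:(congruence) Hi) as [m2 [i2 [e2 b2]]].
    { intros l1 u' v' l2 E; apply (Hn (s :: l1) u' v' l2); rewrite E; reflexivity. }
    exists (m1 ++ m2); rewrite incr_app, last_app, plen_app, e1, e2.
    split; [split; assumption | split; [symmetry; apply (last_cons (u :: l)) |]].
    apply chain_cons; assumption.
Qed.

Lemma chain_snoc x l d y d' : chain x l d -> arc_bound (last l x) y d' -> chain x (l ++ [y]) (d + d').
Proof.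
  intros H; induction H as [x z d hb | x z l d d0 hb Hc IH]; intros Hy.
  - simpl in *. apply chain_cons; [exact hb | apply chain_one; exact Hy].
  - rewrite last_cons in Hy. simpl app. rewrite Rplus_assoc. apply chain_cons; [exact hb | apply IH; exact Hy].
Qed.

Lemma map_last (l : list R) s : last (map X l) (X s) = X (last l s).
Proof. revert s; induction l as [| t l IH]; intros s; [reflexivity |]. simpl map; rewrite !last_cons; apply IH. Qed.

Definition cover_times (l : list R) : Prop :=
  StronglySorted Rle l /\ List.Forall (fun t => a <= t <= b) l /\ covers (map X l).

Lemma StronglySorted_remove (l1 : list R) t l2 :
  StronglySorted Rle (l1 ++ t :: l2) -> StronglySorted Rle (l1 ++ l2).
Proof.
  induction l1 as [| s l1 IH]; simpl; intros H; apply StronglySorted_inv in H; destruct H as [H1 H2]; [exact H1 |].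
  constructor; [apply IH; exact H1 |].
  rewrite Forall_app in *; destruct H2 as [h1 h2]; split; [exact h1 | inversion h2; assumption].
Qed.

Lemma cover_remove l1 t l2 u : cover_times (l1 ++ t :: l2) -> In u (l1 ++ l2) ->
  (forall p, cap (X t) p -> cap (X u) p) -> cover_times (l1 ++ l2).
Proof.
  intros [H1 [H2 H3]] Hu Hc; split; [eapply StronglySorted_remove; exact H1 | split].
  - rewrite Forall_app in *; destruct H2 as [h1 h2]; split; [exact h1 | inversion h2; assumption].
  - intros p hp; destruct (H3 p hp) as [x [Hx cx]].
    rewrite in_map_iff in Hx; destruct Hx as [v [<- Hv]].
    apply in_app_or in Hv; destruct Hv as [Hv | [<- | Hv]].
    + exists (X v); split; [apply in_map, in_or_app; left; exact Hv | exact cx].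
    + exists (X u); split; [apply in_map; exact Hu | apply Hc; exact cx].
    + exists (X v); split; [apply in_map, in_or_app; right; exact Hv | exact cx].
Qed.

Lemma cover_minimal l : cover_times l -> exists m, cover_times m /\
  forall m', cover_times m' -> (length m <= length m')%nat.
Proof.
  remember (length l) as n eqn:En. revert l En.
  induction n as [n IH] using lt_wf_ind; intros l En Hl.
  destruct (classic (exists m', cover_times m' /\ (length m' < n)%nat)) as [[m' [h1 h2]] | h].
  - apply (IH _ h2 m' eq_refl h1).
  - exists l; split; [exact Hl |]. intros m' Hm'. apply Nat.nlt_ge; intros hlt; apply h; exists m'; split; [exact Hm' | lia].
Qed.

Lemma StronglySorted_incr s l : StronglySorted Rle (s :: l) -> incr s l.
Proof.
  revert s; induction l as [| t l IH]; intros s H; simpl; [exact I |].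
  apply StronglySorted_inv in H; destruct H as [H1 H2]; inversion H2; subst; auto.
Qed.

(* In a covering with the fewest members no cap contains another one. *)
Lemma minimal_cover l : cover_times l -> exists s m,
  cover_times (s :: m) /\ m <> [] /\ incr s m /\
  (forall l1 u v l2, s :: m = l1 ++ u :: v :: l2 -> noncomp u v) /\ noncomp (last m s) s.
Proof.
  intros H; destruct (cover_minimal l H) as [M [HM Hmin]].
  assert (key : forall l1 t l2 u, M = l1 ++ t :: l2 -> In u (l1 ++ l2) ->
     ~ (forall p, cap (X t) p -> cap (X u) p)).
  { intros l1 t l2 u -> Hu Hc. assert (L := Hmin _ (cover_remove l1 t l2 u HM Hu Hc)).
    rewrite !length_app in L; simpl in L; lia. }
  destruct M as [| s m].
  { destruct HM as [_ [_ Hc]]. destruct (Hc (1, 0, 0)) as [x [[] _]]. unfold dot; cbn [fst snd]; lra. }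
  assert (Hm : m <> []).
  { intros ->. destruct HM as [_ [_ Hc]].
    destruct (covers_misses _ (X s) Hc) as [x [Hx nx]].
    - rewrite <- nrm_sqr; pose proof (X_outside s); nra.
    - destruct Hx as [<- | []]. apply nx. apply cap_iff. rewrite <- nrm_sqr. pose proof (X_outside s); nra. }
  exists s, m; split; [exact HM | split; [exact Hm | split; [apply StronglySorted_incr, HM | split]]].
  - intros l1 u v l2 E; split.
    + apply (key l1 u (v :: l2) v E). apply in_or_app; right; left; reflexivity.
    + apply (key (l1 ++ [u]) v l2 u); [rewrite E, <- app_assoc; reflexivity |].
      apply in_or_app; left; apply in_or_app; right; left; reflexivity.
  - destruct (exists_last Hm) as [m' [e E]]. rewrite E, last_last. split.
    + apply (key (s :: m') e [] s); [rewrite E; reflexivity | left; reflexivity].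
    + apply (key [] s m e); [reflexivity |]. rewrite E; simpl; apply in_or_app; right; left; reflexivity.
Qed.

Lemma open_bound l : cover_times l ->
  exists m, incr a m /\ last m a = b /\ 2 * 3.951 <= plen X a m.
Proof.
  intros H; destruct (minimal_cover l H) as [s [m [Hc [Hm [Hi [Hn _]]]]]].
  destruct (chain_exists s m Hm Hi Hn) as [r [ir [er Hch]]].
  destruct Hc as [_ [Hab Hc]].
  assert (Hs : a <= s <= b) by (inversion Hab; assumption).
  assert (He : last m s <= b).
  { rewrite Forall_forall in Hab. apply Hab. pose proof (@exists_last _ m Hm) as [m' [e E]].
    rewrite E, last_last; right; apply in_or_app; right; left; reflexivity. }
  (* The first and the last piece only extend the polygon to [a] and [b]; their lengths are
     discarded. *)
  exists (s :: r ++ [b]); split; [| split].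
  - simpl; rewrite incr_app, er; simpl; repeat split; try lra; exact ir.
  - rewrite last_cons, last_last; reflexivity.
  - simpl plen; rewrite plen_app.
    pose proof (dist3_ge0 (X s) (X a)). pose proof (plen_ge0 X (last r s) [b]).
    destruct (chain_estimate _ _ _ Hch) as [f [f1 [f2 [f3 Hf]]]].
    destruct (open_numeric f f1) as [k [Psi [v [Hv [hv Hnum]]]]].
    specialize (Hf k Psi v Hv hv). rewrite map_last in *.
    assert (A := covering_open (X s) (map X m) Hc). rewrite map_last in A.
    rewrite !area_cap in A by apply X_outside.
    assert (N1 := Hnum _ f2). assert (N2 := Hnum _ f3).
    assert (K : k * (2 + / nrm (X s) + / nrm (X (last m s))) <= k * cap_dist_sum (X s) (map X m)).
    { apply Rmult_le_compat_l; [apply Hv | lra]. }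
    unfold Rdiv in *. lra.
Qed.

(** The closing arc runs from e to b and then from a to s. The sign of the linear function at the
    common point X a = X b decides on which of the two pieces it vanishes. *)
Lemma wrap_arc s e : a <= s -> e <= b -> X a = X b -> noncomp e s ->
  exists l1 l2, incr e l1 /\ last l1 e = b /\ incr a l2 /\ last l2 a = s /\
    arc_bound (X e) (X s) (plen X e l1 + plen X a l2).
Proof.
  intros hs he Hab Hn. destruct (classic (hits (X e) (X s))) as [Hh | Hh].
  - destruct (hits_obtuse _ _ (X_outside e) (X_outside s) Hh) as [h1 h2].
    destruct (Rle_lt_dec (dot (X e) (X b) - dot (X s) (X b)) 0) as [c | c].
    + destruct (ivt_root (X e) (X s) e b he h1 c) as [q [hq E]].
      exists [q; b], [s]; repeat split; simpl; try lra.
      apply (arc_through e s q); auto.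
      rewrite Hab. pose proof (dist3_triangle (X q) (X b) (X s)).
      rewrite (dist3_sym (X q) (X e)), (dist3_sym (X b) (X q)), (dist3_sym (X s) (X b)). lra.
    + rewrite <- Hab in c.
      destruct (ivt_root (X e) (X s) a s hs ltac:(lra) h2) as [q [hq E]].
      exists [b], [q; s]; repeat split; simpl; try lra.
      apply (arc_through e s q); auto.
      rewrite <- Hab. pose proof (dist3_triangle (X e) (X a) (X q)).
      rewrite (dist3_sym (X q) (X a)), (dist3_sym (X a) (X e)), (dist3_sym (X s) (X q)). lra.
  - exists [b], [s]; repeat split; simpl; try lra.
    apply arc_direct; auto. rewrite Hab. pose proof (dist3_triangle (X e) (X b) (X s)).
    rewrite (dist3_sym (X b) (X e)), (dist3_sym (X s) (X b)). lra.
Qed.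

Lemma closed_bound l : cover_times l -> X a = X b ->
  exists m, incr a m /\ last m a = b /\ 4 * tangent_ratio <= plen X a m.
Proof.
  intros H Hab; destruct (minimal_cover l H) as [s [m [Hc [Hm [Hi [Hn Hw]]]]]].
  destruct (chain_exists s m Hm Hi Hn) as [r [ir [er Hch]]].
  destruct Hc as [_ [HF Hc]].
  assert (Hs : a <= s <= b) by (inversion HF; assumption).
  assert (He : last m s <= b).
  { rewrite Forall_forall in HF. apply HF. pose proof (@exists_last _ m Hm) as [m' [e E]].
    rewrite E, last_last; right; apply in_or_app; right; left; reflexivity. }
  destruct (wrap_arc s (last m s) ltac:(lra) He Hab Hw) as [l1 [l2 [i1 [e1 [i2 [e2 Hb]]]]]].
  rewrite <- map_last in Hb at 1.
  assert (Hall := chain_snoc _ _ _ _ _ Hch Hb).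
  destruct (chain_estimate _ _ _ Hall) as [f [f1 [_ [_ Hf]]]].
  specialize (Hf tangent_ratio (fun _ => 0) 1 closed_weight f1).
  assert (A := covering_closed (X s) (map X m) Hc).
  (* In order of time the closing arc falls into two pieces, one at each end of [a, b]. *)
  exists (l2 ++ r ++ l1). rewrite !incr_app, !last_app, !plen_app, e2, er.
  split; [split; [exact i2 | split; [exact ir | exact i1]] | split; [exact e1 |]].
  pose proof tangent_ratio_bounds.
  apply Rmult_le_compat_l with (r := tangent_ratio) in A; [lra | lra].
Qed.

End Curve.

(** * Half-spaces, convex hulls and sampling of curves *)

Definition psub (p q : pt) : pt :=
  (fst (fst p) - fst (fst q), snd (fst p) - snd (fst q), snd p - snd q).

Lemma dist3_nrm p q : dist3 p q = nrm (psub p q).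
Proof.
  destruct p as [[a b] c], q as [[x y] z]; unfold dist3, nrm, dot, psub; cbn [fst snd]; f_equal; ring.
Qed.

Lemma dot_psub p q v : dot v (psub p q) = dot v p - dot v q.
Proof. unfold dot, psub; cbn [fst snd]; ring. Qed.

Lemma hull_halfspace (S : pt -> Prop) p v k : convex_hull S p -> k <= dot v p -> exists q, S q /\ k <= dot v q.
Proof.
  intros [n [w [q [Hw [H1 Hp]]]]] Hk. apply NNPP; intros H.
  assert (Hlt : forall i, (i < n)%nat -> dot v (q i) < k).
  { intros i hi; apply Rnot_le_lt; intros h; apply H; exists (q i); split; [apply Hw; exact hi | exact h]. }
  assert (E : dot v p = rsum n (fun i => w i * dot v (q i))).
  { rewrite Hp. clear. induction n as [| n IH]; [unfold dot; simpl; ring |].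
    simpl. rewrite <- IH. destruct (psum n _) as [[a b] c]. destruct (q n) as [[x y] z].
    unfold dot, pscale, padd; cbn [fst snd]; ring. }
  (* Points of weight zero give no strict inequality; it appears once the accumulated weight is
     positive. *)
  assert (K : forall m, (m <= n)%nat -> 0 <= rsum m w /\
     rsum m (fun i => w i * dot v (q i)) <= k * rsum m w /\
     (0 < rsum m w -> rsum m (fun i => w i * dot v (q i)) < k * rsum m w)).
  { induction m as [| m IH]; intros hm; [simpl; lra |].
    destruct (IH ltac:(lia)) as [a1 [a2 a3]]. destruct (Hw m ltac:(lia)) as [w0 _].
    specialize (Hlt m ltac:(lia)). simpl.
    assert (w m * dot v (q m) <= w m * k) by (apply Rmult_le_compat_l; lra).
    split; [lra | split; [lra |]]. intros hp.
    destruct (Rle_lt_or_eq_dec _ _ w0) as [c | c].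
    - assert (w m * dot v (q m) < w m * k) by (apply Rmult_lt_compat_l; lra). lra.
    - rewrite <- c in *. assert (Hpos : 0 < rsum m w) by lra. specialize (a3 Hpos). lra. }
  destruct (K n (Nat.le_refl n)) as [_ [_ K3]]. rewrite H1 in K3. lra.
Qed.

(** Extends the curve by constants, so that the intermediate value theorem and [Heine_cor2] can be
    applied to functions continuous on the whole line. *)
Definition clamp (a b t : R) : R := Rmax a (Rmin b t).

Lemma clamp_in a b t : a <= b -> a <= clamp a b t <= b.
Proof. intros; unfold clamp; split; [apply Rmax_l | apply Rmax_lub; [assumption | apply Rmin_l]]. Qed.

Lemma clamp_id a b t : a <= t <= b -> clamp a b t = t.
Proof. intros; unfold clamp; rewrite Rmin_right, Rmax_right; lra. Qed.

Lemma clamp_lip a b s t : a <= b -> Rabs (clamp a b s - clamp a b t) <= Rabs (s - t).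
Proof.
  intros; unfold clamp, Rmax, Rmin; repeat destruct (Rle_dec _ _); unfold Rabs; repeat destruct (Rcase_abs _); lra.
Qed.

Lemma lipschitz_curve_continuity g a b (f : pt -> R) K : a <= b -> continuous_on_ab g a b -> 0 < K ->
  (forall p q, Rabs (f p - f q) <= K * dist3 p q) -> continuity (fun t => f (g (clamp a b t))).
Proof.
  intros Hab Hg HK Hf t eps Heps.
  destruct (Hg (clamp a b t) (clamp_in a b t Hab) (eps / K)) as [d [hd Hd]].
  { apply Rdiv_lt_0_compat; lra. }
  exists d; split; [exact hd |]. intros s [_ Hs]; simpl in *; unfold Rdist in *.
  eapply Rle_lt_trans; [apply Hf |].
  assert (dist3 (g (clamp a b s)) (g (clamp a b t)) < eps / K).
  { apply Hd; [apply clamp_in; exact Hab |]. eapply Rle_lt_trans; [apply clamp_lip; exact Hab | exact Hs]. }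
  apply Rmult_lt_compat_l with (r := K) in H; [| exact HK].
  replace (K * (eps / K)) with eps in H by (field; lra). exact H.
Qed.

Lemma Rabs_dot_le v p : Rabs (dot v p) <= nrm v * nrm p.
Proof.
  unfold Rabs; destruct (Rcase_abs _); [| apply dot_le_nrm].
  assert (E : - dot v p = dot (psub (0, 0, 0) v) p) by (unfold dot, psub; cbn [fst snd]; ring).
  assert (F : nrm (psub (0, 0, 0) v) = nrm v) by (unfold nrm; f_equal; unfold dot, psub; cbn [fst snd]; ring).
  rewrite E, <- F; apply dot_le_nrm.
Qed.

Lemma dot_lipschitz v p q : Rabs (dot v p - dot v q) <= (nrm v + 1) * dist3 p q.
Proof.
  rewrite <- dot_psub, dist3_nrm. pose proof (nrm_ge0 (psub p q)).
  eapply Rle_trans; [apply Rabs_dot_le | nra].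
Qed.

Lemma dist3_lipschitz c p q : Rabs (dist3 p c - dist3 q c) <= 1 * dist3 p q.
Proof.
  pose proof (dist3_triangle p q c). pose proof (dist3_triangle q p c). rewrite (dist3_sym q p) in *.
  unfold Rabs; destruct (Rcase_abs _); lra.
Qed.

Lemma uniform_sampling (f1 f2 f3 : R -> R) a b eps : a <= b -> 0 < eps ->
  continuity f1 -> continuity f2 -> continuity f3 ->
  exists l, StronglySorted Rle l /\ List.Forall (fun t => a <= t <= b) l /\
    forall t, a <= t <= b -> exists u, In u l /\
      Rabs (f1 t - f1 u) < eps /\ Rabs (f2 t - f2 u) < eps /\ Rabs (f3 t - f3 u) < eps.
Proof.
  intros Hab He c1 c2 c3.
  destruct (Req_dec a b) as [-> | Hne].
  { exists [b]; split; [repeat constructor | split; [repeat constructor; lra |]].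
    intros t ht; assert (t = b) by lra; subst t; exists b; split; [left; reflexivity |].
    rewrite !Rminus_diag_eq, Rabs_R0 by reflexivity; lra. }
  destruct (Heine_cor2 (f := f1) (a := a) (b := b) (fun x _ => c1 x) (mkposreal eps He)) as [d1 H1].
  destruct (Heine_cor2 (f := f2) (a := a) (b := b) (fun x _ => c2 x) (mkposreal eps He)) as [d2 H2].
  destruct (Heine_cor2 (f := f3) (a := a) (b := b) (fun x _ => c3 x) (mkposreal eps He)) as [d3 H3].
  simpl in *.
  set (d := Rmin d1 (Rmin d2 d3)).
  assert (Hd : 0 < d) by (repeat apply Rmin_pos; apply cond_pos).
  assert (L1 : d <= d1) by apply Rmin_l.
  assert (L2 : d <= d2) by (eapply Rle_trans; [apply Rmin_r | apply Rmin_l]).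
  assert (L3 : d <= d3) by (eapply Rle_trans; [apply Rmin_r | apply Rmin_r]).
  destruct (nfloor_ex ((b - a) / d)) as [N [HN0 HN1]].
  { apply Rmult_le_pos; [lra | left; apply Rinv_0_lt_compat; exact Hd]. }
  assert (HNd : INR N * d <= b - a < (INR N + 1) * d).
  { split; apply (fun h => h); [apply Rmult_le_reg_r with (/ d) | apply Rmult_lt_reg_r with (/ d)];
      try (apply Rinv_0_lt_compat; exact Hd); rewrite Rmult_assoc, Rinv_r, Rmult_1_r by lra; assumption. }
  exists (map (fun i => a + INR i * d) (seq 0 (S N))).
  split; [| split].
  - generalize 0%nat as k. generalize (S N) as n. induction n as [| n IH]; intros k; simpl; constructor; [apply IH |].
    rewrite Forall_forall; intros x Hx; rewrite in_map_iff in Hx; destruct Hx as [i [<- Hi]].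
    apply in_seq in Hi. assert (INR k <= INR i) by (apply le_INR; lia). nra.
  - rewrite Forall_forall; intros x Hx; rewrite in_map_iff in Hx; destruct Hx as [i [<- Hi]].
    apply in_seq in Hi. assert (INR i <= INR N) by (apply le_INR; lia). pose proof (pos_INR i). nra.
  - intros t ht.
    destruct (nfloor_ex ((t - a) / d)) as [i [Hi0 Hi1]].
    { apply Rmult_le_pos; [lra | left; apply Rinv_0_lt_compat; exact Hd]. }
    assert (Et : t - a = (t - a) / d * d) by (field; lra).
    assert (Hi : INR i * d <= t - a < (INR i + 1) * d) by (rewrite Et; split; nra).
    assert (i < S N)%nat by (apply INR_lt; rewrite S_INR; nra).
    exists (a + INR i * d); split; [apply in_map_iff; exists i; split; [reflexivity | apply in_seq; lia] |].
    assert (Ha : a <= a + INR i * d <= b) by (pose proof (pos_INR i); nra).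
    assert (Rabs (t - (a + INR i * d)) < d) by (rewrite Rabs_right; lra).
    split; [apply H1 | split; [apply H2 | apply H3]]; lra.
Qed.

Lemma nrm_pscale k p : 0 <= k -> nrm (pscale k p) = k * nrm p.
Proof.
  intros hk; unfold nrm. replace (dot (pscale k p) (pscale k p)) with (k ^ 2 * dot p p).
  - rewrite sqrt_mult_alt by nra. rewrite sqrt_pow2 by exact hk; reflexivity.
  - destruct p as [[x y] z]; unfold dot, pscale; cbn [fst snd]; ring.
Qed.

Lemma dot_pscale k v p : dot v (pscale k p) = k * dot v p.
Proof. destruct p as [[x y] z]; unfold dot, pscale; cbn [fst snd]; ring. Qed.

Lemma plen_scale (g X : R -> pt) k a b s l : 0 <= k -> a <= s -> incr s l -> last l s <= b ->
  (forall t u, a <= t <= b -> a <= u <= b -> dist3 (g t) (g u) = k * dist3 (X t) (X u)) ->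
  plen g s l = k * plen X s l.
Proof.
  intros hk; revert s; induction l as [| t l IH]; intros s ha Hi Hl H; simpl; [ring |].
  rewrite last_cons in Hl. destruct Hi as [h1 h2]. pose proof (incr_last t l h2).
  rewrite (IH t) by (auto; lra). rewrite H by lra. ring.
Qed.

(** * The bound for one admissible sphere *)

Section Inradius.
Variables (g : R -> pt) (a b rho L : R) (c : pt).
Hypothesis Hg : is_curve g a b.
Hypothesis HL : curve_length g a b = Finite L.
Hypothesis Hrho : 0 < rho.
Hypothesis Hhull : forall p, sphere c rho p -> convex_hull (image g a b) p.
Hypothesis Hdisj : forall p, sphere c rho p -> ~ image g a b p.

Let Hab : a <= b := proj1 Hg.

Lemma halfspace_reached v : nrm v = 1 -> exists t, a <= t <= b /\ rho <= dot v (psub (g t) c).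
Proof.
  intros Hv.
  set (p := padd c (pscale rho v)).
  assert (Hp : sphere c rho p).
  { unfold sphere. rewrite dist3_nrm. replace (psub p c) with (pscale rho v).
    - rewrite nrm_pscale by lra; rewrite Hv; ring.
    - unfold p, psub, padd, pscale; destruct c as [[c1 c2] c3], v as [[x y] z]; cbn [fst snd].
      f_equal; [f_equal |]; ring. }
  destruct (hull_halfspace _ p v (dot v c + rho) (Hhull p Hp)) as [q [[t [Ht <-]] Hq]].
  - assert (E := nrm_sqr v). rewrite Hv in E.
    replace (dot v p) with (dot v c + rho * dot v v).
    + rewrite <- E; lra.
    + unfold p, padd, pscale; destruct c as [[c1 c2] c3], v as [[x y] z]; unfold dot; cbn [fst snd]; ring.
  - exists t; split; [exact Ht |]. rewrite dot_psub; lra.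
Qed.

(** Disjointness is assumed from the sphere only. A curve with a point inside would have to cross
    the sphere, since it also reaches a half-space beyond a tangent plane. *)
Lemma curve_outside t : a <= t <= b -> rho < dist3 (g t) c.
Proof.
  intros Ht.
  assert (Hne : forall u, a <= u <= b -> dist3 (g u) c <> rho).
  { intros u Hu E; apply (Hdisj (g u) E); exists u; auto. }
  apply Rnot_le_lt; intros h.
  assert (Hv : nrm (1, 0, 0) = 1).
  { unfold nrm, dot; cbn [fst snd]; replace (1 * 1 + 0 * 0 + 0 * 0) with 1 by ring; apply sqrt_1. }
  destruct (halfspace_reached _ Hv) as [u [Hu hu]].
  assert (rho <= dist3 (g u) c).
  { rewrite dist3_nrm. pose proof (dot_le_nrm (1, 0, 0) (psub (g u) c)). rewrite Hv in H; lra. }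
  assert (Hc : continuity (fun t => dist3 (g (clamp a b t)) c)).
  { apply (lipschitz_curve_continuity g a b (fun p => dist3 p c) 1); [exact Hab | apply Hg | lra |].
    intros; apply dist3_lipschitz. }
  destruct (IVT_gen _ t u rho Hc) as [w [Hw E]].
  - rewrite !clamp_id by assumption. rewrite Rmin_left, Rmax_right; lra.
  - assert (a <= w <= b).
    { destruct Hw as [w1 w2]. unfold Rmin, Rmax in *; destruct (Rle_dec t u); lra. }
    rewrite clamp_id in E by assumption. exact (Hne w H0 E).
Qed.

Section Scaled.
Variable sigma : R.
Hypothesis Hsigma : 0 < sigma < rho.

Let X (t : R) : pt := pscale (/ sigma) (psub (g (clamp a b t)) c).

Lemma scaled_outside t : 1 < nrm (X t).
Proof.
  unfold X; rewrite nrm_pscale by (left; apply Rinv_0_lt_compat; lra).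
  rewrite <- dist3_nrm. assert (H := curve_outside (clamp a b t) (clamp_in a b t Hab)).
  apply Rmult_lt_reg_l with sigma; [lra |]. rewrite <- Rmult_assoc, Rinv_r; lra.
Qed.

Lemma scaled_continuous v : continuity (fun t => dot v (X t)).
Proof.
  unfold X.
  assert (Hi : 0 < / sigma) by (apply Rinv_0_lt_compat; lra).
  pose proof (nrm_ge0 v).
  apply (lipschitz_curve_continuity g a b (fun p => dot v (pscale (/ sigma) (psub p c))) (/ sigma * (nrm v + 1)));
    [exact Hab | apply Hg | nra |].
  intros p q. rewrite !dot_pscale, !dot_psub.
  replace (/ sigma * (dot v p - dot v c) - / sigma * (dot v q - dot v c)) with (/ sigma * (dot v p - dot v q)) by ring.
  rewrite Rabs_mult, (Rabs_right (/ sigma)) by lra. rewrite Rmult_assoc.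
  apply Rmult_le_compat_l; [lra | apply dot_lipschitz].
Qed.

Lemma scaled_dist t u : a <= t <= b -> a <= u <= b -> dist3 (g t) (g u) = sigma * dist3 (X t) (X u).
Proof.
  intros ht hu; rewrite (dist3_nrm (X t)).
  replace (psub (X t) (X u)) with (pscale (/ sigma) (psub (g t) (g u))).
  - rewrite nrm_pscale by (left; apply Rinv_0_lt_compat; lra).
    rewrite <- dist3_nrm; field; lra.
  - unfold X; rewrite !clamp_id by assumption.
    destruct (g t) as [[x y] z], (g u) as [[x' y'] z'], c as [[c1 c2] c3].
    unfold psub, pscale; cbn [fst snd]; f_equal; [f_equal |]; ring.
Qed.

Lemma scaled_cover : exists l, cover_times X a b l.
Proof.
  set (f (v : pt) (t : R) := dot v (g (clamp a b t))).
  assert (Hf : forall v, continuity (f v)).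
  { intros v; pose proof (nrm_ge0 v).
    apply (lipschitz_curve_continuity g a b (fun p => dot v p) (nrm v + 1)); [exact Hab | apply Hg | lra | apply dot_lipschitz]. }
  (* An error of (rho - sigma)/3 in each coordinate changes the product with a unit vector by at
     most rho - sigma. *)
  destruct (uniform_sampling (f (1, 0, 0)) (f (0, 1, 0)) (f (0, 0, 1)) a b ((rho - sigma) / 3) Hab ltac:(lra)
     (Hf _) (Hf _) (Hf _)) as [l [H1 [H2 H3]]].
  exists l; split; [exact H1 | split; [exact H2 |]].
  intros p hp.
  assert (np := sqrt_lt_R0 _ hp). fold (nrm p) in np.
  set (v := pscale (/ nrm p) p).
  assert (Hv : nrm v = 1).
  { unfold v; rewrite nrm_pscale by (left; apply Rinv_0_lt_compat; lra). field; lra. }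
  destruct (halfspace_reached v Hv) as [t [Ht ht]].
  destruct (H3 t Ht) as [u [Hu [e1 [e2 e3]]]].
  exists (X u); split; [apply in_map; exact Hu |].
  rewrite Forall_forall in H2. specialize (H2 u Hu).
  unfold f in e1, e2, e3; rewrite !clamp_id in e1, e2, e3 by assumption.
  assert (Hd : sigma <= dot v (psub (g u) c)).
  { assert (E := nrm_sqr v). rewrite Hv in E.
    rewrite dot_psub in *.
    destruct v as [[x y] z], (g t) as [[t1 t2] t3], (g u) as [[u1 u2] u3].
    unfold dot in *; cbn [fst snd] in *.
    assert (Rabs x <= 1) by (apply Rabs_le; nra). assert (Rabs y <= 1) by (apply Rabs_le; nra).
    assert (Rabs z <= 1) by (apply Rabs_le; nra).
    replace (1 * t1 + 0 * t2 + 0 * t3 - (1 * u1 + 0 * u2 + 0 * u3)) with (t1 - u1) in e1 by ring.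
    replace (0 * t1 + 1 * t2 + 0 * t3 - (0 * u1 + 1 * u2 + 0 * u3)) with (t2 - u2) in e2 by ring.
    replace (0 * t1 + 0 * t2 + 1 * t3 - (0 * u1 + 0 * u2 + 1 * u3)) with (t3 - u3) in e3 by ring.
    assert (P : forall r s, Rabs r <= 1 -> Rabs s < (rho - sigma) / 3 -> r * s <= (rho - sigma) / 3).
    { intros r s hr hs. apply Rle_trans with (Rabs (r * s)); [apply Rle_abs |]. rewrite Rabs_mult.
      pose proof (Rabs_pos r); pose proof (Rabs_pos s). nra. }
    assert (P1 := P x (t1 - u1) H e1). assert (P2 := P y (t2 - u2) H0 e2). assert (P3 := P z (t3 - u3) H4 e3).
    lra. }
  apply cap_iff. unfold X; rewrite clamp_id by exact H2.
  rewrite dot_sym, dot_pscale.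
  assert (Ev : dot p (psub (g u) c) = nrm p * dot v (psub (g u) c)).
  { unfold v; rewrite (dot_sym (pscale _ p)), dot_pscale, (dot_sym _ p); field; lra. }
  rewrite Ev. apply Rmult_le_reg_l with sigma; [lra |].
  replace (sigma * (/ sigma * (nrm p * dot v (psub (g u) c)))) with (nrm p * dot v (psub (g u) c)) by (field; lra).
  nra.
Qed.

Lemma scaled_length l : incr a l -> last l a = b -> sigma * plen X a l <= L.
Proof.
  intros Hi Hl. rewrite <- (plen_scale g X sigma a b a l); try lra; auto.
  - apply (plen_le_length g a b); assumption.
  - exact scaled_dist.
Qed.

Lemma scaled_open : sigma * (2 * 3.951) <= L.
Proof.
  destruct scaled_cover as [l Hl].
  destruct (open_bound X a b scaled_outside scaled_continuous l Hl) as [m [h1 [h2 h3]]].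
  assert (S := scaled_length m h1 h2). nra.
Qed.

Lemma scaled_closed : g a = g b -> sigma * (4 * tangent_ratio) <= L.
Proof.
  intros E. destruct scaled_cover as [l Hl].
  assert (EX : X a = X b) by (unfold X; rewrite !clamp_id by lra; rewrite E; reflexivity).
  destruct (closed_bound X a b scaled_outside scaled_continuous l Hl EX) as [m [h1 [h2 h3]]].
  assert (S := scaled_length m h1 h2). nra.
Qed.

End Scaled.

Lemma limit_bound K : 0 < K -> (forall sigma, 0 < sigma < rho -> sigma * K <= L) -> K * rho <= L.
Proof.
  intros HK H. apply Rnot_lt_le; intros h.
  assert (H1 := H (rho / 2) ltac:(lra)).
  assert (E : L / K < rho).
  { apply Rmult_lt_reg_r with K; [exact HK |]. unfold Rdiv; rewrite Rmult_assoc, Rinv_l; lra. }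
  assert (E0 : rho / 2 <= L / K).
  { apply Rmult_le_reg_r with K; [exact HK |]. unfold Rdiv at 2; rewrite Rmult_assoc, Rinv_l; lra. }
  assert (H2 := H ((L / K + rho) / 2) ltac:(lra)).
  assert ((L / K + rho) / 2 <= L / K); [| lra].
  apply Rmult_le_reg_r with K; [exact HK |]. unfold Rdiv at 3; rewrite (Rmult_assoc L), Rinv_l; lra.
Qed.

Lemma open_inradius : 2 * 3.951 * rho <= L.
Proof. apply limit_bound; [lra | intros; apply scaled_open; assumption]. Qed.

Lemma closed_inradius : g a = g b -> 4 * tangent_ratio * rho <= L.
Proof. intros E; apply limit_bound; [pose proof tangent_ratio_bounds; lra | intros; apply scaled_closed; assumption]. Qed.

End Inradius.

Lemma inradius_mult_le g a b L K : 0 < K -> (forall rho, admissible_radius g a b rho -> K * rho <= L) ->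
  Rbar_le (Rbar_mult K (inradius g a b)) L.
Proof.
  intros HK H.
  assert (Hub : Rbar_le (inradius g a b) (L / K)).
  { apply (proj2 (Lub_Rbar_correct (admissible_radius g a b))). intros r Hr; simpl.
    apply Rmult_le_reg_r with K; [exact HK |]. specialize (H r Hr).
    unfold Rdiv; rewrite Rmult_assoc, Rinv_l; lra. }
  destruct (inradius g a b) as [r | |]; simpl in Hub; [| contradiction |].
  - simpl. apply Rmult_le_compat_l with (r := K) in Hub; [| lra].
    replace (K * (L / K)) with L in Hub by (field; lra). exact Hub.
  (* Without admissible radii the supremum is [m_infty], and so is its product with K > 0. *)
  - rewrite Rbar_mult_comm. simpl. destruct (Rle_dec 0 K) as [h | h]; [| lra].
    destruct (Rle_lt_or_eq_dec 0 K h); [exact I | lra].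
Qed.

Theorem theorem1p2 (g : R -> pt) (a b : R) :
  is_curve g a b -> rectifiable g a b ->
  Rbar_le (Rbar_mult (sqrt ((PI + 2)^2 + 36)) (inradius g a b)) (curve_length g a b) /\
  (g a = g b ->
   Rbar_le (Rbar_mult (6 * sqrt 3) (inradius g a b)) (curve_length g a b)).
Proof.
  intros Hg Hr. unfold rectifiable, is_finite in Hr. set (L := real (curve_length g a b)) in *.
  assert (HL : curve_length g a b = Finite L) by (symmetry; exact Hr).
  rewrite HL. split; [| intros E]; apply inradius_mult_le.
  - apply sqrt_lt_R0; pose proof PI_RGT_0; nra.
  - intros rho [h0 [c [h1 h2]]].
    assert (B := open_inradius g a b rho L c Hg HL h0 h1 h2).
    pose proof open_constant. nra.
  - pose proof (sqrt_lt_R0 3 ltac:(lra)); lra.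
  - intros rho [h0 [c [h1 h2]]].
    assert (B := closed_inradius g a b rho L c Hg HL h0 h1 h2 E).
    unfold tangent_ratio in B. lra.
Qed.
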